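(* For every $\omega_0\in M(\overline{\mathbb{R}^2_+})$ and every $1\le q\le\infty$, $$\lim_{t\to\infty}t^{1-1/q}\|T(t)\omega_0\|_{L^q(\mathbb{R}^2_+)}=0.$$
   Context: $\mathbb{R}^2_+=\{x_2>0\}$; $M(\overline{\mathbb{R}^2_+})$ is the space of finite real regular Borel measures on $\overline{\mathbb{R}^2_+}$. $\nabla^\perp=(\partial_2,-\partial_1)$, $\nabla^\perp\cdot u=\partial_2u^1-\partial_1u^2$, $y^*=(y_1,-y_2)$, $E(x)=-\frac1{2\pi}\log|x|$, $D(x,y)=E(x-y)-E(x-y^* )$, $K\mu(x)=\int_{\mathbb{R}^2_+}\nabla^\perp_xD(x,y)\mu(dy)$. $S(t)$ is the Stokes semigroup on $\mathbb{R}^2_+$ with Dirichlet boundary condition, $S(t)u_0=\int_{\mathbb{R}^2_+}G(x,z,t)u_0(z)dz$ with $\Gamma(x,t)=\frac1{4\pi t}e^{-|x|^2/4t}$ and $$G_{ij}(x,z,t)=(\Gamma(x-z,t)-\Gamma(x-z^*,t))\delta_{ij}-4(1-\delta_{j2})\partial_{x_j}\int_0^{x_2}\int_{\mathbb{R}}\partial_{x_i}E(x-w)\Gamma(w-z^*,t)\,dw_1dw_2,$$ and $T(t)=-\nabla^\perp\cdot S(t)K$ for $t>0$. *)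

(* Defs.v *)
From HB Require Import structures.
From mathcomp Require Import all_boot all_order all_algebra.
From mathcomp Require Import all_classical all_reals all_analysis.

Set Implicit Arguments.
Unset Strict Implicit.
Unset Printing Implicit Defensive.

Import Order.TTheory GRing.Theory Num.Theory numFieldNormedType.Exports.

Local Open Scope classical_set_scope.
Local Open Scope ring_scope.

(* lebesgue_measure is a measure on measurableTypeR R, an alias of R that carries
   the Borel sigma-algebra; its square carries the Borel sigma-algebra of the
   plane, and its points are elements of R * R. *)
Notation plane R := (measurableTypeR R * measurableTypeR R)%type.

(* Coordinate and component indices 1, 2 are represented by 0, 1 : 'I_2. A vector
   field is a family of two scalar functions. In the usual notation, fund_sol is
   E, green_fun is D, biot_savart is K, heat_kernel is Gamma, stokes_kernel is G,
   stokes_sgroup is S and vorticity_op is T.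
   The derivatives below are classical. Where one does not exist (E at the
   origin, hence D on the diagonal), or an integrand is not integrable, the
   library gives an unspecified real number; this only matters on null sets:
   the x at which K mu x diverges, and the line w2 = x.2. *)
Section HalfPlaneStokes.
Context {R : realType}.
Implicit Types (x y z w : R * R) (t : R) (f : R * R -> R).
Implicit Types (u : 'I_2 -> R * R -> R) (i j : 'I_2).

Definition half_plane : set (R * R) := [set x | 0 < x.2].
Definition closed_half_plane : set (R * R) := [set x | 0 <= x.2].

Definition lebesgue2 : {measure set (plane R) -> \bar R} :=
  (@lebesgue_measure R \x @lebesgue_measure R)%E.

(* M(\overline{R^2_+}): a finite signed Borel measure on the closed half plane
   is given by its extension by zero to the plane. Finiteness and sigma-additivity
   are part of the type of charges; every finite Borel measure on the plane is
   regular. *)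
Definition supported_in_closed_half_plane
    (mu : {charge set (plane R) -> \bar R}) : Prop :=
  forall A : set (plane R), measurable A ->
    A `&` closed_half_plane = set0 -> mu A = 0%E.

Lemma Hahn_pair (mu : {charge set (plane R) -> \bar R}) :
  exists PN : set (R * R) * set (R * R), hahn_decomposition mu PN.1 PN.2.
Proof. by have [P [N PN]] := Hahn_decomposition mu; exists (P, N). Qed.

(* The Jordan decomposition, hence the value below, does not depend on the Hahn
   decomposition that is chosen ([Hahn_decomposition_uniq]). *)
Definition charge_integral (mu : {charge set (plane R) -> \bar R})
    (A : set (R * R)) f : R :=
  let hahn := projT2 (cid (Hahn_pair mu)) in
  \int[jordan_pos hahn]_(y in A) f y - \int[jordan_neg hahn]_(y in A) f y.

(* The norm `|x| of R * R is the sup norm. *)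
Definition eucl_norm x : R := Num.sqrt (x.1 ^+ 2 + x.2 ^+ 2).

Definition refl x : R * R := (x.1, - x.2).

Definition basis_vec i : R * R := if i == 0 then (1, 0) else (0, 1).

Definition partial i f x : R := 'D_(basis_vec i) f x.

Definition grad_perp f : 'I_2 -> R * R -> R :=
  fun i => if i == 0 then partial 1 f else \- partial 0 f.

Definition div_perp u x : R := partial 1 (u 0) x - partial 0 (u 1) x.

Definition fund_sol x : R := - (2 * pi)^-1 * ln (eucl_norm x).

Definition green_fun x y : R := fund_sol (x - y) - fund_sol (x - refl y).

Definition biot_savart (mu : {charge set (plane R) -> \bar R}) :
    'I_2 -> R * R -> R :=
  fun i x => charge_integral mu half_plane
    (fun y => grad_perp (fun x' => green_fun x' y) i x).

Definition heat_kernel x t : R :=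
  (4 * pi * t)^-1 * expR (- (eucl_norm x ^+ 2 / (4 * t))).

Definition stokes_kernel i j x z t : R :=
  (heat_kernel (x - z) t - heat_kernel (x - refl z) t) * (i == j)%:R
  - 4 * (1 - (j == 1)%:R) *
    partial j (fun x' =>
      \int[lebesgue_measure]_(w2 in `]0, x'.2[)
        \int[lebesgue_measure]_w1
          (partial i (fun x'' => fund_sol (x'' - (w1, w2))) x'
           * heat_kernel ((w1, w2) - refl z) t)) x.

Definition stokes_sgroup t u : 'I_2 -> R * R -> R :=
  fun i x => \int[lebesgue2]_(z in half_plane)
    \sum_j stokes_kernel i j x z t * u j z.

Definition vorticity_op t (mu : {charge set (plane R) -> \bar R}) :
    R * R -> R :=
  fun x => - div_perp (stokes_sgroup t (biot_savart mu)) x.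

(* f is extended by zero outside the half plane. *)
Definition Lq_norm (q : \bar R) f : \bar R :=
  'N[lebesgue2]_q[(EFin \o f) \_ half_plane].

End HalfPlaneStokes.

(* Main.v *)
(** The operator [T(t)] has an explicit kernel. Write [x = (x1, a)],
    [y = (y1, b)], [xi = x1 - y1], let [g] be the one-dimensional heat kernel at
    time [t], and let [C s] be the convolution of [g] with the Poisson kernel
    [s / (pi (s^2 + r^2))]. Then [T(t) omega (x)] is the integral of
    [W(x, y) omega(dy)], where
      [W(x, y) = g xi (g (a - b) - g (a + b))
                 + 2 \int_0^b g' (a + z) C (b - z) xi dz].
    Indeed [nabla^perp D] consists of Poisson kernels and their conjugates in the
    first coordinate, the curl of the Stokes kernel consists of [g], [g'] and
    [d/ds C] at [s = 0], and Poisson kernels act on Fourier integrals in [x1] by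
    multiplication by [exp (- k |s|)]; once [z1] is integrated out, the remaining
    integrand in [z2] is an exact derivative on either side of [z2 = b], up to
    the last term of [W] for [z2 < b].
    Since [g] has Lipschitz constant of order [1/t], the kernel satisfies
    [t |W(x, y)| <= C kappa] and [\int |W(x, y)| dx <= C kappa] with
    [kappa = min (1, c b / sqrt t)]: it vanishes on the boundary [b = 0]. By
    dominated convergence [\int kappa d|omega|] tends to [0] as [t] tends to
    infinity, and interpolating between the sup norm and the [L^1] norm gives
    every exponent [q]. *)

(* The velocity [K omega] is in general not integrable over the half plane. What saves the exchanges
   of integrals is that each of its components is a combination of Poisson kernels in one of the two
   coordinates, with mass at most 1 in that coordinate whatever the position of the source; only the
   other coordinate needs a weight. The weights are exp(- z2) for the first component and exp(-
   |z1|) for the second, and for fixed x the coefficients that multiply these components in S(t) and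
   in its curl decay at least as fast. The nonlocal double integral of the Stokes kernel enters both
   terms of the curl through the same function [Mcos 2], with opposite signs, and cancels. What
   survives of it is the boundary term that arises when the upper limit x2 is differentiated. Both
   bounds on W rest on the same facts: in x1 the kernels are probability densities of height at most
   g(0), and in x2 only increments of g occur. Since t g(0)^2 does not depend on t, the sup bound
   and the L^1 bound combine into one estimate that is uniform in q. *)
Require Import Defs.
From HB Require Import structures.
From mathcomp Require Import all_boot all_order all_algebra.
From mathcomp Require Import all_classical all_reals all_analysis.
From mathcomp Require Import measurable_realfun ess_sup_inf.
From mathcomp Require Import ring lra.

Import Order.TTheory GRing.Theory Num.Theory numFieldNormedType.Exports.

Local Open Scope classical_set_scope.
Local Open Scope ring_scope.

Set Implicit Arguments.
Unset Strict Implicit.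
Unset Printing Implicit Defensive.

(** * Integrals depending on a parameter, Fubini and Tonelli *)

Section integration.
Context {R : realType}.

Section one_measure.
Context d (T : measurableType d) (mu : {measure set T -> \bar R}).
Implicit Types (D : set T) (f g : T -> R).

Lemma le_integrable_EFin D f g : measurable D -> measurable_fun D f ->
  mu.-integrable D (EFin \o g) -> (forall x, D x -> `|f x| <= g x) ->
  mu.-integrable D (EFin \o f).
Proof.
move=> mD mf ig fg; apply: le_integrable ig => //; first exact/measurable_EFinP.
move=> x Dx /=; rewrite lee_fin.
exact: le_trans (fg _ Dx) (ler_norm _).
Qed.

Lemma integrableZl_EFin D f c : measurable D ->
  mu.-integrable D (EFin \o f) -> mu.-integrable D (EFin \o (fun x => c * f x)).
Proof.
by move=> mD /(integrableZl mD c); apply: eq_integrable.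
Qed.

Lemma integrableN_EFin D f : measurable D ->
  mu.-integrable D (EFin \o f) -> mu.-integrable D (EFin \o (fun x => - f x)).
Proof.
move=> mD /(integrableZl_EFin (-1) mD); apply: eq_integrable => // x _ /=.
by rewrite mulN1r.
Qed.

Lemma integrableD_EFin D f g : measurable D ->
  mu.-integrable D (EFin \o f) -> mu.-integrable D (EFin \o g) ->
  mu.-integrable D (EFin \o (fun x => f x + g x)).
Proof.
move=> mD fi gi; have := integrableD mD fi gi.
by apply: eq_integrable => // x _ /=; rewrite EFinD.
Qed.

Lemma integrableB_EFin D f g : measurable D ->
  mu.-integrable D (EFin \o f) -> mu.-integrable D (EFin \o g) ->
  mu.-integrable D (EFin \o (fun x => f x - g x)).
Proof.
by move=> mD fi gi; apply: integrableD_EFin => //; exact: integrableN_EFin.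
Qed.

Lemma integrable_EFin_measurable D f : measurable D -> mu.-integrable D (EFin \o f) ->
  measurable_fun D f.
Proof. by move=> mD /measurable_int/measurable_EFinP. Qed.

Lemma RintegralN D f : measurable D -> mu.-integrable D (EFin \o f) ->
  \int[mu]_(x in D) (- f x) = - \int[mu]_(x in D) f x.
Proof.
move=> mD fi; rewrite -mulN1r -RintegralZl//.
by apply: eq_Rintegral => x _; rewrite mulN1r.
Qed.

Lemma le_normr_Rintegral_dom D f g : measurable D ->
  measurable_fun D f -> mu.-integrable D (EFin \o g) ->
  (forall x, D x -> `|f x| <= g x) ->
  `|\int[mu]_(x in D) f x| <= \int[mu]_(x in D) g x.
Proof.
move=> mD mf gi fg; have fi := le_integrable_EFin mD mf gi fg.
apply: (le_trans (le_normr_Rintegral mD fi)).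
apply: le_Rintegral => //; exact: (integrable_norm fi).
Qed.

(** The derivative [df] is prescribed and the domination is local, on an interval around [a]: the
    constants of the applications depend on how far the parameter may move. *)
Lemma is_derive_Rintegral (f df : R -> T -> R) (G : T -> R) D (a u v : R) :
  measurable D -> u < a -> a < v ->
  (forall x, u < x -> x < v -> mu.-integrable D (EFin \o f x)) ->
  (forall x y, u < x -> x < v -> D y -> is_derive x 1 (f ^~ y) (df x y)) ->
  mu.-integrable D (EFin \o G) ->
  (forall x y, u < x -> x < v -> D y -> `|df x y| <= G y) ->
  is_derive a 1 (fun x => \int[mu]_(y in D) f x y) (\int[mu]_(y in D) df a y).
Proof.
move=> mD ua av fi fd Gi dfG.
have Ia : `]u, v[%classic a by rewrite /= in_itv /= ua av.
have intf x : `]u, v[%classic x -> mu.-integrable D (EFin \o f x).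
  by rewrite /= in_itv /= => /andP[]; exact: fi.
have derf x y : `]u, v[%classic x -> D y -> derivable (f ^~ y) x 1.
  by rewrite /= in_itv /= => /andP[ux xv] Dy; have [] := fd x y ux xv Dy.
have dE x y : `]u, v[%classic x -> D y -> partial1of2 f x y = df x y.
  rewrite /= in_itv /= => /andP[ux xv] Dy; rewrite partial1of2E.
  by have [_ ->] := fd x y ux xv Dy.
(* The dominating function has to be nonnegative everywhere, while [G] is known to be so only on
   [D]. *)
have Gi' : mu.-integrable D (EFin \o (fun y => `|G y|)) by exact: integrable_norm Gi.
have Gub x y : `]u, v[%classic x -> D y -> `|partial1of2 f x y| <= `|G y|.
  move=> Ix Dy; rewrite dE//; move: Ix; rewrite /= in_itv /= => /andP[ux xv].
  by apply: (le_trans (dfG _ _ ux xv Dy)); rewrite ler_norm.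
have Gge0 y : 0 <= `|G y| by exact: normr_ge0.
apply: DeriveDef.
  exact: (derivable_under_integral mD Ia intf derf Gge0 Gi' Gub).
rewrite -derive1E (differentiation_under_integral mD Ia intf derf Gge0 Gi' Gub).
by apply: eq_Rintegral => y; rewrite inE => Dy; rewrite dE.
Qed.

(** Dominated convergence with [|f|] as the bound. It extends the fundamental theorem of calculus to
    half lines for integrands that change sign. *)
Lemma cvg_Rintegral_exhaustion D (A : nat -> set T) f : measurable D ->
  (forall n, measurable (A n)) -> (forall n, A n `<=` D) ->
  (forall x, D x -> \forall n \near \oo, A n x) ->
  mu.-integrable D (EFin \o f) ->
  \int[mu]_(x in A n) f x @[n --> \oo] --> \int[mu]_(x in D) f x.
Proof.
move=> mD mA AD DA fi.
pose f_ n x := ((f \_ (A n)) x)%:E.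
have mf : measurable_fun D f by exact: integrable_EFin_measurable.
have mf_ n : measurable_fun D (f_ n).
  apply/measurable_EFinP.
  apply: (measurable_restrict f (mA n) mD).1.
  by apply: measurable_funS mf => //; exact: subIsetl.
have [_ _ +] : [/\ mu.-integrable D (EFin \o f),
   (\int[mu]_(x in D) `|f_ n x - (EFin \o f) x|)%E @[n --> \oo] --> 0%E &
   (\int[mu]_(x in D) f_ n x)%E @[n --> \oo] --> (\int[mu]_(x in D) (EFin \o f) x)%E].
  apply: (@dominated_convergence _ _ _ mu D mD f_ (EFin \o f) (EFin \o (fun x => `|f x|))) => //.
  - exact/measurable_EFinP.
  - apply/aeW => x Dx; apply: cvg_near_cst; apply: filterS (DA x Dx) => n Anx.
    by rewrite /f_ patchE mem_set.
  - exact: integrable_norm fi.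
  - apply/aeW => x n Dx; rewrite /f_ /= lee_fin patchE.
    by case: ifP => // _; rewrite normr0.
move=> cv.
apply: fine_cvg.
have intfin : (\int[mu]_(x in D) (EFin \o f) x)%E \is a fin_num.
  exact: integrable_fin_num.
rewrite fineK//.
apply: cvg_trans cv; apply: near_eq_cvg; near=> n.
rewrite -[in RHS](setIidr (AD n)) integral_mkcondr; apply: eq_integral => x _; rewrite /f_ !patchE; case: ifP.
Unshelve. all: by end_near. Qed.

End one_measure.

Section two_measures.
Context d1 d2 (T1 : measurableType d1) (T2 : measurableType d2).
Variables (m1 : {sigma_finite_measure set T1 -> \bar R})
  (m2 : {sigma_finite_measure set T2 -> \bar R}).
Implicit Types (A : set T1) (B : set T2) (f : T1 -> T2 -> R).

(** No integrability is required: the integral is [fine] of a difference of two integrals of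
    nonnegative functions, and each of them is measurable in the parameter by Tonelli. *)
Lemma measurable_Rintegral_param B f : measurable B ->
  measurable_fun setT (fun p : T1 * T2 => f p.1 p.2) ->
  measurable_fun setT (fun x => \int[m2]_(y in B) f x y).
Proof.
move=> mB mf.
pose h (p : T1 * T2) : R := ((f p.1) \_ B) p.2.
have mh : measurable_fun setT h.
  rewrite (_ : h = (fun p : T1 * T2 => f p.1 p.2) \_ (setT `*` B)).
    apply: (measurable_restrict _ _ _).1 => //; first exact: measurableX.
    exact: measurable_funTS.
  apply/funext => -[x y]; rewrite /h !patchE/=.
  have -> : ((x, y) \in [set: T1] `*` B) = (y \in B).
    by apply/idP/idP; rewrite !inE /= => // -[].
  by [].
rewrite (_ : (fun x => _) = fun x => fine ((\int[m2]_y ((EFin \o h)^\+ (x, y))%E)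
   - (\int[m2]_y ((EFin \o h)^\- (x, y))%E))).
  apply: measurableT_comp => //.
  have mp := measurable_funepos ((measurable_EFinP _ _).2 mh).
  have mn := measurable_funeneg ((measurable_EFinP _ _).2 mh).
  apply: emeasurable_funB.
    exact: (measurable_fun_fubini_tonelli_F (m2 := m2) ((EFin \o h)^\+)%E mp (fun x => funepos_ge0 _ x)).
  exact: (measurable_fun_fubini_tonelli_F (m2 := m2) ((EFin \o h)^\-)%E mn (fun x => funeneg_ge0 _ x)).
apply/funext => x; rewrite /Rintegral integral_mkcond integralE; congr (fine (_ - _)%E);
  by apply: eq_integral => y _; rewrite ?funeposE ?funenegE /h /= !patchE; case: ifP.
Qed.

(** Extension by zero, which carries statements on a rectangle to the whole product space, where
    Fubini and Tonelli are applied. *)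
Let restr A B f (p : T1 * T2) : R := ((fun p => f p.1 p.2) \_ (A `*` B)) p.

Let restrE A B f x y : restr A B f (x, y) = (fun x => (f x \_ B) y) \_ A x.
Proof.
rewrite /restr !patchE; have [xA|xA] := boolP (x \in A); last first.
  by rewrite memNset//= => -[/mem_set]; rewrite (negbTE xA).
have [yB|yB] := boolP (y \in B).
  by rewrite mem_set//=; split; exact: set_mem.
by rewrite memNset//= => -[_ /mem_set]; rewrite (negbTE yB).
Qed.

Let restr_integral A B f (g : R -> R) x : g 0 = 0 ->
  (\int[m2]_y (g (restr A B f (x, y)))%:E =
   ((fun x => \int[m2]_(y in B) (g (f x y))%:E) \_ A) x)%E.
Proof.
move=> g0; rewrite patchE; case: ifPn => [xA|xA].
  rewrite [RHS]integral_mkcond; apply: eq_integral => y _.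
  by rewrite restrE !patchE xA; case: ifP; rewrite ?g0.
rewrite integral0_eq// => y _.
by rewrite restrE patchE (negbTE xA) g0.
Qed.

Lemma measurable_integral_param B f : measurable B -> (forall x y, 0 <= f x y) ->
  measurable_fun setT (fun p : T1 * T2 => f p.1 p.2) ->
  measurable_fun setT (fun x => \int[m2]_(y in B) (f x y)%:E)%E.
Proof.
move=> mB f0 mf.
rewrite (_ : (fun x => _) = fun x => \int[m2]_y (restr setT B f (x, y))%:E)%E; last first.
  by apply/funext => x; rewrite (@restr_integral _ _ _ id)// patchE mem_set.
apply: (measurable_fun_fubini_tonelli_F (m2 := m2) (EFin \o restr setT B f)).
- apply/measurable_EFinP; apply: (measurable_restrict _ _ _).1 => //; first exact: measurableX.
  exact: measurable_funTS.
- by move=> p; rewrite lee_fin /restr patchE; case: ifP.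
Qed.

Lemma ge0_integral_swap A B f : measurable A -> measurable B ->
  (forall x y, 0 <= f x y) -> measurable_fun setT (fun p : T1 * T2 => f p.1 p.2) ->
  (\int[m1]_(x in A) \int[m2]_(y in B) (f x y)%:E =
   \int[m2]_(y in B) \int[m1]_(x in A) (f x y)%:E)%E.
Proof.
move=> mA mB f0 mf.
transitivity (\int[m1]_x \int[m2]_y (restr A B f (x, y))%:E)%E.
  rewrite integral_mkcond; apply: eq_integral => x _.
  by rewrite (@restr_integral _ _ _ id).
rewrite (@fubini_tonelli _ _ _ _ _ m1 m2 (EFin \o restr A B f)).
- rewrite [RHS]integral_mkcond; apply: eq_integral => y _; rewrite patchE.
  case: ifPn => yB.
    rewrite [RHS]integral_mkcond; apply: eq_integral => x _.
    by rewrite /= restrE !patchE; case: ifP; rewrite ?patchE ?yB.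
  rewrite integral0_eq// => x _.
  by rewrite /= restrE patchE; case: ifP; rewrite ?patchE ?(negbTE yB).
- apply/measurable_EFinP; apply: (measurable_restrict _ _ _).1 => //; first exact: measurableX.
  exact: measurable_funTS.
- by move=> p; rewrite lee_fin /restr patchE; case: ifP.
Qed.

Lemma integrable_prod12 A B f : measurable A -> measurable B ->
  measurable_fun setT (fun p : T1 * T2 => f p.1 p.2) ->
  (\int[m1]_(x in A) \int[m2]_(y in B) `|f x y|%:E < +oo)%E ->
  (m1 \x m2)%E.-integrable (A `*` B) (EFin \o (fun p => f p.1 p.2)).
Proof.
move=> mA mB mf foo; have mAB : measurable (A `*` B) by exact: measurableX.
apply/(integrable_mkcond _ mAB).
have mr : measurable_fun setT (restr A B f).
  apply: (measurable_restrict _ _ _).1 => //.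
  exact: measurable_funTS.
rewrite restrict_EFin; apply/integrable12ltyP; first exact/measurable_EFinP.
rewrite [ltLHS](_ : _ = \int[m1]_(x in A) \int[m2]_(y in B) `|f x y|%:E)%E; first exact: foo.
rewrite [RHS]integral_mkcond; apply: eq_integral => x _.
by rewrite -restr_integral ?normr0.
Qed.

Lemma integrable_prod21 A B f : measurable A -> measurable B ->
  measurable_fun setT (fun p : T1 * T2 => f p.1 p.2) ->
  (\int[m2]_(y in B) \int[m1]_(x in A) `|f x y|%:E < +oo)%E ->
  (m1 \x m2)%E.-integrable (A `*` B) (EFin \o (fun p => f p.1 p.2)).
Proof.
move=> mA mB mf foo; apply: integrable_prod12 => //.
rewrite (ge0_integral_swap (f := fun x y => `|f x y|))//.
exact: measurableT_comp.
Qed.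

Section integrable_prod.
Variables (A : set T1) (B : set T2) (f : T1 -> T2 -> R).
Hypotheses (mA : measurable A) (mB : measurable B).
Hypothesis fi : (m1 \x m2)%E.-integrable (A `*` B) (EFin \o (fun p => f p.1 p.2)).

Let ri : (m1 \x m2)%E.-integrable setT (EFin \o restr A B f).
Proof.
have := fi; move/(integrable_mkcond _ (measurableX mA mB)).
by rewrite restrict_EFin.
Qed.

Let F := fubini_F m2 (EFin \o restr A B f).

Let FA x : A x -> F x = (\int[m2]_(y in B) (f x y)%:E)%E.
Proof.
move=> Ax; rewrite /F /fubini_F (@restr_integral _ _ _ id)//.
by rewrite patchE mem_set.
Qed.

Let FNA x : ~ A x -> F x = 0%E.
Proof.
move=> Ax; rewrite /F /fubini_F (@restr_integral _ _ _ id)//.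
by rewrite patchE memNset.
Qed.

Lemma integrable_Rintegral_param :
  m1.-integrable A (EFin \o (fun x => \int[m2]_(y in B) f x y)).
Proof.
have iF := integrable_fubini_F ri.
apply: (@le_integrable _ _ _ _ _ mA _ F).
- apply/measurable_EFinP.
  apply: (@eq_measurable_fun _ _ _ _ _ (fun x => fine (F x))).
    by move=> x /set_mem Ax; rewrite FA.
  by apply: measurable_funTS; apply: measurableT_comp => //; exact: measurable_fubini_F ri.
- move=> x Ax; rewrite FA//= /Rintegral.
  case: (\int[m2]_(y in B) (f x y)%:E)%E => [r||] //=; by rewrite leey.
- exact: integrableS iF.
Qed.

Lemma Rintegral_prod12 :
  \int[(m1 \x m2)%E]_(p in A `*` B) f p.1 p.2 =
  \int[m1]_(x in A) \int[m2]_(y in B) f x y.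
Proof.
have iF := integrable_fubini_F ri.
rewrite /Rintegral; congr fine.
rewrite integral_mkcond restrict_EFin -(integral12_prod_meas1 ri).
rewrite [RHS]integral_mkcond.
(* The inner integral is finite only almost everywhere; on the exceptional null set [fine] changes
   its value. *)
apply: ae_eq_integral => //.
- exact: measurable_fubini_F ri.
- apply: (measurable_restrict _ _ _).1 => //.
  apply: measurable_funS (measurable_int _ integrable_Rintegral_param) => //.
- have := integrable_ae measurableT iF; apply: filterS => x /(_ I) Fx _.
  rewrite patchE; case: ifPn => [/set_mem Ax|/negP xA]; last first.
    by rewrite [LHS]FNA// => Ax; apply: xA; rewrite inE.
  by rewrite -FA// fineK.
Qed.

End integrable_prod.

Lemma integrable_prod_dom A B f (u : T1 -> R) (v : T2 -> R) :
  measurable A -> measurable B ->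
  measurable_fun setT (fun p : T1 * T2 => f p.1 p.2) ->
  m1.-integrable A (EFin \o u) -> m2.-integrable B (EFin \o v) ->
  (forall x y, A x -> B y -> `|f x y| <= u x * v y) ->
  (m1 \x m2)%E.-integrable (A `*` B) (EFin \o (fun p => f p.1 p.2)).
Proof.
move=> mA mB mf ui vi fuv; apply: integrable_prod12 => //.
have vi' : m2.-integrable B (EFin \o (fun y => `|v y|)) by exact: integrable_norm.
have ui' : m1.-integrable A (EFin \o (fun y => `|u y|)) by exact: integrable_norm.
have mfA x : measurable_fun B (f x).
  apply: measurable_funTS.
  exact: (measurableT_comp mf (measurable_fun_pair (measurable_cst x) (@measurable_id _ _ _))).
pose c := (\int[m2]_(y in B) `|v y|%:E)%E.
have c0 : (0 <= c)%E by apply: integral_ge0 => y _; rewrite lee_fin.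
have cfin : c \is a fin_num by exact: integrable_fin_num vi'.
apply: (@le_lt_trans _ _ (\int[m1]_(x in A) (fine c * `|u x|)%:E)%E); last first.
  have := integrableZl_EFin (fine c) mA ui'.
  move=> /integrable_fin_num-/(_ mA); rewrite ge0_fin_numE//.
  by apply: integral_ge0 => x _; rewrite lee_fin mulr_ge0// fine_ge0.
apply: ge0_le_integral => //.
- by move=> x _; apply: integral_ge0 => y _; rewrite lee_fin.
- apply: measurable_funTS; apply: (measurable_integral_param (f := fun x y => `|f x y|)) => //.
  exact: measurableT_comp.
- apply/measurable_EFinP; exact: (integrable_EFin_measurable mA (integrableZl_EFin (fine c) mA ui')).
- move=> x Ax; rewrite EFinM fineK// muleC -ge0_integralZl//; last first.
    by apply/measurable_EFinP; exact: integrable_EFin_measurable vi'.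
  apply: ge0_le_integral => //.
  + by apply/measurable_EFinP; exact: measurableT_comp.
  + apply/measurable_EFinP/measurable_funM => //.
    exact: integrable_EFin_measurable vi'.
  + move=> y By; rewrite lee_fin (le_trans (fuv _ _ Ax By))//.
    by rewrite (le_trans (ler_norm _))// normrM.
Qed.

End two_measures.

Section swap.
Context d1 d2 (T1 : measurableType d1) (T2 : measurableType d2).
Variables (m1 : {sigma_finite_measure set T1 -> \bar R})
  (m2 : {sigma_finite_measure set T2 -> \bar R}).
Variables (A : set T1) (B : set T2) (f : T1 -> T2 -> R).
Hypotheses (mA : measurable A) (mB : measurable B).
Hypothesis fi : (m1 \x m2)%E.-integrable (A `*` B) (EFin \o (fun p => f p.1 p.2)).

Let r (p : T1 * T2) : R := ((fun p => f p.1 p.2) \_ (A `*` B)) p.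
Let r' (p : T2 * T1) : R := ((fun p => f p.2 p.1) \_ (B `*` A)) p.

Let ri : (m1 \x m2)%E.-integrable setT (EFin \o r).
Proof.
have := fi; move/(integrable_mkcond _ (measurableX mA mB)).
by rewrite restrict_EFin.
Qed.

Let r'E : r' = r \o (fun p : T2 * T1 => (p.2, p.1)).
Proof.
apply/funext => -[y x]; rewrite /r' /r /= !patchE /=.
have -> // : ((y, x) \in B `*` A) = ((x, y) \in A `*` B).
by apply/idP/idP; rewrite !inE /= => -[].
Qed.

Let r'i : (m2 \x m1)%E.-integrable setT (EFin \o r').
Proof.
have mr : measurable_fun setT (EFin \o r) by exact: measurable_int ri.
apply/integrable12ltyP.
  rewrite r'E (_ : _ \o _ = (EFin \o r) \o (fun p : T2 * T1 => (p.2, p.1)))//.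
  exact: (measurableT_comp mr (measurable_fun_pair measurable_snd measurable_fst)).
by have := (integrable21ltyP m1 m2 mr).1 ri; rewrite r'E.
Qed.

Lemma integrable_prod_swap :
  (m2 \x m1)%E.-integrable (B `*` A) (EFin \o (fun p => f p.2 p.1)).
Proof.
apply/integrable_mkcond; first exact: measurableX.
by rewrite restrict_EFin; exact: r'i.
Qed.

Lemma Rintegral_prod21 :
  \int[(m1 \x m2)%E]_(p in A `*` B) f p.1 p.2 =
  \int[m2]_(y in B) \int[m1]_(x in A) f x y.
Proof.
rewrite -(Rintegral_prod12 mB mA (f := fun y x => f x y) integrable_prod_swap).
rewrite /Rintegral; congr fine.
rewrite [LHS]integral_mkcond [RHS]integral_mkcond !restrict_EFin.
rewrite -(integral21_prod_meas1 ri) -(integral12_prod_meas1 r'i).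
by rewrite /fubini_F/fubini_G -/r' r'E.
Qed.

Lemma Rintegral_swap :
  \int[m1]_(x in A) \int[m2]_(y in B) f x y =
  \int[m2]_(y in B) \int[m1]_(x in A) f x y.
Proof. by rewrite -(Rintegral_prod12 mA mB fi) Rintegral_prod21. Qed.

End swap.
End integration.

(** * Derivatives and integrals on the line *)

Section calculus.
Context {R : realType}.
Implicit Types (f g : R -> R) (x a b : R).

Lemma is_derive1_eq f x a b : is_derive x 1 f a -> a = b -> is_derive x 1 f b.
Proof. by move=> fa <-. Qed.

Lemma is_derive1D f g x a b : is_derive x 1 f a -> is_derive x 1 g b ->
  is_derive x 1 (fun y => f y + g y) (a + b).
Proof. by move=> fa gb; exact: (is_deriveD fa gb). Qed.

Lemma is_derive1N f x a : is_derive x 1 f a ->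
  is_derive x 1 (fun y => - f y) (- a).
Proof. by move=> fa; exact: (is_deriveN fa). Qed.

Lemma is_derive1M f g x a b : is_derive x 1 f a -> is_derive x 1 g b ->
  is_derive x 1 (fun y => f y * g y) (a * g x + f x * b).
Proof.
move=> fa gb; apply: (is_derive_eq (is_deriveM fa gb)).
by rewrite addrC; congr (_ + _); rewrite /GRing.scale /= mulrC.
Qed.

Lemma is_derive1_chain f g x a b : is_derive (g x) 1 f a -> is_derive x 1 g b ->
  is_derive x 1 (fun y => f (g y)) (a * b).
Proof. by move=> fa gb; exact: is_derive1_comp. Qed.

Lemma is_derive1X f n x a : is_derive x 1 f a ->
  is_derive x 1 (fun y => f y ^+ n) (n%:R * f x ^+ n.-1 * a).
Proof.
move=> fa; rewrite (_ : (fun y => f y ^+ n) = f ^+ n); first exact: (is_deriveX n fa).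
by apply/funext => y; rewrite exprfctE.
Qed.

Lemma is_derive1V f x a : f x != 0 -> is_derive x 1 f a ->
  is_derive x 1 (fun y => (f y)^-1) (- f x ^- 2 * a).
Proof. by move=> f0 fa; exact: (is_deriveV f0 fa). Qed.

Lemma is_derive1_continuous f (df : R -> R) : (forall x, is_derive x 1 f (df x)) ->
  continuous f.
Proof.
move=> fd x; apply: differentiable_continuous; apply/derivable1_diffP.
by have [] := fd x.
Qed.

End calculus.

(** One step per head symbol. [notypeclasses refine] leaves the premises to the tactic instead of
    instance search, so the derivative is built along the syntax of the function and [deriv] ends
    with a single algebraic identity. *)
Ltac deriv_step := lazymatch goal with
  | |- is_derive _ _ (fun y => y) _ => exact: is_derive_id
  | |- is_derive _ _ (fun _ => ?c) _ => exact: is_derive_cst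
  | |- is_derive _ _ (fun y => (@?f y + @?g y)%R) _ =>
      notypeclasses refine (is_derive1D (f := f) (g := g) _ _)
  | |- is_derive _ _ (fun y => (- @?f y)%R) _ =>
      notypeclasses refine (is_derive1N (f := f) _)
  | |- is_derive _ _ (fun y => (@?f y * @?g y)%R) _ =>
      notypeclasses refine (is_derive1M (f := f) (g := g) _ _)
  | |- is_derive _ _ (fun y => (@?f y ^+ ?n)%R) _ =>
      notypeclasses refine (is_derive1X n (f := f) _)
  | |- is_derive _ _ (fun y => expR (@?f y)) _ =>
      notypeclasses refine (is_derive1_chain (f := expR) (g := f) (is_derive_expR _) _)
  | |- is_derive _ _ (fun y => sin (@?f y)) _ =>
      notypeclasses refine (is_derive1_chain (f := sin) (g := f) (is_derive_sin _) _)
  | |- is_derive _ _ (fun y => cos (@?f y)) _ =>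
      notypeclasses refine (is_derive1_chain (f := cos) (g := f) (is_derive_cos _) _)
  | |- is_derive _ _ (fun y => (@?f y)^-1) _ =>
      notypeclasses refine (is_derive1V (f := f) _ _)
  end; cbv beta.
Ltac deriv := notypeclasses refine (is_derive1_eq _ _); [repeat deriv_step|cbv beta].

Section measurable_inv.
Context {R : realType}.
(** Inversion is continuous off 0 only; the point 0, where its value is 0, is split off. Quotients
    such as [pk] are then measurable with no condition on the denominator. *)
Lemma inv_measurable_fun : measurable_fun [set: R] (@GRing.inv R).
Proof.
have m0 : measurable [set x : R | x != 0] by apply: open_measurable; exact: open_neq.
have -> : [set: R] = [set 0] `|` [set x : R | x != 0].
  apply/seteqP; split=> [x _|//].
  by have [->|x0] := eqVneq x 0; [left|right].
apply/measurable_funU => //.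
split; first exact: measurable_fun_set1.
apply: open_continuous_measurable_fun; first exact: open_neq.
by move=> x; rewrite inE /=; exact: inv_continuous.
Qed.

Lemma measurable_funV d (T : measurableType d) (D : set T) (f : T -> R) :
  measurable_fun D f -> measurable_fun D (fun x => (f x)^-1).
Proof. by move=> mf; exact: (measurableT_comp inv_measurable_fun mf). Qed.

Lemma measurable_fun_norm d (T : measurableType d) (D : set T) (f : T -> R) :
  measurable_fun D f -> measurable_fun D (fun x => `|f x|).
Proof.
by move=> mf; exact: (measurableT_comp (@normr_measurable _ setT) mf).
Qed.
End measurable_inv.

Ltac meas_step := lazymatch goal with
  | |- measurable_fun _ (fun y => y) => exact: measurable_id
  | |- measurable_fun _ (fun _ => ?c) => exact: measurable_cst
  | |- measurable_fun _ (fun y => (@?f y + @?g y)%R) => apply: (measurable_funD (f := f) (g := g))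
  | |- measurable_fun _ (fun y => (- @?f y)%R) => apply: (measurable_funN (f := f))
  | |- measurable_fun _ (fun y => (@?f y * @?g y)%R) => apply: (measurable_funM (f := f) (g := g))
  | |- measurable_fun _ (fun y => (@?f y ^+ ?n)%R) => apply: (measurable_funX n (f := f))
  | |- measurable_fun _ (fun y => (@?f y)^-1) => apply: (measurable_funV (f := f))
  | |- measurable_fun _ (fun y => expR (@?f y)) => apply: (measurableT_comp (f := expR) (g := f)); [exact: measurable_expR|]
  | |- measurable_fun _ (fun y => sin (@?f y)) => apply: (measurableT_comp (f := sin) (g := f)); [exact: continuous_measurable_fun (@continuous_sin _)|]
  | |- measurable_fun _ (fun y => cos (@?f y)) => apply: (measurableT_comp (f := cos) (g := f)); [exact: continuous_measurable_fun (@continuous_cos _)|]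
  | |- measurable_fun _ (fun y => (`|@?f y|)%R) => apply: (measurable_fun_norm (f := f))
  | |- measurable_fun _ (fun y => fst (@?f y)) => apply: (measurableT_comp (f := fst) (g := f)); [exact: measurable_fst|]
  | |- measurable_fun _ (fun y => snd (@?f y)) => apply: (measurableT_comp (f := snd) (g := f)); [exact: measurable_snd|]
  | |- measurable_fun _ (fun y => (@?f y, @?g y)) => apply: (measurable_fun_pair (f := f) (g := g))
  | |- measurable_fun _ ?f => lazymatch f with
       | fst => exact: measurable_fst | snd => exact: measurable_snd
       end
  end.

Ltac meas := repeat meas_step.

Section real_integrals.
Context {R : realType}.
Notation leb := (@lebesgue_measure R).
Implicit Types (f F : R -> R) (x : R).

Lemma Rintegral_FTC2 f F (a b : R) : a <= b ->
  continuous f -> (forall x, is_derive x 1 F (f x)) ->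
  \int[leb]_(x in `[a, b]) f x = F b - F a.
Proof.
rewrite le_eqVlt => /predU1P[<-|ab] cf dF.
  by rewrite set_itv1 Rintegral_set1 subrr.
have cF := is_derive1_continuous dF.
rewrite /Rintegral (@continuous_FTC2 _ f F)//.
- exact: continuous_subspaceT.
- split; first by move=> x _; have [] := dF x.
  + exact: cvg_at_right_filter (cF a).
  + exact: cvg_at_left_filter (cF b).
- by move=> x _; rewrite derive1E; have [_ ->] := dF x.
Qed.

(** The integrand may oscillate, so integrability is a premise and the half line is exhausted by the
    segments from a to a + n. *)
Lemma Rintegral_FTC2y f F (a l : R) :
  continuous f -> (forall x, is_derive x 1 F (f x)) ->
  leb.-integrable `[a, +oo[ (EFin \o f) -> F x @[x --> +oo] --> l ->
  \int[leb]_(x in `[a, +oo[) f x = l - F a.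
Proof.
move=> cf dF fi Fl.
have := @cvg_Rintegral_exhaustion R _ _ leb `[a, +oo[ (fun n => `[a, a + n%:R]%classic) f.
move=> /(_ _ _ _ _ fi) cvgi.
have {}cvgi : \int[leb]_(x in `[a, a + n%:R]) f x @[n --> \oo] -->
    \int[leb]_(x in `[a, +oo[) f x.
  apply: cvgi => //.
  - by move=> n x /=; rewrite !in_itv/= => /andP[->].
  - move=> x /=; rewrite in_itv/= andbT => ax.
    near=> n; rewrite /= in_itv/= ax/= -lerBlDl.
    by near: n; exact: nbhs_infty_ger.
apply/esym/(cvg_unique _ _ cvgi) => //.
rewrite /=; under eq_fun do rewrite (Rintegral_FTC2 _ cf dF) ?lerDl//.
apply: cvgB; last exact: cvg_cst.
apply: (cvg_comp (fun n => a + n%:R) F) Fl.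
apply/cvgryPge => A; near=> n.
rewrite -lerBlDl; near: n; exact: nbhs_infty_ger.
Unshelve. all: by end_near. Qed.

Lemma cvg_scaley (T : topologicalType) (F : R -> T) (c : R) (l : T) : 0 < c ->
  F x @[x --> +oo] --> l -> F (c * x) @[x --> +oo] --> l.
Proof.
move=> c0 Fl; apply: (cvg_comp (fun x => c * x) F) Fl.
apply/cvgryPge => A; near=> x.
rewrite -ler_pdivrMl//; near: x; exact: nbhs_pinfty_ge.
Unshelve. all: by end_near. Qed.

Lemma ge0_integral_FTC2y f F (a l : R) : (forall x, a <= x -> 0 <= f x) ->
  continuous f -> (forall x, is_derive x 1 F (f x)) -> F x @[x --> +oo] --> l ->
  (\int[leb]_(x in `[a, +oo[) (f x)%:E = (l - F a)%:E)%E.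
Proof.
move=> f0 cf dF Fl; rewrite (@ge0_continuous_FTC2y _ f F a l)//.
- exact: continuous_subspaceT.
- by apply: cvg_at_right_filter; exact: is_derive1_continuous dF a.
- by move=> x _; rewrite derive1E; have [_ ->] := dF x.
Qed.

Lemma ge0_integrable_FTC2y f F (a l : R) : (forall x, a <= x -> 0 <= f x) ->
  continuous f -> (forall x, is_derive x 1 F (f x)) -> F x @[x --> +oo] --> l ->
  leb.-integrable `[a, +oo[ (EFin \o f).
Proof.
move=> f0 cf dF Fl; apply/integrableP; split.
  by apply/measurable_EFinP/measurable_funTS; exact: continuous_measurable_fun.
rewrite [ltLHS](_ : _ = (l - F a)%:E) ?ltry//.
rewrite -(ge0_integral_FTC2y f0 cf dF Fl); apply: eq_integral => x.
by rewrite inE/= in_itv/= andbT => ax; rewrite ger0_norm// f0.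
Qed.

Lemma derivable1_continuous f : (forall x, exists d, is_derive x 1 f d) -> continuous f.
Proof.
move=> fd x; apply: differentiable_continuous; apply/derivable1_diffP.
by have [d []] := fd x.
Qed.

(** By uniqueness of Lebesgue measure it suffices to treat half-open intervals. Reflections are the
    basic substitution because convolutions contain x - z; for even functions they yield
    translations too. *)
Lemma lebesgue_measure_reflect (c : R) (A : set (measurableTypeR R)) : measurable A ->
  pushforward leb (fun x : measurableTypeR R => c - x : measurableTypeR R) A = leb A.
Proof.
move=> mA; apply/esym.
have mr : measurable_fun setT (fun x : measurableTypeR R => c - x : measurableTypeR R).
  by apply: measurable_funB.
apply: (@lebesgue_measure_unique R (pushforward leb (fun x : measurableTypeR R => c - x : measurableTypeR R))) => //.
move=> X [[a b] /= _ <-].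
rewrite /pushforward /=.
(* A reflection moves the closed end of a half-open interval to the other side, which leaves the
   length unchanged. *)
rewrite (_ : _ @^-1` _ = `[c - b, c - a[%classic).
  rewrite !lebesgue_measure_itv/= !lte_fin.
  rewrite ltrD2l ltrN2; case: ifP => // _; rewrite -!EFinB; congr EFin; ring.
apply/seteqP; split=> x /=; rewrite !in_itv/= => /andP[h1 h2]; apply/andP; split; lra.
Qed.

Lemma ge0_integral_reflect (f : R -> \bar R) (c : R) : measurable_fun setT f ->
  (forall x, 0 <= f x)%E ->
  (\int[leb]_x f (c - x)%R = \int[leb]_x f x)%E.
Proof.
move=> mf f0.
have mr : measurable_fun setT (fun x : measurableTypeR R => c - x : measurableTypeR R).
  by apply: measurable_funB.
transitivity (\int[pushforward leb (fun x : measurableTypeR R => (c - x)%R : measurableTypeR R)]_x f x)%E.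
  by rewrite ge0_integral_pushforward.
by apply: eq_measure_integral => A mA _; exact: lebesgue_measure_reflect.
Qed.

Lemma Rintegral_reflect f (c : R) : measurable_fun setT f ->
  \int[leb]_x f (c - x) = \int[leb]_x f x.
Proof.
move=> mf; rewrite /Rintegral; congr fine.
have mEf := (measurable_EFinP _ _).2 mf.
have mp := measurable_funepos mEf; have mn := measurable_funeneg mEf.
rewrite [LHS]integralE [RHS]integralE; congr (_ - _)%E.
  rewrite -(@ge0_integral_reflect _ c mp (fun x => funepos_ge0 _ x)).
  by apply: eq_integral => x _; rewrite !funeposE.
rewrite -(@ge0_integral_reflect _ c mn (fun x => funeneg_ge0 _ x)).
by apply: eq_integral => x _; rewrite !funenegE.
Qed.

Lemma integrable_reflect f (c : R) : leb.-integrable setT (EFin \o f) ->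
  leb.-integrable setT (EFin \o (fun x => f (c - x))).
Proof.
move=> /integrableP[mf foo]; apply/integrableP; split.
  apply/measurable_EFinP; move/measurable_EFinP : mf => mf.
  apply: (measurableT_comp mf); exact: measurable_funB.
rewrite /= (@ge0_integral_reflect (fun x => `|f x|%:E))//.
by apply/measurable_EFinP; apply: measurableT_comp => //; exact/measurable_EFinP.
Qed.

End real_integrals.

Ltac cont := apply: derivable1_continuous => ?; eexists; repeat deriv_step.

(** * Fourier integrals with a Gaussian weight *)

Section gaussian.
Context {R : realType}.
Notation leb := (@lebesgue_measure R).
Implicit Types (t s x k r : R) (n : nat).

Lemma cvg_dom_expRN (f : R -> R) (C : R) :
  (forall x, 0 <= x -> `|f x| <= C * expR (- x)) -> f x @[x --> +oo] --> 0.
Proof.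
move=> fC; apply: norm_cvg0.
apply: (@squeeze_cvgr _ _ _ _ (fun=> 0) (fun x => C * expR (- x))).
- near=> x; rewrite normr_ge0/= fC//; near: x; exact: nbhs_pinfty_ge.
- exact: cvg_cst.
- by rewrite -[X in _ --> X](mulr0 C); apply: cvgMr; exact: cvgr_expR.
Unshelve. all: by end_near. Qed.

Lemma integrable_expRMN s : 0 < s ->
  leb.-integrable `[0, +oo[ (EFin \o (fun x => expR (- (s * x)))).
Proof.
move=> s0; apply: (@ge0_integrable_FTC2y _ _ (fun x => - (s^-1 * expR (- (s * x)))) _ (- (s^-1 * 0))).
- by move=> x _; exact: expR_ge0.
- by cont.
- by move=> x; deriv; field; rewrite gt_eqF.
- apply: cvgN; apply: cvgMr.
  by apply: (@cvg_scaley _ _ (fun x => expR (- x))) => //; exact: cvgr_expR.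
Qed.

Lemma integrable_expRN : leb.-integrable `[0, +oo[ (EFin \o (fun x => expR (- x))).
Proof.
have := @integrable_expRMN 1 ltr01; apply: eq_integrable => // x _ /=.
by rewrite mul1r.
Qed.

(* The integrands of the Fourier representations in the first coordinate of the
   plane, [k] being the frequency. *)
Definition wexp n t s k : R := k ^+ n * expR (- (k * s) - t * k ^+ 2).

(** The maximum over k of exp(m k - t k^2) with m = n + 1 + b: here k^n is at most exp(n k), the
    factor exp(- k s) is at most exp(b k), and one more exp(k) is spent to obtain the decay exp(-
    k). *)
Definition wexp_bound n t (b : R) : R := expR ((n%:R + 1 + b) ^+ 2 / (4 * t)).

Lemma wexp_ge0 n t s k : 0 <= k -> 0 <= wexp n t s k.
Proof. by move=> k0; rewrite mulr_ge0 ?exprn_ge0 ?expR_ge0. Qed.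

Lemma wexp_le n t s (b : R) k : 0 < t -> - b <= s -> 0 <= k ->
  wexp n t s k <= wexp_bound n t b * expR (- k).
Proof.
move=> t0 sb k0; rewrite /wexp /wexp_bound -expRD.
have kn : k ^+ n <= expR (n%:R * k).
  rewrite expRM_natl; apply: lerXn2r; rewrite ?nnegrE ?expR_ge0//.
  by apply: le_trans (expR_ge1Dx k); rewrite lerDr.
apply: (@le_trans _ _ (expR (n%:R * k) * expR (- (k * s) - t * k ^+ 2))).
  by rewrite ler_wpM2r// expR_ge0.
rewrite -expRD ler_expR.
have ks : - (k * s) <= k * b by rewrite -mulrN ler_wpM2l// lerNl.
set m := n%:R + 1 + b.
have : 0 <= (2 * t * k - m) ^+ 2 / (4 * t) by rewrite divr_ge0 ?sqr_ge0// mulr_ge0// ltW.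
have -> : (2 * t * k - m) ^+ 2 / (4 * t) = t * k ^+ 2 - m * k + m ^+ 2 / (4 * t).
  by field; rewrite gt_eqF.
rewrite /m; nra.
Qed.

Lemma norm_wexp_le n t s (b : R) k (c : R) : 0 < t -> - b <= s -> 0 <= k -> `|c| <= 1 ->
  `|wexp n t s k * c| <= wexp_bound n t b * expR (- k).
Proof.
move=> t0 sb k0 c1; rewrite normrM ger0_norm ?wexp_ge0//.
apply: le_trans (wexp_le n t0 sb k0).
by rewrite -[leRHS]mulr1 ler_wpM2l// wexp_ge0.
Qed.

Lemma norm_sin_le1 x : `|sin x| <= 1.
Proof. by rewrite ler_norml sin_geN1 sin_le1. Qed.

Lemma norm_cos_le1 x : `|cos x| <= 1.
Proof. by rewrite ler_norml cos_geN1 cos_le1. Qed.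

Lemma integrable_wexp n t s (c : R -> R) : 0 < t -> measurable_fun setT c ->
  (forall k, `|c k| <= 1) ->
  leb.-integrable `[0, +oo[ (EFin \o (fun k => wexp n t s k * c k)).
Proof.
move=> t0 mc c1.
apply: (@le_integrable_EFin R _ _ leb _ _ (fun k => wexp_bound n t `|s| * expR (- k))) => //.
- by apply: measurable_funTS; rewrite /wexp; meas.
- by apply: integrableZl_EFin => //; exact: integrable_expRN.
- move=> k /=; rewrite in_itv/= andbT => k0; apply: norm_wexp_le => //.
  by rewrite lerNl ler_normr lexx orbT.
Qed.

(* [Ccos 0 t s] is the heat kernel at time [t] convolved with the Poisson kernel
   of height [s], see [gauss_conv_pk]; [Ccos n] is [(- d/ds)^n] of it. *)
Definition Ccos n t s x := pi^-1 * \int[leb]_(k in `[0, +oo[) (wexp n t s k * cos (k * x)).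
Definition Csin n t s x := pi^-1 * \int[leb]_(k in `[0, +oo[) (wexp n t s k * sin (k * x)).

Lemma integrable_wexp_cos n t s x : 0 < t ->
  leb.-integrable `[0, +oo[ (EFin \o (fun k => wexp n t s k * cos (k * x))).
Proof.
move=> t0; apply: integrable_wexp => //; first by meas.
by move=> k; exact: norm_cos_le1.
Qed.

Lemma integrable_wexp_sin n t s x : 0 < t ->
  leb.-integrable `[0, +oo[ (EFin \o (fun k => wexp n t s k * sin (k * x))).
Proof.
move=> t0; apply: integrable_wexp => //; first by meas.
by move=> k; exact: norm_sin_le1.
Qed.

Lemma is_derive1_cst_mul (f : R -> R) c x df : is_derive x 1 f df ->
  is_derive x 1 (fun y => c * f y) (c * df).
Proof.
by move=> fd; apply: is_derive1_eq (is_derive1M (is_derive_cst c x 1) fd) _; rewrite mul0r add0r.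
Qed.

Lemma is_derive_Ccos n t s x : 0 < t ->
  is_derive x 1 (Ccos n t s) (- Csin n.+1 t s x).
Proof.
move=> t0; rewrite /Ccos /Csin -mulrN; apply: is_derive1_cst_mul.
rewrite -RintegralN//; last exact: integrable_wexp_sin.
apply: (@is_derive_Rintegral R _ _ leb (fun x k => wexp n t s k * cos (k * x))
  (fun x k => - (wexp n.+1 t s k * sin (k * x)))
  (fun k => wexp_bound n.+1 t `|s| * expR (- k)) _ x (x - 1) (x + 1)) => //.
- by rewrite ltrBlDr ltrDl.
- by rewrite ltrDl.
- by move=> y _ _; exact: integrable_wexp_cos.
- by move=> y k _ _ _; deriv; rewrite /wexp (exprS k n); ring.
- by apply: integrableZl_EFin => //; exact: integrable_expRN.
- move=> y k _ _ /=; rewrite in_itv/= andbT => k0; rewrite normrN.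
  apply: norm_wexp_le => //; last exact: norm_sin_le1.
  by rewrite lerNl ler_normr lexx orbT.
Qed.

Lemma is_derive_Csin n t s x : 0 < t ->
  is_derive x 1 (Csin n t s) (Ccos n.+1 t s x).
Proof.
move=> t0; rewrite /Ccos /Csin; apply: is_derive1_cst_mul.
apply: (@is_derive_Rintegral R _ _ leb (fun x k => wexp n t s k * sin (k * x))
  (fun x k => wexp n.+1 t s k * cos (k * x))
  (fun k => wexp_bound n.+1 t `|s| * expR (- k)) _ x (x - 1) (x + 1)) => //.
- by rewrite ltrBlDr ltrDl.
- by rewrite ltrDl.
- by move=> y _ _; exact: integrable_wexp_sin.
- by move=> y k _ _ _; deriv; rewrite /wexp (exprS k n); ring.
- by apply: integrableZl_EFin => //; exact: integrable_expRN.
- move=> y k _ _ /=; rewrite in_itv/= andbT => k0.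
  apply: norm_wexp_le => //; last exact: norm_cos_le1.
  by rewrite lerNl ler_normr lexx orbT.
Qed.

Lemma is_derive_Ccos_s n t s x : 0 < t ->
  is_derive s 1 (fun s => Ccos n t s x) (- Ccos n.+1 t s x).
Proof.
move=> t0; rewrite /Ccos -mulrN; apply: is_derive1_cst_mul.
rewrite -RintegralN//; last exact: integrable_wexp_cos.
(* Here the height itself moves, by less than 1, so the bound is taken for heights down to -
   ([|s| + 1]). *)
apply: (@is_derive_Rintegral R _ _ leb (fun s k => wexp n t s k * cos (k * x))
  (fun s k => - (wexp n.+1 t s k * cos (k * x)))
  (fun k => wexp_bound n.+1 t (`|s| + 1) * expR (- k)) _ s (s - 1) (s + 1)) => //.
- by rewrite ltrBlDr ltrDl.
- by rewrite ltrDl.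
- by move=> y _ _; exact: integrable_wexp_cos.
- by move=> y k _ _ _; rewrite /wexp; deriv; rewrite (exprS k n); ring.
- by apply: integrableZl_EFin => //; exact: integrable_expRN.
- move=> y k sy _ /=; rewrite in_itv/= andbT => k0; rewrite normrN.
  apply: norm_wexp_le => //; last exact: norm_cos_le1.
  rewrite opprD; apply: le_trans (ltW sy); rewrite lerD2r.
  by rewrite lerNl ler_normr lexx orbT.
Qed.

(** At height 0 and position 0 both the damping and the oscillation disappear, which leaves the
    integral of the positive weight. *)
Lemma Ccos_bound n t s x : 0 < t -> 0 <= s -> `|Ccos n t s x| <= Ccos n t 0 0.
Proof.
move=> t0 s0; rewrite /Ccos normrM gtr0_norm ?invr_gt0 ?pi_gt0// ler_wpM2l ?invr_ge0 ?pi_ge0//.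
apply: le_normr_Rintegral_dom => //.
- by apply: measurable_funTS; rewrite /wexp; meas.
- exact: integrable_wexp_cos.
- move=> k /=; rewrite in_itv/= andbT => k0; rewrite mulr0 cos0 mulr1 normrM.
  rewrite ger0_norm ?wexp_ge0// -[leRHS]mulr1 ler_pM ?wexp_ge0//; last exact: norm_cos_le1.
  by rewrite ler_wpM2l ?exprn_ge0// ler_expR lerD2r lerN2 ler_wpM2l.
Qed.

Lemma Csin_bound n t s x : 0 < t -> 0 <= s -> `|Csin n t s x| <= Ccos n t 0 0.
Proof.
move=> t0 s0; rewrite /Ccos /Csin normrM gtr0_norm ?invr_gt0 ?pi_gt0// ler_wpM2l ?invr_ge0 ?pi_ge0//.
apply: le_normr_Rintegral_dom => //.
- by apply: measurable_funTS; rewrite /wexp; meas.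
- exact: integrable_wexp_cos.
- move=> k /=; rewrite in_itv/= andbT => k0; rewrite mulr0 cos0 mulr1 normrM.
  rewrite ger0_norm ?wexp_ge0// -[leRHS]mulr1 ler_pM ?wexp_ge0//; last exact: norm_sin_le1.
  by rewrite ler_wpM2l ?exprn_ge0// ler_expR lerD2r lerN2 ler_wpM2l.
Qed.

Lemma measurable_Ccos n t :
  measurable_fun setT (fun p : measurableTypeR R * measurableTypeR R => Ccos n t p.1 p.2).
Proof.
rewrite /Ccos; apply: measurable_funM => //.
apply: (@measurable_Rintegral_param R _ _ (plane R) _ leb `[0, +oo[
  (fun p k => wexp n t p.1 k * cos (k * p.2))) => //.
by rewrite /wexp; meas.
Qed.

End gaussian.

(** * The one-dimensional heat kernel *)

Section gaussian.
Context {R : realType}.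
Notation leb := (@lebesgue_measure R).
Implicit Types (t s x k r : R) (n : nat).

Definition gauss t r : R := (Num.sqrt (4 * pi * t))^-1 * expR (- (r ^+ 2 / (4 * t))).
Definition dgauss t r : R := - (r / (2 * t)) * gauss t r.

Lemma gauss_ge0 t r : 0 <= gauss t r.
Proof. by rewrite mulr_ge0 ?expR_ge0// invr_ge0 sqrtr_ge0. Qed.

Lemma gaussN t r : gauss t (- r) = gauss t r.
Proof. by rewrite /gauss sqrrN. Qed.

Lemma dgaussN t r : dgauss t (- r) = - dgauss t r.
Proof. by rewrite /dgauss gaussN; ring. Qed.

Lemma gauss0 t : gauss t 0 = (Num.sqrt (4 * pi * t))^-1.
Proof. by rewrite /gauss expr0n /= mul0r oppr0 expR0 mulr1. Qed.

Lemma measurable_gauss t : measurable_fun setT (gauss t).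
Proof. by rewrite /gauss; meas. Qed.

Section positive_time.
Variable t : R.
Hypothesis t0 : 0 < t.

Lemma gauss_le r : gauss t r <= gauss t 0.
Proof.
rewrite gauss0 -[leRHS]mulr1 ler_wpM2l ?invr_ge0 ?sqrtr_ge0// -expR0 ler_expR.
by rewrite oppr_le0 divr_ge0 ?sqr_ge0// mulr_ge0// ltW.
Qed.

Lemma is_derive_gauss r : is_derive r 1 (gauss t) (dgauss t r).
Proof.
rewrite /dgauss /gauss; deriv; rewrite expr1.
by field; rewrite !gt_eqF// sqrtr_gt0 !mulr_gt0 ?pi_gt0.
Qed.

Lemma is_derive_dgauss r :
  is_derive r 1 (dgauss t) ((r ^+ 2 / (2 * t) ^+ 2 - (2 * t)^-1) * gauss t r).
Proof.
rewrite /dgauss /gauss; deriv; rewrite expr1.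
by field; rewrite !gt_eqF// sqrtr_gt0 !mulr_gt0 ?pi_gt0.
Qed.

Lemma continuous_gauss : continuous (gauss t).
Proof. exact: is_derive1_continuous is_derive_gauss. Qed.

(** One constant for [gauss] and [dgauss]. The exponential comes from r^2 / (4 t) + 4 t >= 2 |r|; of
    the two |r|, one is the decay and the other absorbs the factor r of [dgauss], whose remaining
    factor is (2 t)^-1. *)
Definition gauss_bound : R := (1 + (2 * t)^-1) * gauss t 0 * expR (4 * t).

Let quad r : - (r ^+ 2 / (4 * t)) <= 4 * t - 2 * `|r|.
Proof.
have : 0 <= (`|r| - 4 * t) ^+ 2 / (4 * t) by rewrite divr_ge0 ?sqr_ge0// mulr_ge0// ltW.
have -> : (`|r| - 4 * t) ^+ 2 / (4 * t) = `|r| ^+ 2 / (4 * t) - 2 * `|r| + 4 * t.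
  by field; rewrite gt_eqF.
by rewrite real_normK ?num_real//; lra.
Qed.

Lemma gauss_exp_le r : gauss t r <= gauss_bound * expR (- `|r|).
Proof.
rewrite /gauss_bound gauss0 /gauss.
set c := (Num.sqrt _)^-1; have c0 : 0 <= c by rewrite invr_ge0 sqrtr_ge0.
rewrite [_ * c]mulrC -!mulrA ler_wpM2l// -expRD.
apply: (@le_trans _ _ (expR (4 * t + - `|r|))).
  by rewrite ler_expR; have := quad r; have := normr_ge0 r; lra.
by rewrite ler_peMl ?expR_ge0// lerDl invr_ge0 mulr_ge0// ltW.
Qed.

Lemma dgauss_exp_le r : `|dgauss t r| <= gauss_bound * expR (- `|r|).
Proof.
rewrite /gauss_bound gauss0 /dgauss /gauss !normrM normrN normrM.
set c := (Num.sqrt _)^-1; have c0 : 0 <= c by rewrite invr_ge0 sqrtr_ge0.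
rewrite (ger0_norm c0) (ger0_norm (expR_ge0 _)) (ger0_norm (x := (2 * t)^-1)).
  rewrite mulrCA [_ * c]mulrC -!mulrA ler_wpM2l//.
  apply: (@le_trans _ _ ((2 * t)^-1 * (expR (4 * t) * expR (- `|r|)))); last first.
    by rewrite ler_wpM2r ?mulr_ge0 ?expR_ge0// lerDr.
  rewrite mulrCA ler_wpM2l//; first by rewrite invr_ge0 mulr_ge0// ltW.
  rewrite -expRD; apply: (@le_trans _ _ (expR `|r| * expR (- (r * (r / (4 * t)))))).
    by rewrite ler_wpM2r ?expR_ge0//; apply: (le_trans _ (expR_ge1Dx _)); rewrite lerDr.
  by rewrite -expRD ler_expR; have := quad r; rewrite expr2 -mulrA; lra.
by rewrite invr_ge0 mulr_ge0// ltW.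
Qed.

Lemma gauss_bound_ge0 : 0 <= gauss_bound.
Proof.
by rewrite /gauss_bound !mulr_ge0 ?expR_ge0 ?gauss_ge0// addr_ge0// invr_ge0 mulr_ge0// ltW.
Qed.

(** The heat kernel at time t is the normal density of variance 2 t. *)
Lemma integral_gauss : (\int[leb]_x (gauss t x)%:E = 1)%E.
Proof.
have s0 : Num.sqrt (2 * t) != 0 by rewrite sqrtr_eq0 -ltNge mulr_gt0.
rewrite -(integral_normal_pdf 0 (Num.sqrt (2 * t))); apply: eq_integral => x _.
rewrite (normal_pdfE _ s0) /normal_peak /normal_fun sqr_sqrtr ?mulr_ge0 ?ltW//.
rewrite /gauss subr0; congr (_^-1 * expR _)%:E.
  by congr Num.sqrt; rewrite -mulr_natr; ring.
by rewrite -mulr_natr; field; rewrite gt_eqF.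
Qed.

Lemma integrable_gauss : leb.-integrable setT (EFin \o gauss t).
Proof.
apply/integrableP; split; first by apply/measurable_EFinP; exact: measurable_gauss.
under eq_integral do rewrite /= ger0_norm ?gauss_ge0//.
by rewrite integral_gauss ltry.
Qed.

Lemma Rintegral_gauss : \int[leb]_x gauss t x = 1.
Proof. by rewrite /Rintegral integral_gauss. Qed.

End positive_time.

Lemma Rintegral_even (f : R -> R) : (forall x, f (- x) = f x) ->
  leb.-integrable setT (EFin \o f) ->
  \int[leb]_x f x = 2 * \int[leb]_(x in `[0, +oo[) f x.
Proof.
move=> fN fi.
have mf : measurable_fun setT f by exact: integrable_EFin_measurable fi.
have U : [set: R] = `]-oo, 0[ `|` `[0, +oo[.
  by rewrite -setCitvr setvU.
rewrite [LHS](_ : _ = \int[leb]_(x in `]-oo, 0[ `|` `[0, +oo[) f x); last by rewrite -U.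
rewrite Rintegral_setU//; last 2 first.
- by rewrite -U.
- by apply/disj_setPS => x [] /=; rewrite !in_itv/= => h /andP[h' _]; move: h; rewrite ltNge h'.
rewrite mulr2n mulrDl mul1r; congr (_ + _).
rewrite -[RHS]Rintegral_itv_obnd_cbnd; last exact: integrableS fi.
rewrite [LHS]Rintegral_mkcond -(@Rintegral_reflect R _ 0); last first.
  by apply: (measurable_restrict _ _ _).1 => //; exact: measurable_funTS.
rewrite [RHS]Rintegral_mkcond; apply: eq_Rintegral => x _.
rewrite sub0r !patchE fN.
by congr (if _ then _ else _); apply/idP/idP; rewrite !inE/= !in_itv/= ?andbT oppr_lt0.
Qed.

End gaussian.

(** * Fourier transform of the heat kernel *)

Section transforms.
Context {R : realType}.
Notation leb := (@lebesgue_measure R).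
Implicit Types (t s x k r : R) (n : nat).

Lemma wexpE t k : wexp 0 t 0 k = expR (- (t * k ^+ 2)).
Proof. by rewrite /wexp expr0 mul1r mulr0 oppr0 sub0r. Qed.

Lemma sqrt_4pit t : 0 < t -> Num.sqrt (4 * pi * t) * Num.sqrt (4 * pi * (4 * t)^-1) = 2 * pi.
Proof.
move=> t0; rewrite -sqrtrM ?mulr_ge0 ?pi_ge0 ?ltW//.
have -> : 4 * pi * t * (4 * pi * (4 * t)^-1) = (2 * pi) ^+ 2 by field; rewrite gt_eqF.
by rewrite sqrtr_sqr ger0_norm// mulr_ge0// pi_ge0.
Qed.

Lemma sqrt_4pit_gt0 t : 0 < t -> 0 < Num.sqrt (4 * pi * t).
Proof. by move=> t0; rewrite sqrtr_gt0 !mulr_gt0 ?pi_gt0. Qed.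

(** The frequency weight exp(- t k^2) is, up to a constant, the heat kernel at the dual time 1 / (4
    t); facts about the Gaussian can thus be read on either side of the Fourier transform. *)
Lemma gauss_dual t k : 0 < t ->
  gauss (4 * t)^-1 k = Num.sqrt (4 * pi * t) / (2 * pi) * wexp 0 t 0 k.
Proof.
move=> t0; rewrite wexpE /gauss -(sqrt_4pit t0).
have -> : k ^+ 2 / (4 * (4 * t)^-1) = t * k ^+ 2 by field; rewrite gt_eqF.
congr (_ * _); field.
rewrite !gt_eqF ?sqrtr_gt0 ?mulr_gt0 ?invr_gt0 ?pi_gt0 ?mulr_gt0//.
Qed.

Lemma Ccos00 t : 0 < t -> Ccos 0 t 0 0 = gauss t 0.
Proof.
move=> t0; have t'0 : 0 < (4 * t)^-1 by rewrite invr_gt0 mulr_gt0.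
have := Rintegral_gauss t'0.
rewrite (Rintegral_even (gaussN _) (integrable_gauss t'0)).
under eq_Rintegral do rewrite gauss_dual//.
rewrite RintegralZl//; last first.
  have := integrable_wexp_cos 0 0 0 t0.
  by apply: eq_integrable => // k _ /=; rewrite mulr0 cos0 mulr1.
rewrite /Ccos gauss0.
have -> : \int[leb]_(x in `[0, +oo[) wexp 0 t 0 x =
  \int[leb]_(k in `[0, +oo[) (wexp 0 t 0 k * cos (k * 0)).
  by apply: eq_Rintegral => k _; rewrite mulr0 cos0 mulr1.
set I := \int[leb]_(k in _) _.
have s0 := sqrt_4pit_gt0 t0; set S := Num.sqrt _ in s0 *.
move=> h; apply: (@mulfI _ S); first by rewrite gt_eqF.
rewrite divff ?gt_eqF// -h; move: (lt0r_neq0 (pi_gt0 R)); clearbody S I; move: (@pi R) => p pn; by field.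
Qed.

(** Integration by parts in the frequency: the difference of the two integrands is the derivative of
    [F], which vanishes at 0 and at infinity. *)
Lemma Csin_ode t x : 0 < t -> Csin 1 t 0 x = x / (2 * t) * Ccos 0 t 0 x.
Proof.
move=> t0; apply/eqP; rewrite -subr_eq0; apply/eqP.
rewrite /Csin /Ccos mulrCA -mulrBr -[RHS](mulr0 pi^-1); congr (_ * _).
rewrite -RintegralZl//; last exact: integrable_wexp_cos.
rewrite -RintegralB//; last 2 first.
- exact: integrable_wexp_sin.
- by apply: integrableZl_EFin => //; exact: integrable_wexp_cos.
pose F k := - (2 * t)^-1 * (wexp 0 t 0 k * sin (k * x)).
transitivity (- (2 * t)^-1 * 0 - F 0); last by rewrite /F mul0r sin0 !mulr0 subrr.
apply: Rintegral_FTC2y.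
- by rewrite /wexp; cont.
- by move=> k; rewrite /F /wexp; deriv; field; rewrite gt_eqF.
- apply: integrableB_EFin => //; first exact: integrable_wexp_sin.
  by apply: integrableZl_EFin => //; exact: integrable_wexp_cos.
- apply: cvgMr; apply: (@cvg_dom_expRN _ _ (wexp_bound 0 t 0)) => k k0.
  by apply: norm_wexp_le => //; rewrite ?oppr0//; exact: norm_sin_le1.
Qed.

(** By [Csin_ode], the left-hand side solves f' = - x / (2 t) f, the equation of the Gaussian. The
    quotient [h] is therefore constant, and [Ccos00] gives its value. *)
Lemma Ccos_gauss t x : 0 < t -> Ccos 0 t 0 x = gauss t x.
Proof.
move=> t0.
pose h x := Ccos 0 t 0 x * expR (x ^+ 2 / (4 * t)).
have hd (y : R) : is_derive y 1 h 0.
  have e1 : is_derive y 1 (fun x => expR (x ^+ 2 / (4 * t))) (expR (y ^+ 2 / (4 * t)) * (y / (2 * t))).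
    by deriv; rewrite expr1; field; rewrite gt_eqF.
  apply: is_derive1_eq (is_derive1M (is_derive_Ccos 0 0 y t0) e1) _.
  by rewrite Csin_ode//; ring.
have := is_derive_0_is_cst x 0 hd.
rewrite /h expr0n /= mul0r expR0 mulr1 Ccos00// => e.
rewrite /gauss -gauss0 -e -mulrA -expRD subrr expR0 mulr1//.
Qed.

(** This is [Ccos_gauss] at the dual time, with position and frequency exchanged. *)
Lemma Rintegral_gauss_cos t k : 0 < t ->
  \int[leb]_w (gauss t w * cos (k * w)) = expR (- (t * k ^+ 2)).
Proof.
move=> t0; have t'0 : 0 < (4 * t)^-1 by rewrite invr_gt0 mulr_gt0.
rewrite Rintegral_even; last 2 first.
- by move=> w; rewrite gaussN mulrN cosN.
- apply: (@le_integrable_EFin R _ _ leb _ _ (gauss t)) => //.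
  + by rewrite /gauss; meas.
  + exact: integrable_gauss.
  + move=> w _; rewrite normrM ger0_norm ?gauss_ge0// -[leRHS]mulr1 ler_wpM2l ?gauss_ge0//.
    exact: norm_cos_le1.
have e w : gauss t w * cos (k * w) = (Num.sqrt (4 * pi * t))^-1 * (wexp 0 (4 * t)^-1 0 w * cos (w * k)).
  by rewrite wexpE /gauss mulrA (mulrC k) [(4 * t)^-1 * _]mulrC.
under eq_Rintegral do rewrite e.
rewrite RintegralZl//; last exact: integrable_wexp_cos.
have := Ccos_gauss k t'0; rewrite /Ccos => /(canRL (mulKf (invr_neq0 (lt0r_neq0 (pi_gt0 R))))) ->.
rewrite invrK gauss_dual// wexpE.
have := lt0r_neq0 (sqrt_4pit_gt0 t0); set S := Num.sqrt _.
move: (lt0r_neq0 (pi_gt0 R)); clearbody S; move: (@pi R) => p pn Sn; field.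
by rewrite pn.
Qed.

Lemma Rintegral_odd (f : R -> R) : (forall x, f (- x) = - f x) ->
  leb.-integrable setT (EFin \o f) -> \int[leb]_x f x = 0.
Proof.
move=> fN fi.
have mf : measurable_fun setT f by exact: integrable_EFin_measurable fi.
have := @Rintegral_reflect R f 0 mf.
under eq_Rintegral do rewrite sub0r fN.
rewrite RintegralN// => e; lra.
Qed.

Lemma integrable_gauss_mul t (c : R -> R) : 0 < t -> measurable_fun setT c ->
  (forall x, `|c x| <= 1) -> leb.-integrable setT (EFin \o (fun w => gauss t w * c w)).
Proof.
move=> t0 mc c1; apply: (@le_integrable_EFin R _ _ leb _ _ (gauss t)) => //.
- by apply: measurable_funM => //; exact: measurable_gauss.
- exact: integrable_gauss.
- by move=> w _; rewrite normrM ger0_norm ?gauss_ge0// -[leRHS]mulr1 ler_wpM2l ?gauss_ge0.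
Qed.

Lemma Rintegral_gauss_sin t k : 0 < t ->
  \int[leb]_w (gauss t w * sin (k * w)) = 0.
Proof.
move=> t0; apply: Rintegral_odd.
  by move=> w; rewrite gaussN !mulrN sinN mulrN.
apply: integrable_gauss_mul => //; first by meas.
by move=> x; exact: norm_sin_le1.
Qed.

(** Trigonometric functions are eigenfunctions of the convolution with [gauss t]: the addition
    formula separates x - y from w, and the sine part vanishes by parity. *)
Lemma gauss_conv_trig t k x y : 0 < t ->
  (\int[leb]_z (gauss t (x - z) * cos (k * (z - y))) = expR (- (t * k ^+ 2)) * cos (k * (x - y))) *
  (\int[leb]_z (gauss t (x - z) * sin (k * (z - y))) = expR (- (t * k ^+ 2)) * sin (k * (x - y))).
Proof.
move=> t0.
have ic : leb.-integrable setT (EFin \o (fun w => gauss t w * cos (k * w))).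
  apply: integrable_gauss_mul => //; first by meas.
  by move=> ?; exact: norm_cos_le1.
have is_ : leb.-integrable setT (EFin \o (fun w => gauss t w * sin (k * w))).
  apply: integrable_gauss_mul => //; first by meas.
  by move=> ?; exact: norm_sin_le1.
split.
- transitivity (\int[leb]_w (gauss t w * cos (k * ((x - w) - y)))).
    rewrite -(@Rintegral_reflect R _ x); last by rewrite /gauss; meas.
    by apply: eq_Rintegral => z _; rewrite subKr.
  transitivity (\int[leb]_w (cos (k * (x - y)) * (gauss t w * cos (k * w)) +
     sin (k * (x - y)) * (gauss t w * sin (k * w)))).
    apply: eq_Rintegral => w _.
    have -> : k * (x - w - y) = k * (x - y) - k * w by ring.
    by rewrite cosB; ring.
  rewrite RintegralD//; [|exact: integrableZl_EFin..].
  by rewrite !RintegralZl// Rintegral_gauss_sin// Rintegral_gauss_cos//; ring.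
- transitivity (\int[leb]_w (gauss t w * sin (k * ((x - w) - y)))).
    rewrite -(@Rintegral_reflect R _ x); last by rewrite /gauss; meas.
    by apply: eq_Rintegral => z _; rewrite subKr.
  transitivity (\int[leb]_w (sin (k * (x - y)) * (gauss t w * cos (k * w)) -
     cos (k * (x - y)) * (gauss t w * sin (k * w)))).
    apply: eq_Rintegral => w _.
    have -> : k * (x - w - y) = k * (x - y) - k * w by ring.
    by rewrite sinB; ring.
  rewrite RintegralB//; [|exact: integrableZl_EFin..].
  by rewrite !RintegralZl// Rintegral_gauss_sin// Rintegral_gauss_cos//; ring.
Qed.

End transforms.

(** * The Poisson kernel and its conjugate *)

Section poisson.
Context {R : realType}.
Notation leb := (@lebesgue_measure R).
Implicit Types (t s x k r : R) (n : nat).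

(* Poisson kernel for [0 < s]; odd in [s], and with exchanged arguments its
   conjugate kernel. *)
Definition pk s r : R := s / (pi * (s ^+ 2 + r ^+ 2)).

Lemma pkN s r : pk (- s) r = - pk s r.
Proof. by rewrite /pk sqrrN mulNr. Qed.

Lemma pkNr s r : pk s (- r) = pk s r.
Proof. by rewrite /pk sqrrN. Qed.

Lemma pk0 r : pk 0 r = 0.
Proof. by rewrite /pk mul0r. Qed.

Lemma pk_ge0 s r : 0 <= s -> 0 <= pk s r.
Proof. by move=> s0; rewrite divr_ge0// mulr_ge0 ?pi_ge0// addr_ge0 ?sqr_ge0. Qed.

Lemma norm_pk s r : `|pk s r| = pk `|s| r.
Proof.
have [s0|s0] := leP 0 s; first by rewrite (ger0_norm s0) ger0_norm// pk_ge0.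
by rewrite (ltr0_norm s0) pkN -normrN ger0_norm// -pkN pk_ge0// oppr_ge0 ltW.
Qed.

Lemma den_neq0 s r : 0 < s -> s ^+ 2 + r ^+ 2 != 0.
Proof. by move=> s0; rewrite gt_eqF// ltr_pwDl ?exprn_gt0 ?sqr_ge0. Qed.

(** The conjugate kernel decays only like 1 / |r| and is not integrable; this bound makes its
    products with a Gaussian integrable. *)
Lemma norm_pk_le r s : 0 < s -> `|pk r s| <= s^-1.
Proof.
move=> s0.
rewrite norm_pk /pk.
have p1 : 1 <= @pi R by apply: le_trans (pi_ge2 R); rewrite ler1n.
have D : 0 < `|r| ^+ 2 + s ^+ 2 by rewrite ltr_wpDl ?sqr_ge0 ?exprn_gt0.
rewrite ler_pdivrMr; last by rewrite mulr_gt0// pi_gt0.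
rewrite ler_pdivlMl//; have := normr_ge0 r; move: (`|r|) p1 {D} => a; move: (@pi R) => p p1 a0.
have : 0 <= (a - s) ^+ 2 by exact: sqr_ge0.
have : 0 <= (p - 1) * (a ^+ 2 + s ^+ 2) by rewrite mulr_ge0 ?subr_ge0// addr_ge0 ?sqr_ge0.
have : 0 <= a * s by rewrite mulr_ge0// ltW.
lra.
Qed.

Lemma norm_pk_le2 r s : 0 < s -> `|pk s r| <= s^-1.
Proof.
move=> s0; rewrite (ger0_norm (pk_ge0 _ (ltW s0))) /pk.
have p1 : 1 <= @pi R by apply: le_trans (pi_ge2 R); rewrite ler1n.
have D : 0 < s ^+ 2 + r ^+ 2 by rewrite ltr_pwDl ?sqr_ge0 ?exprn_gt0.
rewrite ler_pdivrMr; last by rewrite mulr_gt0// pi_gt0.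
rewrite ler_pdivlMl//; move: (@pi R) p1 => p p1.
have : 0 <= (p - 1) * (s ^+ 2 + r ^+ 2) by rewrite mulr_ge0 ?subr_ge0// ltW.
have := sqr_ge0 r; lra.
Qed.

Let is_derive_atan_pk s r : 0 < s ->
  is_derive r 1 (fun r => pi^-1 * atan (s^-1 * r)) (pk s r).
Proof.
move=> s0.
have e : is_derive r 1 (fun r => atan (s^-1 * r)) ((1 + (s^-1 * r) ^+ 2)^-1 * s^-1).
  notypeclasses refine (is_derive1_chain (f := atan) (g := fun r => s^-1 * r) (is_derive1_atan _) _).
  by deriv; ring.
apply: is_derive1_eq (is_derive1_cst_mul _ e) _.
rewrite /pk; have := den_neq0 r s0; have := lt0r_neq0 s0.
move: (lt0r_neq0 (pi_gt0 R)); move: (@pi R) => p pn sn d.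
have h : 1 + (s^-1 * r) ^+ 2 = (s ^+ 2 + r ^+ 2) / s ^+ 2 by field.
by rewrite h; field; rewrite d sn pn.
Qed.

Let cvg_atan_pk s : 0 < s -> pi^-1 * atan (s^-1 * r) @[r --> +oo] --> pi^-1 * (pi / 2).
Proof.
move=> s0; apply: cvgMr.
by apply: (@cvg_scaley _ _ (@atan R)); [rewrite invr_gt0|exact: cvgy_atan].
Qed.

Lemma continuous_pk s : 0 < s -> continuous (pk s).
Proof.
move=> s0; apply: derivable1_continuous => r; eexists; rewrite /pk.
by repeat deriv_step; rewrite mulf_neq0// ?(lt0r_neq0 (pi_gt0 R)) ?den_neq0.
Qed.

Lemma integral_pk s : 0 < s -> (\int[leb]_r (pk s r)%:E = 1)%E.
Proof.
move=> s0; rewrite ge0_symfun_integralT.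
- rewrite -set_itvcy.
  have -> : (\int[leb]_(r in `[0%R, +oo[) (pk s r)%:E =
      (pi^-1 * (pi / 2) - pi^-1 * atan (s^-1 * 0))%:E)%E.
    apply: (ge0_integral_FTC2y (F := fun r => pi^-1 * atan (s^-1 * r))).
    + by move=> r _; exact: pk_ge0 (ltW s0).
    + exact: continuous_pk.
    + by move=> r; exact: is_derive_atan_pk.
    + exact: cvg_atan_pk.
  rewrite mulr0 atan0 mulr0 subr0 -EFinM; congr EFin.
  by move: (lt0r_neq0 (pi_gt0 R)); move: (@pi R) => p pn; field.
- by move=> r; exact: pk_ge0 (ltW s0).
- exact: continuous_pk.
- by move=> r /=; rewrite pkNr.
Qed.

Lemma measurable_pk1 s : measurable_fun setT (pk s).
Proof. by rewrite /pk; meas. Qed.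

Lemma integrable_pk s : 0 < s -> leb.-integrable setT (EFin \o pk s).
Proof.
move=> s0; apply/integrableP; split; first by apply/measurable_EFinP; exact: measurable_pk1.
under eq_integral do rewrite /= ger0_norm ?pk_ge0 ?(ltW s0)//.
by rewrite integral_pk ?ltry.
Qed.

(** Only an inequality, because the kernel vanishes at s = 0. Heights of any sign are covered, as
    they occur when the field point lies above, below or level with the source. *)
Lemma integral_norm_pk_le1 s c : (\int[leb]_z `|pk s (z - c)|%:E <= 1)%E.
Proof.
have [->|s0] := eqVneq s 0.
  by rewrite integral0_eq ?lee01// => z _; rewrite pk0 normr0.
rewrite -(@integral_pk `|s|) ?normr_gt0// -(@ge0_integral_reflect _ (fun r => (pk `|s| r)%:E) c).
- by under eq_integral do rewrite norm_pk -pkNr opprB.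
- by apply/measurable_EFinP; exact: measurable_pk1.
- by move=> x; rewrite lee_fin pk_ge0.
Qed.

(** [F] is the real part of the primitive - exp(- (s - i r) k) / (s - i r) of exp(- (s - i r) k);
    [laplace_sin] uses its imaginary part. *)
Lemma laplace_cos s r : 0 < s ->
  \int[leb]_(k in `[0, +oo[) (expR (- (s * k)) * cos (k * r)) = pi * pk s r.
Proof.
move=> s0.
have sr := den_neq0 r s0.
pose F k := expR (- (s * k)) * ((r * sin (k * r) - s * cos (k * r)) / (s ^+ 2 + r ^+ 2)).
transitivity (0 - F 0).
  apply: Rintegral_FTC2y.
  - by cont.
  - move=> k; rewrite /F; deriv => //; field.
    exact: sr.
  - apply: (@le_integrable_EFin R _ _ leb _ _ (fun k => expR (- (s * k)))) => //.
    + by apply: measurable_funTS; meas.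
    + exact: integrable_expRMN.
    + move=> k _; rewrite normrM ger0_norm ?expR_ge0// -[leRHS]mulr1 ler_wpM2l ?expR_ge0//.
      exact: norm_cos_le1.
  - apply: norm_cvg0.
    apply: (@squeeze_cvgr _ _ _ _ (fun=> 0) (fun k => (`|r| + s) / (s ^+ 2 + r ^+ 2) * expR (- (s * k)))).
    + near=> k; rewrite normr_ge0/= /F normrM mulrC (ger0_norm (expR_ge0 _)) ler_wpM2r ?expR_ge0//.
      rewrite normrM normfV (ger0_norm (x := s ^+ 2 + _)) ?addr_ge0 ?sqr_ge0//.
      rewrite ler_wpM2r ?invr_ge0 ?addr_ge0 ?sqr_ge0// (le_trans (ler_normB _ _))// lerD// normrM.
        by rewrite ler_piMr// norm_sin_le1.
      by rewrite (ger0_norm (ltW s0)) ler_piMr ?(ltW s0)// norm_cos_le1.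
    + exact: cvg_cst.
    + rewrite -[X in _ --> X](mulr0 ((`|r| + s) / (s ^+ 2 + r ^+ 2))); apply: cvgMr.
      by apply: (@cvg_scaley _ _ (fun x => expR (- x))) => //; exact: cvgr_expR.
rewrite /F /pk mulr0 oppr0 expR0 !mul0r sin0 cos0; move: (lt0r_neq0 (pi_gt0 R)); move: (@pi R) => p pn.
by field; rewrite pn sr.
Unshelve. all: by end_near. Qed.

Lemma laplace_sin s r : 0 < s ->
  \int[leb]_(k in `[0, +oo[) (expR (- (s * k)) * sin (k * r)) = pi * pk r s.
Proof.
move=> s0.
have sr := den_neq0 r s0.
pose F k := - (expR (- (s * k)) * ((s * sin (k * r) + r * cos (k * r)) / (s ^+ 2 + r ^+ 2))).
transitivity (0 - F 0).
  apply: Rintegral_FTC2y.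
  - by cont.
  - move=> k; rewrite /F; deriv => //; field.
    exact: sr.
  - apply: (@le_integrable_EFin R _ _ leb _ _ (fun k => expR (- (s * k)))) => //.
    + by apply: measurable_funTS; meas.
    + exact: integrable_expRMN.
    + move=> k _; rewrite normrM ger0_norm ?expR_ge0// -[leRHS]mulr1 ler_wpM2l ?expR_ge0//.
      exact: norm_sin_le1.
  - apply: norm_cvg0.
    apply: (@squeeze_cvgr _ _ _ _ (fun=> 0) (fun k => (s + `|r|) / (s ^+ 2 + r ^+ 2) * expR (- (s * k)))).
    + near=> k; rewrite normr_ge0/= /F normrN normrM mulrC (ger0_norm (expR_ge0 _)) ler_wpM2r ?expR_ge0//.
      rewrite normrM normfV (ger0_norm (x := s ^+ 2 + _)) ?addr_ge0 ?sqr_ge0//.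
      rewrite ler_wpM2r ?invr_ge0 ?addr_ge0 ?sqr_ge0// (le_trans (ler_normD _ _))// lerD// normrM.
        by rewrite (ger0_norm (ltW s0)) ler_piMr ?(ltW s0)// norm_sin_le1.
      by rewrite ler_piMr// norm_cos_le1.
    + exact: cvg_cst.
    + rewrite -[X in _ --> X](mulr0 ((s + `|r|) / (s ^+ 2 + r ^+ 2))); apply: cvgMr.
      by apply: (@cvg_scaley _ _ (fun x => expR (- x))) => //; exact: cvgr_expR.
rewrite /F /pk mulr0 oppr0 expR0 !mul0r sin0 cos0; move: (lt0r_neq0 (pi_gt0 R)); move: (@pi R) => p pn.
by rewrite (addrC (r ^+ 2)); field; rewrite pn sr.
Unshelve. all: by end_near. Qed.

(** By [laplace_cos] the Poisson kernel is a superposition of cosines with weight exp(- s k). Fubini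
    applies thanks to this weight and the Gaussian, and the convolution multiplies each cosine by
    exp(- t k^2). *)
Lemma gauss_conv_pk t s x y : 0 < t -> 0 < s ->
  \int[leb]_z (gauss t (x - z) * pk s (z - y)) = Ccos 0 t s (x - y).
Proof.
move=> t0 s0.
transitivity (\int[leb]_z \int[leb]_(k in `[0, +oo[)
   (gauss t (x - z) * (pi^-1 * (expR (- (s * k)) * cos (k * (z - y)))))).
  apply: eq_Rintegral => z _.
  have ic : leb.-integrable `[0, +oo[ (EFin \o (fun k => expR (- (s * k)) * cos (k * (z - y)))).
    apply: (@le_integrable_EFin R _ _ leb _ _ (fun k => expR (- (s * k)))) => //.
    + by apply: measurable_funTS; meas.
    + exact: integrable_expRMN.
    + move=> k _; rewrite normrM ger0_norm ?expR_ge0// -[leRHS]mulr1 ler_wpM2l ?expR_ge0//.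
      exact: norm_cos_le1.
  rewrite RintegralZl//; last exact: integrableZl_EFin.
  by rewrite RintegralZl// laplace_cos// mulKf// lt0r_neq0// pi_gt0.
have fi : (leb \x leb)%E.-integrable (setT `*` `[0, +oo[) (EFin \o (fun p =>
   (gauss t (x - p.1) * (pi^-1 * (expR (- (s * p.2)) * cos (p.2 * (p.1 - y))))))).
  apply: (@integrable_prod_dom R _ _ _ _ leb leb _ _
    (fun z k => gauss t (x - z) * (pi^-1 * (expR (- (s * k)) * cos (k * (z - y)))))
    (fun z => gauss t (x - z)) (fun k => pi^-1 * expR (- (s * k)))) => //.
  - by rewrite /gauss; meas.
  - exact: integrable_reflect (integrable_gauss t0).
  - by apply: integrableZl_EFin => //; exact: integrable_expRMN.
  - move=> z k _ _; rewrite normrM ger0_norm ?gauss_ge0// ler_wpM2l ?gauss_ge0//.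
    rewrite normrM ger0_norm ?invr_ge0 ?pi_ge0// ler_wpM2l ?invr_ge0 ?pi_ge0//.
    rewrite normrM ger0_norm ?expR_ge0// -[leRHS]mulr1 ler_wpM2l ?expR_ge0//.
    exact: norm_cos_le1.
rewrite (Rintegral_swap _ _ fi)//.
transitivity (\int[leb]_(k in `[0, +oo[) (pi^-1 * (wexp 0 t s k * cos (k * (x - y))))).
  apply: eq_Rintegral => k _.
  transitivity (\int[leb]_z (pi^-1 * expR (- (s * k)) * (gauss t (x - z) * cos (k * (z - y))))).
    by apply: eq_Rintegral => z _; ring.
  rewrite RintegralZl//; last first.
    apply: (@le_integrable_EFin R _ _ leb _ _ (fun z => gauss t (x - z))) => //.
      by rewrite /gauss; meas.
      exact: integrable_reflect (integrable_gauss t0).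
    move=> z _; rewrite normrM ger0_norm ?gauss_ge0// -[leRHS]mulr1 ler_wpM2l ?gauss_ge0//.
    exact: norm_cos_le1.
  rewrite gauss_conv_trig// /wexp expr0 mul1r expRD [s * k]mulrC; ring.
by rewrite RintegralZl//; exact: integrable_wexp_cos.
Qed.

Lemma gauss_conv_cpk t s x y : 0 < t -> 0 < s ->
  \int[leb]_z (gauss t (x - z) * pk (z - y) s) = Csin 0 t s (x - y).
Proof.
move=> t0 s0.
transitivity (\int[leb]_z \int[leb]_(k in `[0, +oo[)
   (gauss t (x - z) * (pi^-1 * (expR (- (s * k)) * sin (k * (z - y)))))).
  apply: eq_Rintegral => z _.
  have ic : leb.-integrable `[0, +oo[ (EFin \o (fun k => expR (- (s * k)) * sin (k * (z - y)))).
    apply: (@le_integrable_EFin R _ _ leb _ _ (fun k => expR (- (s * k)))) => //.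
    + by apply: measurable_funTS; meas.
    + exact: integrable_expRMN.
    + move=> k _; rewrite normrM ger0_norm ?expR_ge0// -[leRHS]mulr1 ler_wpM2l ?expR_ge0//.
      exact: norm_sin_le1.
  rewrite RintegralZl//; last exact: integrableZl_EFin.
  by rewrite RintegralZl// laplace_sin// mulKf// lt0r_neq0// pi_gt0.
have fi : (leb \x leb)%E.-integrable (setT `*` `[0, +oo[) (EFin \o (fun p =>
   (gauss t (x - p.1) * (pi^-1 * (expR (- (s * p.2)) * sin (p.2 * (p.1 - y))))))).
  apply: (@integrable_prod_dom R _ _ _ _ leb leb _ _
    (fun z k => gauss t (x - z) * (pi^-1 * (expR (- (s * k)) * sin (k * (z - y)))))
    (fun z => gauss t (x - z)) (fun k => pi^-1 * expR (- (s * k)))) => //.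
  - by rewrite /gauss; meas.
  - exact: integrable_reflect (integrable_gauss t0).
  - by apply: integrableZl_EFin => //; exact: integrable_expRMN.
  - move=> z k _ _; rewrite normrM ger0_norm ?gauss_ge0// ler_wpM2l ?gauss_ge0//.
    rewrite normrM ger0_norm ?invr_ge0 ?pi_ge0// ler_wpM2l ?invr_ge0 ?pi_ge0//.
    rewrite normrM ger0_norm ?expR_ge0// -[leRHS]mulr1 ler_wpM2l ?expR_ge0//.
    exact: norm_sin_le1.
rewrite (Rintegral_swap _ _ fi)//.
transitivity (\int[leb]_(k in `[0, +oo[) (pi^-1 * (wexp 0 t s k * sin (k * (x - y))))).
  apply: eq_Rintegral => k _.
  transitivity (\int[leb]_z (pi^-1 * expR (- (s * k)) * (gauss t (x - z) * sin (k * (z - y))))).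
    by apply: eq_Rintegral => z _; ring.
  rewrite RintegralZl//; last first.
    apply: (@le_integrable_EFin R _ _ leb _ _ (fun z => gauss t (x - z))) => //.
      by rewrite /gauss; meas.
      exact: integrable_reflect (integrable_gauss t0).
    move=> z _; rewrite normrM ger0_norm ?gauss_ge0// -[leRHS]mulr1 ler_wpM2l ?gauss_ge0//.
    exact: norm_sin_le1.
  rewrite gauss_conv_trig// /wexp expr0 mul1r expRD [s * k]mulrC; ring.
by rewrite RintegralZl//; exact: integrable_wexp_sin.
Qed.

End poisson.

Section more_integration.
Context {R : realType}.

Lemma cvg_Rintegral_dom d (T : measurableType d) (mu : {measure set T -> \bar R})
  (D : set T) (f_ : nat -> T -> R) (f g : T -> R) : measurable D ->
  (forall n, measurable_fun D (f_ n)) -> measurable_fun D f ->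
  (forall x, D x -> f_ n x @[n --> \oo] --> f x) ->
  mu.-integrable D (EFin \o g) -> (forall n x, D x -> `|f_ n x| <= g x) ->
  \int[mu]_(x in D) f_ n x @[n --> \oo] --> \int[mu]_(x in D) f x.
Proof.
move=> mD mf_ mf ff gi fg.
have [fi _ cv] : [/\ mu.-integrable D (EFin \o f),
   (\int[mu]_(x in D) `|(f_ n x)%:E - (f x)%:E|)%E @[n --> \oo] --> 0%E &
   (\int[mu]_(x in D) (f_ n x)%:E)%E @[n --> \oo] --> (\int[mu]_(x in D) (f x)%:E)%E].
  apply: (@dominated_convergence _ _ _ mu D mD (fun n x => (f_ n x)%:E) (EFin \o f) (EFin \o g)) => //.
  - by move=> n; exact/measurable_EFinP.
  - exact/measurable_EFinP.
  - by apply/aeW => x Dx; apply: cvg_EFin; [exact: nearW|exact: ff].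
  - by apply/aeW => x n Dx; rewrite lee_fin fg.
apply: fine_cvg; rewrite fineK//.
exact: integrable_fin_num fi.
Qed.

Lemma integrable_mul_le1 d (T : measurableType d) (mu : {measure set T -> \bar R})
  (D : set T) (f c : T -> R) : measurable D ->
  mu.-integrable D (EFin \o f) -> measurable_fun D c ->
  (forall x, D x -> `|c x| <= 1) -> mu.-integrable D (EFin \o (fun x => f x * c x)).
Proof.
move=> mD fi mc c1.
apply: (@le_integrable_EFin R _ _ mu _ _ (fun x => `|f x|)) => //.
- by apply: measurable_funM => //; exact: integrable_EFin_measurable fi.
- exact: integrable_norm fi.
- by move=> x Dx; rewrite normrM -[leRHS]mulr1 ler_wpM2l// c1.
Qed.
End more_integration.

(** * Fourier transform of the Poisson kernel *)

Section fourier_poisson.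
Context {R : realType}.
Notation leb := (@lebesgue_measure R).
Implicit Types (t s x k r : R) (n : nat).

(** The symmetrized function f(x) + f(- x) is even, so that [Rintegral_even] applies to it. *)
Lemma Rintegral_fold (f : R -> R) : leb.-integrable setT (EFin \o f) ->
  \int[leb]_x f x = \int[leb]_(x in `[0, +oo[) (f x + f (- x)).
Proof.
move=> fi.
have fi' : leb.-integrable setT (EFin \o (fun x => f (- x))).
  have := integrable_reflect 0 fi; apply: eq_integrable => // x _ /=.
  by rewrite sub0r.
have mf : measurable_fun setT f by exact: integrable_EFin_measurable fi.
rewrite [RHS](_ : _ = 2^-1 * (2 * \int[leb]_(x in `[0, +oo[) (f x + f (- x)))); last first.
  by rewrite mulKf.
rewrite -Rintegral_even.
- rewrite RintegralD//.
  rewrite (_ : \int[leb]_x f (- x) = \int[leb]_x f x); first by field.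
  rewrite -(@Rintegral_reflect R f 0)//.
  by apply: eq_Rintegral => x _; rewrite sub0r.
- by move=> x; rewrite opprK addrC.
- exact: integrableD_EFin.
Qed.

Lemma Rintegral_fold_shift (f : R -> R) k : (forall x, f (- x) = f x) ->
  leb.-integrable setT (EFin \o f) ->
  \int[leb]_(x in `[0, +oo[) (f (x - k) + f (x + k)) = \int[leb]_x f x.
Proof.
move=> fN fi.
rewrite -(@Rintegral_reflect R f k); last by exact: integrable_EFin_measurable fi.
rewrite (Rintegral_fold (integrable_reflect k fi)).
apply: eq_Rintegral => x _; rewrite opprK (addrC x k); congr (_ + _).
by rewrite -fN opprB.
Qed.

Lemma integrable_shift (f : R -> R) k : (forall x, f (- x) = f x) ->
  leb.-integrable setT (EFin \o f) ->
  leb.-integrable `[0, +oo[ (EFin \o (fun x => f (x - k) + f (x + k))).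
Proof.
move=> fN fi; apply: integrableD_EFin => //.
  have := integrable_reflect k fi => fik; apply: (integrableS (E := setT)) => //.
  by move: fik; apply: eq_integrable => // x _ /=; rewrite -fN opprB.
have := integrable_reflect (- k) fi => fik; apply: (integrableS (E := setT)) => //.
by move: fik; apply: eq_integrable => // x _ /=; rewrite -fN opprB opprK.
Qed.

Lemma integrable_expRN_abs : leb.-integrable setT (EFin \o (fun x : R => expR (- `|x|))).
Proof.
have mE : measurable_fun setT (fun x : R => expR (- `|x|)).
  by meas.
apply/integrableP; split; first by apply/measurable_EFinP.
under eq_integral do rewrite /= ger0_norm ?expR_ge0//.
rewrite ge0_symfun_integralT//.
- rewrite -set_itvcy.
  have h : (\int[leb]_(x in `[0%R, +oo[) (expR (- x))%:E)%E \is a fin_num.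
    by apply: integrable_fin_num => //; exact: integrable_expRN.
  rewrite (_ : (\int[leb]_(x in `[0%R, +oo[) _)%E =
      \int[leb]_(x in `[0%R, +oo[) (expR (- x))%:E)%E.
    by rewrite lte_mul_pinfty// ltey_eq h.
  by apply: eq_integral => x; rewrite inE/= in_itv/= andbT => x0; rewrite ger0_norm.
- move=> x; apply: continuous_comp; last exact: continuous_expR.
  by apply: continuous_comp; [exact: norm_continuous|exact: opp_continuous].
- by move=> x /=; rewrite normrN.
Qed.

(** Both sides are the derivative in x of [gauss_conv_cpk]: one taken under the integral, the other
    from its closed form [Csin]. *)
Lemma dgauss_conv_cpk t s x y : 0 < t -> 0 < s ->
  \int[leb]_z (dgauss t (x - z) * pk (z - y) s) = Ccos 1 t s (x - y).
Proof.
move=> t0 s0.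
have pks r := norm_pk_le r s0.
have mpk (y' : R) : measurable_fun setT (fun z : R => pk (z - y') s) by rewrite /pk; meas.
have gi (x' : R) : leb.-integrable setT (EFin \o (fun z => gauss t (x' - z))).
  exact: integrable_reflect (integrable_gauss t0).
have h1 : is_derive x 1 (fun x => \int[leb]_z (gauss t (x - z) * pk (z - y) s))
    (\int[leb]_z (dgauss t (x - z) * pk (z - y) s)).
  (* The factor [expR 1] pays for replacing x' by x in the exponential decay, as they differ by at
     most 1. *)
  apply: (@is_derive_Rintegral R _ _ leb (fun x z => gauss t (x - z) * pk (z - y) s)
     (fun x z => dgauss t (x - z) * pk (z - y) s)
     (fun z => s^-1 * (gauss_bound t * (expR 1 * expR (- `|x - z|)))) _ x (x - 1) (x + 1)) => //.
  - by rewrite ltrBlDr ltrDl.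
  - by rewrite ltrDl.
  - move=> x' _ _.
    apply: (@le_integrable_EFin R _ _ leb _ _ (fun z => s^-1 * gauss t (x' - z))) => //.
    + by rewrite /gauss /pk; meas.
    + exact: integrableZl_EFin.
    + move=> z _; rewrite normrM mulrC (ger0_norm (gauss_ge0 _ _)).
      by rewrite ler_wpM2r ?gauss_ge0.
  - move=> x' z _ _ _.
    have e : is_derive x' 1 (fun x => gauss t (x - z)) (dgauss t (x' - z) * 1).
      notypeclasses refine (is_derive1_chain (f := gauss t) (g := fun x => x - z) (is_derive_gauss t0 _) _).
      by deriv; ring.
    by apply: is_derive1_eq (is_derive1M e (is_derive_cst (pk (z - y) s) _ _)) _; rewrite /=; ring.
  - do 3 apply: integrableZl_EFin => //.
    exact: integrable_reflect integrable_expRN_abs.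
  - move=> x' z h h' _; rewrite normrM mulrC ler_pM//.
    apply: (le_trans (dgauss_exp_le t0 _)).
    rewrite ler_wpM2l ?gauss_bound_ge0// -expRD ler_expR.
    have : `|x - z| <= `|x' - z| + `|x - x'|.
      by rewrite -[x - z](_ : (x' - z) + (x - x') = _) ?ler_normD//; ring.
    have : `|x - x'| <= 1 by rewrite ler_norml; lra.
    lra.
have h2 : is_derive x 1 (fun x => \int[leb]_z (gauss t (x - z) * pk (z - y) s))
   (Ccos 1 t s (x - y)).
  rewrite (_ : (fun x => _) = fun x => Csin 0 t s (x - y)); last first.
    by apply/funext => x'; rewrite gauss_conv_cpk.
  apply: is_derive1_eq; last exact: mulr1.
  notypeclasses refine (is_derive1_chain (f := Csin 0 t s) (g := fun x => x - y) (is_derive_Csin _ _ _ t0) _).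
  by deriv; ring.
by have [_ <-] := h1; have [_ <-] := h2.
Qed.

Lemma norm_expRNB a b : 0 <= a -> 0 <= b -> `|expR (- a) - expR (- b : R)| <= `|a - b|.
Proof.
wlog ab : a b / a <= b.
  move=> h a0 b0; have [ab|/ltW ba] := leP a b; first exact: h.
  by rewrite distrC (distrC a); exact: h.
move=> a0 b0; rewrite (distrC a) (ger0_norm (x := b - a)) ?subr_ge0//.
rewrite ger0_norm ?subr_ge0 ?ler_expR ?lerN2//.
have -> : expR (- b) = expR (- a) * expR (- (b - a)) by rewrite -expRD; congr expR; ring.
have : expR (- a) <= 1 by rewrite -expR0 ler_expR oppr_le0.
have := expR_ge0 (- a); have := expR_ge1Dx (- (b - a)).
by have := expR_ge0 (- (b - a)); nra.
Qed.

(** On the half line - 2 t [gauss t] is a primitive. This first moment controls the error of an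
    approximate identity in [fourier_pk] and gives the L^1 norm of [dgauss]. *)
Lemma Rintegral_abs_gauss t : 0 < t ->
  leb.-integrable setT (EFin \o (fun v => `|v| * gauss t v)) /\
  \int[leb]_v (`|v| * gauss t v) = 4 * t * gauss t 0.
Proof.
move=> t0.
have i : leb.-integrable setT (EFin \o (fun v => `|v| * gauss t v)).
  apply: (@le_integrable_EFin R _ _ leb _ _ (fun v => 2 * t * (gauss_bound t * expR (- `|v|)))) => //.
  - by rewrite /gauss; meas.
  - by do 2 apply: integrableZl_EFin => //; exact: integrable_expRN_abs.
  - move=> v _; have t2 : 0 < 2 * t by rewrite mulr_gt0.
    have -> : `|v| * gauss t v = - (2 * t) * (- (`|v| / (2 * t)) * gauss t v).
      by field; rewrite gt_eqF.
    rewrite normrM normrN (ger0_norm (ltW t2)) ler_wpM2l ?(ltW t2)//.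
    have -> : `|- (`|v| / (2 * t)) * gauss t v| = `|dgauss t v|.
      by rewrite /dgauss [LHS]normrM [RHS]normrM !normrN !(normrM _ (_^-1)) normr_id.
    exact: dgauss_exp_le.
split=> //.
rewrite Rintegral_even//; last by move=> v; rewrite normrN gaussN.
have -> : \int[leb]_(x in `[0, +oo[) (`|x| * gauss t x) = \int[leb]_(x in `[0, +oo[) (x * gauss t x).
  by apply: eq_Rintegral => x; rewrite inE/= in_itv/= andbT => x0; rewrite ger0_norm.
have -> : \int[leb]_(x in `[0, +oo[) (x * gauss t x) = 2 * t * 0 - (- (2 * t) * gauss t 0).
  apply: (Rintegral_FTC2y (F := fun x => - (2 * t) * gauss t x)).
  - by rewrite /gauss; cont.
  - move=> x; apply: is_derive1_eq (is_derive1_cst_mul _ (is_derive_gauss t0 x)) _.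
    by rewrite /dgauss; field; rewrite gt_eqF.
  - apply: (integrableS (E := setT)) => //.
    apply: (@le_integrable_EFin R _ _ leb _ _ (fun v => `|v| * gauss t v)) => //.
      by rewrite /gauss; meas.
    by move=> v _; rewrite normrM (ger0_norm (gauss_ge0 _ _)).
  - rewrite [X in _ --> X](_ : _ = - (2 * t) * 0); last by rewrite !mulr0.
    apply: cvgMr; apply: (@cvg_dom_expRN _ _ (gauss_bound t)) => x x0.
    by rewrite ger0_norm ?gauss_ge0//; apply: (le_trans (gauss_exp_le t0 x)); rewrite ger0_norm.
ring.
Qed.

Lemma integrable_expRMN_cos s k : 0 < s ->
  leb.-integrable `[0, +oo[ (EFin \o (fun l => expR (- (s * l)) * cos (l * k))).
Proof.
move=> s0; apply: integrable_mul_le1 => //; first exact: integrable_expRMN.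
  by apply: measurable_funTS; meas.
by move=> l _; exact: norm_cos_le1.
Qed.

(** Inserting [laplace_cos] for [pk] gives a double integral that is not absolutely convergent. The
    factor exp(- e w^2) repairs this, and the integral in w then yields heat kernels at time e
    centred at the frequencies k and - k. *)
Let regularized r k e : 0 < r -> 0 < e ->
  \int[leb]_w (pk r w * cos (k * w) * wexp 0 e 0 w) =
  \int[leb]_(l in `[0, +oo[) (expR (- (r * l)) * (gauss e (l - k) + gauss e (l + k))).
Proof.
move=> r0 e0.
have e'0 : 0 < (4 * e)^-1 by rewrite invr_gt0 mulr_gt0.
have wi : leb.-integrable setT (EFin \o wexp 0 e 0).
  have := integrableZl_EFin (2 * pi / Num.sqrt (4 * pi * e)) measurableT (integrable_gauss e'0).
  apply: eq_integrable => // w _ /=; rewrite gauss_dual//.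
  have := lt0r_neq0 (sqrt_4pit_gt0 e0); set S := Num.sqrt _.
  move: (lt0r_neq0 (pi_gt0 R)); clearbody S; move: (@pi R) => p pn Sn; congr EFin; field.
  by rewrite pn.
have wge0 w : 0 <= wexp 0 e 0 w by rewrite wexpE expR_ge0.
have wcos m : \int[leb]_w (wexp 0 e 0 w * cos (m * w)) = 2 * pi * gauss e m.
  transitivity (\int[leb]_w ((2 * pi / Num.sqrt (4 * pi * e)) * (gauss (4 * e)^-1 w * cos (m * w)))).
    apply: eq_Rintegral => w _; rewrite gauss_dual//.
    have := lt0r_neq0 (sqrt_4pit_gt0 e0); set S := Num.sqrt _.
    move: (lt0r_neq0 (pi_gt0 R)); clearbody S; move: (@pi R) => p pn Sn; field.
    by rewrite pn.
  rewrite RintegralZl//; last first.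
    by apply: integrable_gauss_mul => //; [meas|move=> ?; exact: norm_cos_le1].
  rewrite Rintegral_gauss_cos// /gauss.
  have -> : (4 * e)^-1 * m ^+ 2 = m ^+ 2 / (4 * e) by rewrite mulrC.
  ring.
transitivity (\int[leb]_w \int[leb]_(l in `[0, +oo[)
   (pi^-1 * (expR (- (r * l)) * cos (l * w)) * (cos (k * w) * wexp 0 e 0 w))).
  apply: eq_Rintegral => w _; rewrite RintegralZr//; last first.
    by apply: integrableZl_EFin => //; exact: integrable_expRMN_cos.
  rewrite RintegralZl//; last exact: integrable_expRMN_cos.
  by rewrite laplace_cos// mulKf ?mulrA// lt0r_neq0// pi_gt0.
have fi : (leb \x leb)%E.-integrable (setT `*` `[0, +oo[) (EFin \o (fun p =>
   (pi^-1 * (expR (- (r * p.2)) * cos (p.2 * p.1)) * (cos (k * p.1) * wexp 0 e 0 p.1)))).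
  apply: (@integrable_prod_dom R _ _ _ _ leb leb _ _
    (fun w l => (pi^-1 * (expR (- (r * l)) * cos (l * w)) * (cos (k * w) * wexp 0 e 0 w)))
    (wexp 0 e 0) (fun l => pi^-1 * expR (- (r * l)))) => //.
  - by rewrite /wexp; meas.
  - by apply: integrableZl_EFin => //; exact: integrable_expRMN.
  - move=> w l _ _; rewrite normrM mulrC; apply: ler_pM => //.
      by rewrite normrM (ger0_norm (wge0 _)) ler_piMl// norm_cos_le1.
    rewrite normrM ger0_norm ?invr_ge0 ?pi_ge0// ler_wpM2l ?invr_ge0 ?pi_ge0//.
    rewrite normrM ger0_norm ?expR_ge0// -[leRHS]mulr1 ler_wpM2l ?expR_ge0//.
    exact: norm_cos_le1.
rewrite (Rintegral_swap _ _ fi)//.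
apply: eq_Rintegral => l _.
transitivity (\int[leb]_w (pi^-1 * expR (- (r * l)) / 2 *
   (wexp 0 e 0 w * cos ((l - k) * w) + wexp 0 e 0 w * cos ((l + k) * w)))).
  apply: eq_Rintegral => w _.
  have -> : (l - k) * w = l * w - k * w by ring.
  have -> : (l + k) * w = l * w + k * w by ring.
  rewrite cosB cosD; move: (lt0r_neq0 (pi_gt0 R)); move: (@pi R) => p pn.
  by field.
have wci m : leb.-integrable setT (EFin \o (fun w => wexp 0 e 0 w * cos (m * w))).
  by apply: integrable_mul_le1 => //; [meas|move=> ? _; exact: norm_cos_le1].
rewrite RintegralZl//; last exact: integrableD_EFin.
rewrite RintegralD// !wcos.
by move: (lt0r_neq0 (pi_gt0 R)); move: (@pi R) => p pn; field.
Qed.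

Lemma fourier_pk r k : 0 < r -> 0 <= k ->
  \int[leb]_w (pk r w * cos (k * w)) = expR (- (r * k)).
Proof.
move=> r0 k0.
pose e n : R := n.+1%:R^-1.
have e0 n : 0 < e n by rewrite invr_gt0.
pose I n := \int[leb]_w (pk r w * cos (k * w) * wexp 0 (e n) 0 w).
have wcv : e n @[n --> \oo] --> (0 : R) by exact: cvg_harmonic.
have cv1 : I n @[n --> \oo] --> \int[leb]_w (pk r w * cos (k * w)).
  apply: (@cvg_Rintegral_dom R _ _ leb _ _ _ (pk r)) => //.
  - by move=> n; rewrite /pk /wexp; meas.
  - by rewrite /pk; meas.
  - move=> w _; rewrite -[X in _ --> X]mulr1; apply: cvgMr.
    rewrite (_ : (fun n => wexp 0 (e n) 0 w) = fun n => expR (- (e n * w ^+ 2))); last first.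
      by apply/funext => n; rewrite wexpE.
    rewrite -[X in _ --> X]expR0; apply: continuous_cvg; first exact: continuous_expR.
    rewrite -oppr0; apply: cvgN; rewrite -[X in _ --> X](mul0r (w ^+ 2)).
    exact: cvgMl.
  - exact: integrable_pk.
  - move=> n w _; rewrite -mulrA normrM (ger0_norm (pk_ge0 _ (ltW r0))).
    rewrite -[leRHS]mulr1 ler_wpM2l ?pk_ge0 ?(ltW r0)// normrM mulr_ile1 ?norm_cos_le1//.
    rewrite wexpE ger0_norm ?expR_ge0// -expR0 ler_expR oppr_le0 mulr_ge0 ?sqr_ge0//.
    exact: ltW.
apply: (cvg_unique _ cv1) => //.
apply/subr_cvg0; apply: norm_cvg0.
(* The two heat kernels have total mass 1 on the half line and l -> exp(- r l) has Lipschitz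
   constant r there, so the error is at most r times a first moment, of order sqrt e. *)
apply: (@squeeze_cvgr _ _ _ _ (fun=> 0) (fun n => r * (4 * e n * gauss (e n) 0))).
- apply: nearW => n; rewrite normr_ge0/= /I regularized//.
  have gi := integrable_shift k (gaussN (e n)) (integrable_gauss (e0 n)).
  have mg : measurable_fun (`[0, +oo[ : set (measurableTypeR R)) (fun l : R => gauss (e n) (l - k) + gauss (e n) (l + k)).
    exact: integrable_EFin_measurable gi.
  have agi := Rintegral_abs_gauss (e0 n).
  have even : forall v : R, `|- v| * gauss (e n) (- v) = `|v| * gauss (e n) v.
    by move=> v; rewrite normrN gaussN.
  have -> : expR (- (r * k)) =
     \int[leb]_(l in `[0, +oo[) (expR (- (r * k)) * (gauss (e n) (l - k) + gauss (e n) (l + k))).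
    rewrite RintegralZl// Rintegral_fold_shift ?Rintegral_gauss ?mulr1//.
      by move=> ?; exact: gaussN.
    exact: integrable_gauss.
  rewrite -RintegralB//; last 2 first.
  + have := @integrable_mul_le1 R _ _ leb `[0, +oo[ _ (fun l => expR (- (r * l))) _ gi.
    rewrite (_ : (fun x => _ * _) = (fun l => expR (- (r * l)) *
       (gauss (e n) (l - k) + gauss (e n) (l + k)))); last by apply/funext => l; rewrite mulrC.
    apply => //; first by apply: measurable_funTS; meas.
    move=> l /=; rewrite in_itv/= andbT => l0.
    by rewrite ger0_norm ?expR_ge0// -expR0 ler_expR oppr_le0 mulr_ge0// ltW.
  + exact: integrableZl_EFin.
  rewrite -(agi.2) -(Rintegral_fold_shift k even agi.1).
  rewrite -RintegralZl//; last exact: integrable_shift even agi.1.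
  apply: le_normr_Rintegral_dom => //.
  + apply: measurable_funB; apply: measurable_funM => //.
    by apply: measurable_funTS; meas.
  + by apply: integrableZl_EFin => //; exact: (integrable_shift k even agi.1).
  + move=> l /=; rewrite in_itv/= andbT => l0; rewrite -mulrBl normrM.
    rewrite [X in _ * X <= _]ger0_norm ?addr_ge0 ?gauss_ge0//.
    apply: (@le_trans _ _ (r * `|l - k| * (gauss (e n) (l - k) + gauss (e n) (l + k)))).
      rewrite ler_wpM2r ?addr_ge0 ?gauss_ge0//.
      apply: (le_trans (norm_expRNB _ _)); rewrite ?mulr_ge0 ?(ltW r0)//.
      by rewrite -mulrBr normrM ger0_norm ?(ltW r0).
    (* For the mirror image centred at - k the distance |l - k| is enlarged to |l + k|, after which
       the first moment folds onto the half line. *)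
    rewrite -mulrA ler_wpM2l ?(ltW r0)// mulrDr lerD2l ler_wpM2r ?gauss_ge0//.
    by rewrite (ger0_norm (x := l + k)) ?addr_ge0// ler_norml; lra.
- exact: cvg_cst.
- rewrite -[X in _ --> X](mulr0 r); apply: cvgMr.
  apply: (@squeeze_cvgr _ _ _ _ (fun=> 0) (fun n => 4 * Num.sqrt (e n))).
  + apply: nearW => n; rewrite !mulr_ge0 ?gauss_ge0 ?(ltW (e0 n))//= -mulrA ler_wpM2l//.
    rewrite gauss0 -ler_pdivlMr ?invr_gt0 ?sqrt_4pit_gt0// invrK.
    rewrite -sqrtrM ?(ltW (e0 n))// -[leLHS](ger0_norm (ltW (e0 n))) -sqrtr_sqr.
    rewrite ler_wsqrtr// expr2 ler_wpM2l ?(ltW (e0 n))// ler_peMl ?(ltW (e0 n))//.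
    have : 2 <= @pi R := pi_ge2 R; lra.
  + exact: cvg_cst.
  + rewrite -[X in _ --> X](mulr0 4); apply: cvgMr.
    rewrite -(@sqrtr0 R); apply: continuous_cvg => //; exact: sqrt_continuous.
Qed.

(** By [fourier_pk], convolution with the Poisson kernel of height s multiplies the frequency k by
    exp(- s k), which adds s to the height. *)
Lemma Ccos1_conv_pk t s x y : 0 < t -> 0 < s ->
  \int[leb]_z (Ccos 1 t 0 (x - z) * pk s (z - y)) = Ccos 1 t s (x - y).
Proof.
move=> t0 s0.
have pki : leb.-integrable setT (EFin \o (fun z => pk s (z - y))).
  have := integrable_reflect y (integrable_pk s0).
  by apply: eq_integrable => // z _ /=; rewrite -pkNr opprB.
have mpk : measurable_fun setT (fun z : R => pk s (z - y)) by exact: integrable_EFin_measurable pki.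
transitivity (\int[leb]_z \int[leb]_(k in `[0, +oo[)
  (pi^-1 * (wexp 1 t 0 k * cos (k * (x - z))) * pk s (z - y))).
  apply: eq_Rintegral => z _; rewrite RintegralZr//; last first.
    by apply: integrableZl_EFin => //; exact: integrable_wexp_cos.
  by rewrite RintegralZl//; exact: integrable_wexp_cos.
have fi : (leb \x leb)%E.-integrable (setT `*` `[0, +oo[) (EFin \o (fun p =>
   (pi^-1 * (wexp 1 t 0 p.2 * cos (p.2 * (x - p.1))) * pk s (p.1 - y)))).
  apply: (@integrable_prod_dom R _ _ _ _ leb leb _ _
    (fun z k => (pi^-1 * (wexp 1 t 0 k * cos (k * (x - z))) * pk s (z - y)))
    (fun z => pk s (z - y)) (fun k => pi^-1 * (wexp_bound 1 t 0 * expR (- k)))) => //.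
  - by rewrite /wexp /pk; meas.
  - by do 2 apply: integrableZl_EFin => //; exact: integrable_expRN.
  - move=> z k _ /=; rewrite in_itv/= andbT => k0.
    rewrite normrM mulrC (ger0_norm (pk_ge0 _ (ltW s0))) ler_wpM2l ?pk_ge0 ?(ltW s0)//.
    rewrite normrM ger0_norm ?invr_ge0 ?pi_ge0// ler_wpM2l ?invr_ge0 ?pi_ge0//.
    by apply: norm_wexp_le => //; rewrite ?oppr0//; exact: norm_cos_le1.
rewrite (Rintegral_swap _ _ fi)//.
transitivity (\int[leb]_(k in `[0, +oo[) (pi^-1 * (wexp 1 t s k * cos (k * (x - y))))).
  apply: eq_Rintegral => k; rewrite inE/= in_itv/= andbT => k0.
  transitivity (\int[leb]_z (pi^-1 * wexp 1 t 0 k * (cos (k * (x - z)) * pk s (z - y)))).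
    by apply: eq_Rintegral => z _; ring.
  have ci : leb.-integrable setT (EFin \o (fun v => pk s v * cos (k * v))).
    apply: integrable_mul_le1 => //; [exact: integrable_pk|meas|by move=> ? _; exact: norm_cos_le1].
  have si : leb.-integrable setT (EFin \o (fun v => pk s v * sin (k * v))).
    apply: integrable_mul_le1 => //; [exact: integrable_pk|meas|by move=> ? _; exact: norm_sin_le1].
  rewrite RintegralZl//; last first.
    have := @integrable_mul_le1 R _ _ leb setT _ (fun z => cos (k * (x - z))) measurableT pki.
    rewrite (_ : (fun x => _ * _) = (fun z => cos (k * (x - z)) * pk s (z - y))); last first.
      by apply/funext => z; rewrite mulrC.
    by apply; [meas|move=> ? _; exact: norm_cos_le1].
  have -> : \int[leb]_z (cos (k * (x - z)) * pk s (z - y)) = expR (- (s * k)) * cos (k * (x - y)).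
    transitivity (\int[leb]_v (cos (k * (x - (y - v))) * pk s v)).
      rewrite -[RHS](@Rintegral_reflect R _ y); last by rewrite /pk; meas.
      by apply: eq_Rintegral => z _; rewrite subKr -pkNr opprB.
    transitivity (\int[leb]_v (cos (k * (x - y)) * (pk s v * cos (k * v)) -
       sin (k * (x - y)) * (pk s v * sin (k * v)))).
      apply: eq_Rintegral => v _.
      have -> : k * (x - (y - v)) = k * (x - y) + k * v by ring.
      by rewrite cosD; ring.
    rewrite RintegralB//; [|exact: integrableZl_EFin..].
    rewrite !RintegralZl// fourier_pk// Rintegral_odd//; first ring.
    by move=> v; rewrite pkNr !mulrN sinN mulrN.
  have -> : wexp 1 t s k = wexp 1 t 0 k * expR (- (s * k)).
    by rewrite /wexp -mulrA -expRD; congr (_ * expR _); ring.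
  ring.
by rewrite RintegralZl//; exact: integrable_wexp_cos.
Qed.

End fourier_poisson.

(** * The kernel of the Stokes semigroup *)

Section nonlocal.
Context {R : realType}.
Notation leb := (@lebesgue_measure R).
Implicit Types (t s x k r a b : R) (n : nat).

Lemma CcosN n t s x : Ccos n t s (- x) = Ccos n t s x.
Proof. by congr (_ * _); apply: eq_Rintegral => k _; rewrite mulrN cosN. Qed.

Lemma CsinN n t s x : 0 < t -> Csin n t s (- x) = - Csin n t s x.
Proof.
move=> t0; rewrite /Csin -mulrN; congr (_ * _).
rewrite -RintegralN//; last exact: integrable_wexp_sin.
by apply: eq_Rintegral => k _; rewrite mulrN sinN mulrN.
Qed.

(* [Mcos] and [Msin] below represent the derivatives of the double integral in
   the Stokes kernel; [Jint] is its part in [w2]. *)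
Definition Jint t k a b : R :=
  \int[leb]_(w in `[0, a]) (expR (- (k * (a - w))) * gauss t (w + b)).

Lemma integrable_segment (f : R -> R) (a b : R) : continuous f ->
  leb.-integrable `[a, b] (EFin \o f).
Proof.
move=> cf; apply: continuous_compact_integrable; first exact: segment_compact.
exact: continuous_subspaceT.
Qed.

Lemma is_derive_Rintegral_ub (f : R -> R) a : 0 < a -> continuous f ->
  is_derive a 1 (fun a => \int[leb]_(w in `[0, a]) f w) (f a).
Proof.
move=> a0 cf.
(* The segment is prolonged to a + 1 so that a is an interior point. *)
have := @continuous_FTC1_closed R f 0 a (a + 1).
rewrite ltrDl ltr01 => /(_ isT (integrable_segment 0 (a + 1) cf) a0 (cf a)) [df fE].
by apply: DeriveDef; [exact: df|rewrite -derive1E].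
Qed.

Lemma Jint_ge0 t k a b : 0 <= Jint t k a b.
Proof. by apply: Rintegral_ge0 => w _; rewrite mulr_ge0 ?expR_ge0 ?gauss_ge0. Qed.

Lemma continuous_Jint_integrand t k a b : 0 < t ->
  continuous (fun w => expR (- (k * (a - w))) * gauss t (w + b)).
Proof. by move=> t0; rewrite /gauss; cont. Qed.

Lemma Jint_le t k a b : 0 < t -> 0 <= k -> 0 <= a -> 0 <= b ->
  Jint t k a b <= a * (gauss_bound t * expR (- b)).
Proof.
move=> t0 k0 a0 b0.
have -> : a * (gauss_bound t * expR (- b)) = \int[leb]_(w in `[0, a]) (gauss_bound t * expR (- b)).
  rewrite Rintegral_cst//= lebesgue_measure_itv/= lte_fin mulrC; congr (_ * _).
  by move: (a0); rewrite le_eqVlt => /predU1P[<-|a1]; [rewrite ltxx|rewrite a1 /= subr0].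
apply: le_Rintegral => //.
- by apply: integrable_segment; exact: continuous_Jint_integrand.
- by apply: integrable_segment => x; exact: cst_continuous.
- move=> w; rewrite /= in_itv/= => /andP[w0 wa].
  apply: (@le_trans _ _ (gauss t (w + b))).
    by rewrite ler_piMl ?gauss_ge0// -expR0 ler_expR oppr_le0 mulr_ge0// subr_ge0.
  apply: (le_trans (gauss_exp_le t0 _)).
  rewrite ler_wpM2l ?gauss_bound_ge0// ler_expR lerN2 ger0_norm ?addr_ge0//.
  by rewrite lerDr.
Qed.

(** Once exp(- k a) is factored out, a remains in the upper limit only. The first term of the
    derivative is the boundary term. *)
Lemma is_derive_Jint t k a b : 0 < t -> 0 < a ->
  is_derive a 1 (fun a => Jint t k a b) (gauss t (a + b) - k * Jint t k a b).
Proof.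
move=> t0 a0.
pose f w := expR (k * w) * gauss t (w + b).
have cf : continuous f by rewrite /f /gauss; cont.
have JE x : Jint t k x b = expR (- (k * x)) * \int[leb]_(w in `[0, x]) f w.
  rewrite -RintegralZl//; last exact: integrable_segment.
  apply: eq_Rintegral => w _; rewrite /f mulrA -expRD; congr (expR _ * _); ring.
have e : is_derive a 1 (fun x => expR (- (k * x))) (- k * expR (- (k * a))).
  by deriv; ring.
rewrite (_ : (fun _ => _) = fun x => expR (- (k * x)) * \int[leb]_(w in `[0, x]) f w); last first.
  by apply/funext => x; rewrite JE.
apply: is_derive1_eq (is_derive1M e (is_derive_Rintegral_ub a0 cf)) _.
have fa : expR (- (k * a)) * f a = gauss t (a + b).
  by rewrite /f mulrA -expRD addNr expR0 mul1r.
by rewrite fa JE; ring.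
Qed.

Lemma measurable_Jint t a d (T : measurableType d) (f g : T -> R) :
  measurable_fun setT f -> measurable_fun setT g ->
  measurable_fun setT (fun p => Jint t (f p) a (g p)).
Proof.
move=> mf mg.
have mJ : measurable_fun setT (fun p : plane R => Jint t p.1 a p.2).
  apply: (@measurable_Rintegral_param R _ _ (plane R) _ leb `[0, a]
    (fun p w => expR (- (p.1 * (a - w))) * gauss t (w + p.2))) => //.
  by rewrite /gauss; meas.
exact: (measurableT_comp mJ (measurable_fun_pair mf mg)).
Qed.

Definition Mcos n t x a b : R :=
  2 * pi^-1 * \int[leb]_(k in `[0, +oo[) (wexp n t 0 k * cos (k * x) * Jint t k a b).
Definition Msin n t x a b : R :=
  2 * pi^-1 * \int[leb]_(k in `[0, +oo[) (wexp n t 0 k * sin (k * x) * Jint t k a b).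

Definition Mbound n t b : R := wexp_bound n t 0 * (gauss_bound t * expR (- b)).

Lemma Mbound_ge0 n t b : 0 < t -> 0 <= Mbound n t b.
Proof.
move=> t0; apply: mulr_ge0; first exact: expR_ge0.
by apply: mulr_ge0; [exact: gauss_bound_ge0|exact: expR_ge0].
Qed.

Lemma norm_M_integrand n t k a b c : 0 < t -> 0 <= k -> 0 <= a -> 0 <= b -> `|c| <= 1 ->
  `|wexp n t 0 k * c * Jint t k a b| <= a * Mbound n t b * expR (- k).
Proof.
move=> t0 k0 a0 b0 c1; rewrite normrM (ger0_norm (Jint_ge0 _ _ _ _)).
have -> : a * Mbound n t b * expR (- k) =
    (wexp_bound n t 0 * expR (- k)) * (a * (gauss_bound t * expR (- b))).
  by rewrite /Mbound; ring.
by apply: ler_pM; rewrite ?Jint_ge0 ?Jint_le// norm_wexp_le// oppr0.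
Qed.

Lemma integrable_M n t a b (c : R -> R) : 0 < t -> 0 <= a -> 0 <= b ->
  measurable_fun setT c -> (forall k, `|c k| <= 1) ->
  leb.-integrable `[0, +oo[ (EFin \o (fun k => wexp n t 0 k * c k * Jint t k a b)).
Proof.
move=> t0 a0 b0 mc c1.
apply: (@le_integrable_EFin R _ _ leb _ _ (fun k => a * Mbound n t b * expR (- k))) => //.
- apply: measurable_funTS; apply: measurable_funM; last exact: measurable_Jint.
  by apply: measurable_funM => //; rewrite /wexp; meas.
- by apply: integrableZl_EFin => //; exact: integrable_expRN.
- by move=> k /=; rewrite in_itv/= andbT => k0; exact: norm_M_integrand.
Qed.

Let pi2_ge0 : 0 <= 2 * (@pi R)^-1.
Proof. by rewrite mulr_ge0// invr_ge0 pi_ge0. Qed.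

Let Rintegral_expRN : \int[leb]_(k in `[0, +oo[) expR (- k) = 1 :> R.
Proof.
have -> : \int[leb]_(k in `[0, +oo[) expR (- k) = 0 - (- expR (- 0)) :> R.
  apply: (Rintegral_FTC2y (F := fun k => - expR (- k))).
  - by cont.
  - by move=> k; deriv; ring.
  - exact: integrable_expRN.
  - by rewrite -oppr0; apply: cvgN; exact: cvgr_expR.
by rewrite oppr0 expR0; ring.
Qed.

Let norm_M n t a b (c : R -> R) : 0 < t -> 0 <= a -> 0 <= b ->
  measurable_fun setT c -> (forall k, `|c k| <= 1) ->
  `|2 * pi^-1 * \int[leb]_(k in `[0, +oo[) (wexp n t 0 k * c k * Jint t k a b)| <=
    2 * pi^-1 * (a * Mbound n t b).
Proof.
move=> t0 a0 b0 mc c1; rewrite normrM (ger0_norm pi2_ge0) ler_wpM2l//.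
apply: (@le_trans _ _ (\int[leb]_(k in `[0, +oo[) (a * Mbound n t b * expR (- k)))).
  apply: le_normr_Rintegral_dom => //.
  - apply: measurable_funTS; apply: measurable_funM; last exact: measurable_Jint.
    by apply: measurable_funM => //; rewrite /wexp; meas.
  - by apply: integrableZl_EFin => //; exact: integrable_expRN.
  - by move=> k /=; rewrite in_itv/= andbT => k0; exact: norm_M_integrand.
by rewrite RintegralZl ?Rintegral_expRN ?mulr1//; exact: integrable_expRN.
Qed.

Lemma norm_Mcos n t x a b : 0 < t -> 0 <= a -> 0 <= b ->
  `|Mcos n t x a b| <= 2 * pi^-1 * (a * Mbound n t b).
Proof.
by move=> t0 a0 b0; apply: norm_M => //; [meas|move=> k; exact: norm_cos_le1].
Qed.

Lemma norm_Msin n t x a b : 0 < t -> 0 <= a -> 0 <= b ->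
  `|Msin n t x a b| <= 2 * pi^-1 * (a * Mbound n t b).
Proof.
by move=> t0 a0 b0; apply: norm_M => //; [meas|move=> k; exact: norm_sin_le1].
Qed.

Lemma measurable_Mcos n t a d (T : measurableType d) (f g : T -> R) :
  measurable_fun setT f -> measurable_fun setT g ->
  measurable_fun setT (fun p => Mcos n t (f p) a (g p)).
Proof.
move=> mf mg.
have mM : measurable_fun setT (fun p : plane R => Mcos n t p.1 a p.2).
  rewrite /Mcos; apply: measurable_funM => //.
  apply: (@measurable_Rintegral_param R _ _ (plane R) _ leb `[0, +oo[
    (fun p k => wexp n t 0 k * cos (k * p.1) * Jint t k a p.2)) => //.
  apply: measurable_funM; first by rewrite /wexp; meas.
  by apply: measurable_Jint; meas.
exact: (measurableT_comp mM (measurable_fun_pair mf mg)).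
Qed.

Lemma measurable_Msin n t a d (T : measurableType d) (f g : T -> R) :
  measurable_fun setT f -> measurable_fun setT g ->
  measurable_fun setT (fun p => Msin n t (f p) a (g p)).
Proof.
move=> mf mg.
have mM : measurable_fun setT (fun p : plane R => Msin n t p.1 a p.2).
  rewrite /Msin; apply: measurable_funM => //.
  apply: (@measurable_Rintegral_param R _ _ (plane R) _ leb `[0, +oo[
    (fun p k => wexp n t 0 k * sin (k * p.1) * Jint t k a p.2)) => //.
  apply: measurable_funM; first by rewrite /wexp; meas.
  by apply: measurable_Jint; meas.
exact: (measurableT_comp mM (measurable_fun_pair mf mg)).
Qed.

(** Treats both trigonometric functions at once: (c, dc) is (cos, - sin) or (sin, cos). *)
Let is_derive_M_x n t x a b (c dc : R -> R) : 0 < t -> 0 <= a -> 0 <= b ->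
  measurable_fun setT c -> measurable_fun setT dc ->
  (forall y, `|c y| <= 1) -> (forall y, `|dc y| <= 1) ->
  (forall y : R, is_derive y 1 c (dc y)) ->
  is_derive x 1 (fun x => 2 * pi^-1 * \int[leb]_(k in `[0, +oo[) (wexp n t 0 k * c (k * x) * Jint t k a b))
    (2 * pi^-1 * \int[leb]_(k in `[0, +oo[) (wexp n.+1 t 0 k * dc (k * x) * Jint t k a b)).
Proof.
move=> t0 a0 b0 mc mdc c1 dc1 cd; apply: is_derive1_cst_mul.
apply: (@is_derive_Rintegral R _ _ leb (fun x k => wexp n t 0 k * c (k * x) * Jint t k a b)
  (fun x k => wexp n.+1 t 0 k * dc (k * x) * Jint t k a b)
  (fun k => a * Mbound n.+1 t b * expR (- k)) _ x (x - 1) (x + 1)) => //.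
- by rewrite ltrBlDr ltrDl.
- by rewrite ltrDl.
- move=> y _ _; apply: integrable_M => //; apply: (measurableT_comp mc).
  by apply: measurable_funM.
- move=> y k _ _ _.
  have e : is_derive y 1 (fun y => c (k * y)) (dc (k * y) * k).
    notypeclasses refine (is_derive1_chain (f := c) (g := fun y => k * y) (cd _) _).
    by deriv; ring.
  have e' := is_derive1_cst_mul (Jint t k a b * wexp n t 0 k) e.
  rewrite (_ : (fun x0 => _) = fun y => Jint t k a b * wexp n t 0 k * c (k * y)); last first.
    by apply/funext => y'; ring.
  by apply: is_derive1_eq e' _; rewrite /wexp (exprS k n); ring.
- by apply: integrableZl_EFin => //; exact: integrable_expRN.
- by move=> y k _ _ /=; rewrite in_itv/= andbT => k0; exact: norm_M_integrand.
Qed.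

Lemma is_derive_Mcos_x n t x a b : 0 < t -> 0 <= a -> 0 <= b ->
  is_derive x 1 (fun x => Mcos n t x a b) (- Msin n.+1 t x a b).
Proof.
move=> t0 a0 b0; rewrite /Mcos.
have : measurable_fun setT (fun x : R => - sin x) by meas.
have mcos : measurable_fun setT (@cos R) by exact: continuous_measurable_fun (@continuous_cos _).
move=> msin.
have Nsin1 (y : R) : `|- sin y| <= 1 by rewrite normrN norm_sin_le1.
have := is_derive_M_x n x t0 a0 b0 mcos msin (@norm_cos_le1 _) Nsin1 (@is_derive_cos R).
move=> h; apply: is_derive1_eq h _.
rewrite /Msin -mulrN; congr (_ * _); rewrite -RintegralN//.
  by apply: eq_Rintegral => k _; ring.
apply: integrable_M => //; [meas|move=> k; exact: norm_sin_le1].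
Qed.

Lemma is_derive_Msin_x n t x a b : 0 < t -> 0 <= a -> 0 <= b ->
  is_derive x 1 (fun x => Msin n t x a b) (Mcos n.+1 t x a b).
Proof.
move=> t0 a0 b0; rewrite /Mcos /Msin.
have mcos : measurable_fun setT (@cos R) by exact: continuous_measurable_fun (@continuous_cos _).
have msin : measurable_fun setT (@sin R) by exact: continuous_measurable_fun (@continuous_sin _).
exact: (is_derive_M_x n x t0 a0 b0 msin mcos (@norm_sin_le1 _) (@norm_cos_le1 _) (@is_derive_sin R)).
Qed.

(** The first term is the boundary term of [is_derive_Jint], freed from the frequency integral; for
    n = 1 it becomes the nonlocal part of [V0]. *)
Lemma is_derive_Mcos_a n t x a b : 0 < t -> 0 < a -> 0 <= b ->
  is_derive a 1 (fun a => Mcos n t x a b)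
    (2 * gauss t (a + b) * Ccos n t 0 x - Mcos n.+1 t x a b).
Proof.
move=> t0 a0 b0.
have e : is_derive a 1 (fun a => Mcos n t x a b) (2 * pi^-1 * \int[leb]_(k in `[0, +oo[)
    (wexp n t 0 k * cos (k * x) * (gauss t (a + b) - k * Jint t k a b))).
  apply: is_derive1_cst_mul.
  apply: (@is_derive_Rintegral R _ _ leb (fun a k => wexp n t 0 k * cos (k * x) * Jint t k a b)
    (fun a k => wexp n t 0 k * cos (k * x) * (gauss t (a + b) - k * Jint t k a b))
    (fun k => gauss t 0 * (wexp_bound n t 0 * expR (- k)) + (a + 1) * Mbound n.+1 t b * expR (- k)) _ a 0 (a + 1)).
  - by [].
  - exact: a0.
  - by rewrite ltrDl.
  - move=> a' a'0 _; apply: integrable_M => //; [exact: ltW|meas|move=> k; exact: norm_cos_le1].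
  - move=> a' k a'0 _ _; apply: is_derive1_cst_mul; exact: is_derive_Jint.
  - apply: integrableD_EFin => //; do ?apply: integrableZl_EFin => //; exact: integrable_expRN.
  - move=> a' k a'0 a'a /=; rewrite in_itv/= andbT => k0.
    have -> : wexp n t 0 k * cos (k * x) * (gauss t (a' + b) - k * Jint t k a' b) =
       gauss t (a' + b) * (wexp n t 0 k * cos (k * x)) - wexp n.+1 t 0 k * cos (k * x) * Jint t k a' b.
      by rewrite /wexp (exprS k n); ring.
    apply: (le_trans (ler_normB _ _)); apply: lerD.
      rewrite normrM (ger0_norm (gauss_ge0 _ _)); apply: ler_pM; rewrite ?gauss_ge0 ?gauss_le//.
      by apply: norm_wexp_le => //; rewrite ?oppr0//; exact: norm_cos_le1.
    apply: (le_trans (norm_M_integrand _ t0 k0 (ltW a'0) b0 (norm_cos_le1 _))).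
    by rewrite ler_wpM2r ?expR_ge0// ler_wpM2r ?Mbound_ge0// ltW.
apply: is_derive1_eq e _.
rewrite (_ : \int[leb]_(k in _) _ = \int[leb]_(k in `[0, +oo[)
    (gauss t (a + b) * (wexp n t 0 k * cos (k * x)) - wexp n.+1 t 0 k * cos (k * x) * Jint t k a b)); last first.
  by apply: eq_Rintegral => k _; rewrite /wexp (exprS k n); ring.
rewrite RintegralB//; last 2 first.
- by apply: integrableZl_EFin => //; exact: integrable_wexp_cos.
- by apply: integrable_M => //; [exact: ltW|meas|move=> k; exact: norm_cos_le1].
rewrite RintegralZl//; last exact: integrable_wexp_cos.
rewrite /Mcos /Ccos; ring.
Qed.

Lemma Rintegral_itv_oo_cc (f : R -> R) a b : continuous f ->
  \int[leb]_(w in `]a, b[) f w = \int[leb]_(w in `[a, b]) f w.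
Proof.
move=> cf; rewrite -Rintegral_itv_obnd_cbnd; last first.
  by apply: integrableS (integrable_segment a b cf) => //; apply: subset_itvr => //; rewrite bnd_simp.
rewrite -Rintegral_itv_bndo_bndc//.
apply: integrableS (integrable_segment a b cf) => //.
exact: subset_itv_oo_cc.
Qed.

(** Fubini in w and the frequency: the damping exp(- k (a - w)) contained in [Ccos] at height a - w
    is the exponential inside [Jint]. *)
Lemma Mcos_double n t x a b : 0 < t -> 0 < a -> 0 <= b ->
  \int[leb]_(w in `]0, a[) (gauss t (w + b) * Ccos n t (a - w) x) = 2^-1 * Mcos n t x a b.
Proof.
move=> t0 a0 b0.
transitivity (\int[leb]_(w in `]0, a[) \int[leb]_(k in `[0, +oo[)
    (pi^-1 * (wexp n t 0 k * cos (k * x) * (expR (- (k * (a - w))) * gauss t (w + b))))).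
  apply: eq_Rintegral => w _; rewrite /Ccos mulrCA RintegralZl//; last first.
    have : leb.-integrable `[0, +oo[ (EFin \o (fun k => gauss t (w + b) * (wexp n t (a - w) k * cos (k * x)))).
      by apply: integrableZl_EFin => //; exact: integrable_wexp_cos.
    apply: eq_integrable => // k _ /=; rewrite /wexp mulr0 oppr0 sub0r expRD; congr EFin; ring.
  congr (_ * _); rewrite -RintegralZl//; last exact: integrable_wexp_cos.
  by apply: eq_Rintegral => k _; rewrite /wexp mulr0 oppr0 sub0r expRD; ring.
have fi : (leb \x leb)%E.-integrable (`]0, a[ `*` `[0, +oo[) (EFin \o (fun p =>
   pi^-1 * (wexp n t 0 p.2 * cos (p.2 * x) * (expR (- (p.2 * (a - p.1))) * gauss t (p.1 + b))))).
  apply: (@integrable_prod_dom R _ _ _ _ leb leb _ _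
    (fun w k => pi^-1 * (wexp n t 0 k * cos (k * x) * (expR (- (k * (a - w))) * gauss t (w + b))))
    (fun w => gauss t 0) (fun k => pi^-1 * (wexp_bound n t 0 * expR (- k)))) => //.
  - by rewrite /wexp /gauss; meas.
  - apply: integrableS (integrable_segment 0 a (@cst_continuous _ _ (gauss t 0))) => //.
    exact: subset_itv_oo_cc.
  - by do 2 apply: integrableZl_EFin => //; exact: integrable_expRN.
  - move=> w k /=; rewrite !in_itv/= andbT => /andP[w0 wa] k0.
    rewrite normrM (ger0_norm (x := pi^-1)) ?invr_ge0 ?pi_ge0// [leRHS]mulrCA ler_wpM2l ?invr_ge0 ?pi_ge0//.
    rewrite normrM mulrC; apply: ler_pM => //.
      rewrite ger0_norm ?mulr_ge0 ?expR_ge0 ?gauss_ge0//.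
      apply: le_trans (gauss_le t0 (w + b)).
      by rewrite ler_piMl ?gauss_ge0// -expR0 ler_expR oppr_le0 mulr_ge0// subr_ge0 ltW.
    by apply: norm_wexp_le => //; rewrite ?oppr0//; exact: norm_cos_le1.
rewrite (Rintegral_swap _ _ fi)//.
transitivity (\int[leb]_(k in `[0, +oo[) (pi^-1 * (wexp n t 0 k * cos (k * x) * Jint t k a b))).
  apply: eq_Rintegral => k _.
  have cJ := @continuous_Jint_integrand t k a b t0.
  have iJ : leb.-integrable `]0, a[ (EFin \o (fun w => expR (- (k * (a - w))) * gauss t (w + b))).
    apply: integrableS (integrable_segment 0 a cJ) => //; exact: subset_itv_oo_cc.
  rewrite RintegralZl//; last exact: integrableZl_EFin.
  by rewrite RintegralZl// Rintegral_itv_oo_cc.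
rewrite RintegralZl//; last first.
  by apply: integrable_M => //; [exact: ltW|meas|move=> k; exact: norm_cos_le1].
by rewrite /Mcos; move: (lt0r_neq0 (pi_gt0 R)); move: (@pi R) => p pn; field.
Qed.

Lemma Msin_double n t x a b : 0 < t -> 0 < a -> 0 <= b ->
  \int[leb]_(w in `]0, a[) (gauss t (w + b) * Csin n t (a - w) x) = 2^-1 * Msin n t x a b.
Proof.
move=> t0 a0 b0.
transitivity (\int[leb]_(w in `]0, a[) \int[leb]_(k in `[0, +oo[)
    (pi^-1 * (wexp n t 0 k * sin (k * x) * (expR (- (k * (a - w))) * gauss t (w + b))))).
  apply: eq_Rintegral => w _; rewrite /Csin mulrCA RintegralZl//; last first.
    have : leb.-integrable `[0, +oo[ (EFin \o (fun k => gauss t (w + b) * (wexp n t (a - w) k * sin (k * x)))).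
      by apply: integrableZl_EFin => //; exact: integrable_wexp_sin.
    apply: eq_integrable => // k _ /=; rewrite /wexp mulr0 oppr0 sub0r expRD; congr EFin; ring.
  congr (_ * _); rewrite -RintegralZl//; last exact: integrable_wexp_sin.
  by apply: eq_Rintegral => k _; rewrite /wexp mulr0 oppr0 sub0r expRD; ring.
have fi : (leb \x leb)%E.-integrable (`]0, a[ `*` `[0, +oo[) (EFin \o (fun p =>
   pi^-1 * (wexp n t 0 p.2 * sin (p.2 * x) * (expR (- (p.2 * (a - p.1))) * gauss t (p.1 + b))))).
  apply: (@integrable_prod_dom R _ _ _ _ leb leb _ _
    (fun w k => pi^-1 * (wexp n t 0 k * sin (k * x) * (expR (- (k * (a - w))) * gauss t (w + b))))
    (fun w => gauss t 0) (fun k => pi^-1 * (wexp_bound n t 0 * expR (- k)))) => //.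
  - by rewrite /wexp /gauss; meas.
  - apply: integrableS (integrable_segment 0 a (@cst_continuous _ _ (gauss t 0))) => //.
    exact: subset_itv_oo_cc.
  - by do 2 apply: integrableZl_EFin => //; exact: integrable_expRN.
  - move=> w k /=; rewrite !in_itv/= andbT => /andP[w0 wa] k0.
    rewrite normrM (ger0_norm (x := pi^-1)) ?invr_ge0 ?pi_ge0// [leRHS]mulrCA ler_wpM2l ?invr_ge0 ?pi_ge0//.
    rewrite normrM mulrC; apply: ler_pM => //.
      rewrite ger0_norm ?mulr_ge0 ?expR_ge0 ?gauss_ge0//.
      apply: le_trans (gauss_le t0 (w + b)).
      by rewrite ler_piMl ?gauss_ge0// -expR0 ler_expR oppr_le0 mulr_ge0// subr_ge0 ltW.
    by apply: norm_wexp_le => //; rewrite ?oppr0//; exact: norm_sin_le1.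
rewrite (Rintegral_swap _ _ fi)//.
transitivity (\int[leb]_(k in `[0, +oo[) (pi^-1 * (wexp n t 0 k * sin (k * x) * Jint t k a b))).
  apply: eq_Rintegral => k _.
  have cJ := @continuous_Jint_integrand t k a b t0.
  have iJ : leb.-integrable `]0, a[ (EFin \o (fun w => expR (- (k * (a - w))) * gauss t (w + b))).
    apply: integrableS (integrable_segment 0 a cJ) => //; exact: subset_itv_oo_cc.
  rewrite RintegralZl//; last exact: integrableZl_EFin.
  by rewrite RintegralZl// Rintegral_itv_oo_cc.
rewrite RintegralZl//; last first.
  by apply: integrable_M => //; [exact: ltW|meas|move=> k; exact: norm_sin_le1].
by rewrite /Msin; move: (lt0r_neq0 (pi_gt0 R)); move: (@pi R) => p pn; field.
Qed.

End nonlocal.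

(** * Closed forms of the Biot-Savart kernel and of the Stokes kernel *)

Section kernels.
Context {R : realType}.
Notation leb := (@lebesgue_measure R).
Implicit Types (x y z : R * R) (t : R).

Lemma ord2P (i : 'I_2) : i = 0 \/ i = 1.
Proof.
by case: i => [[|[|//]] im]; [left|right]; exact: val_inj.
Qed.

(** The difference quotients coincide, so the equality also holds where no derivative exists;
    [grad_perp_green_diag] relies on this. *)
Lemma partial0_derive (f : R * R -> R) x :
  partial 0 f x = 'D_1 (fun a : R => f (a, x.2)) x.1.
Proof.
rewrite /partial /basis_vec /= /derive.
rewrite (_ : (fun h : R => h^-1 *: _) = fun h : R =>
   h^-1 *: (((fun a : R => f (a, x.2)) \o shift x.1) (h *: (1 : R)) - f (x.1, x.2)))//.
apply/funext => h; case: x => x1 x2 /=; congr (_ *: (f _ - _)).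
by apply: injective_projections => /=; rewrite ?scaler0 ?add0r.
Qed.

Lemma partial1_derive (f : R * R -> R) x :
  partial 1 f x = 'D_1 (fun a : R => f (x.1, a)) x.2.
Proof.
rewrite /partial /basis_vec /= /derive.
rewrite (_ : (fun h : R => h^-1 *: _) = fun h : R =>
   h^-1 *: (((fun a : R => f (x.1, a)) \o shift x.2) (h *: (1 : R)) - f (x.1, x.2)))//.
apply/funext => h; case: x => x1 x2 /=; congr (_ *: (f _ - _)).
by apply: injective_projections => /=; rewrite ?scaler0 ?add0r.
Qed.

Lemma partial0P (f : R * R -> R) x d :
  is_derive x.1 1 (fun a : R => f (a, x.2)) d -> partial 0 f x = d.
Proof. by rewrite partial0_derive => -[]. Qed.

Lemma partial1P (f : R * R -> R) x d :
  is_derive x.2 1 (fun a : R => f (x.1, a)) d -> partial 1 f x = d.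
Proof. by rewrite partial1_derive => -[]. Qed.

Let is_derive_ln_sqrt (a b c : R) : (a - b) ^+ 2 + c != 0 -> 0 <= c ->
  is_derive a 1 (fun a => - (2 * pi)^-1 * ln (Num.sqrt ((a - b) ^+ 2 + c)))
    (- 2^-1 * ((a - b) / (pi * ((a - b) ^+ 2 + c)))).
Proof.
move=> D0 c0; have Dp : 0 < (a - b) ^+ 2 + c by rewrite lt_neqAle eq_sym D0 addr_ge0 ?sqr_ge0.
have e : is_derive a 1 (fun a => (a - b) ^+ 2 + c) (2 * (a - b)).
  by deriv; rewrite expr1; ring.
have e1 : is_derive a 1 (fun a => Num.sqrt ((a - b) ^+ 2 + c)) ((2 * Num.sqrt ((a - b) ^+ 2 + c))^-1 * (2 * (a - b))).
  notypeclasses refine (is_derive1_chain (f := Num.sqrt) (g := fun a => (a - b) ^+ 2 + c) (is_derive1_sqrt Dp) e).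
have S0 : 0 < Num.sqrt ((a - b) ^+ 2 + c) by rewrite sqrtr_gt0.
have e2 := is_derive1_chain (f := @ln R) (g := fun a => Num.sqrt ((a - b) ^+ 2 + c)) (is_derive1_ln S0) e1.
apply: is_derive1_eq (is_derive1_cst_mul _ e2) _.
have SS := sqr_sqrtr (ltW Dp).
have := lt0r_neq0 S0; move: SS; set S := Num.sqrt _ => <- Sn.
by move: (lt0r_neq0 (pi_gt0 R)); clearbody S; move: (@pi R) => p pn; field; rewrite pn Sn.
Qed.

Let sum_sqr_neq0 (a b : R) : (a != 0) || (b != 0) -> a ^+ 2 + b ^+ 2 != 0.
Proof.
apply: contraTneq => /eqP; rewrite paddr_eq0 ?sqr_ge0// !sqrf_eq0 => /andP[/eqP-> /eqP->].
by rewrite eqxx.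
Qed.

Lemma sub_neq0 x y : x != y -> (x.1 - y.1 != 0) || (x.2 - y.2 != 0).
Proof.
case: x y => [x1 x2] [y1 y2] /=; rewrite !subr_eq0 -negb_and.
by apply: contra => /andP[/eqP-> /eqP->].
Qed.

Lemma is_derive_fund_sol0 x y : x != y ->
  is_derive x.1 1 (fun a => fund_sol ((a, x.2) - y)) (- 2^-1 * pk (x.1 - y.1) (x.2 - y.2)).
Proof.
move=> xy; rewrite /fund_sol /eucl_norm /pk /=.
apply: is_derive_ln_sqrt; last exact: sqr_ge0.
exact: sum_sqr_neq0 (sub_neq0 xy).
Qed.

Lemma is_derive_fund_sol1 x y : x != y ->
  is_derive x.2 1 (fun a => fund_sol ((x.1, a) - y)) (- 2^-1 * pk (x.2 - y.2) (x.1 - y.1)).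
Proof.
move=> xy; rewrite /fund_sol /eucl_norm /pk /=.
rewrite (_ : (fun _ => _) = fun a => - (2 * pi)^-1 *
   ln (Num.sqrt ((a - y.2) ^+ 2 + (x.1 - y.1) ^+ 2))); last first.
  by apply/funext => a; rewrite [X in Num.sqrt X]addrC.
apply: is_derive_ln_sqrt; last exact: sqr_ge0.
by apply: sum_sqr_neq0; rewrite orbC; exact: sub_neq0 xy.
Qed.

(* [nabla^perp D] in closed form. The value on the diagonal is the one that
   [partial] takes there, see [grad_perp_green_diag]. *)
Definition Kgreen (i : 'I_2) z y : R :=
  if z == y then 0 else
  if i == 0 then - 2^-1 * (pk (z.2 - y.2) (z.1 - y.1) - pk (z.2 + y.2) (z.1 - y.1))
  else 2^-1 * (pk (z.1 - y.1) (z.2 - y.2) - pk (z.1 - y.1) (z.2 + y.2)).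

(** A derivative would force continuity at b, but the logarithm is unbounded there while [ln 0] is
    0. The function s stands for the regular contribution of the reflected source. *)
Let ln_not_derivable (c b : R) (s : R -> R) : c != 0 -> {for b, continuous s} ->
  ~ derivable (fun a => c * ln (Num.sqrt ((a - b) ^+ 2)) + s a) b 1.
Proof.
move=> c0 cs dv.
have cf : {for b, continuous (fun a => c * ln (Num.sqrt ((a - b) ^+ 2)) + s a)}.
  by apply: differentiable_continuous; exact/derivable1_diffP.
have {}cf : ln (Num.sqrt ((a - b) ^+ 2)) @[a --> b] --> (0 : R).
  have h : (fun a => c^-1 * ((c * ln (Num.sqrt ((a - b) ^+ 2)) + s a) - s a)) x @[x --> b] -->
      c^-1 * ((c * ln (Num.sqrt ((b - b) ^+ 2)) + s b) - s b).
    by apply: cvgMr; exact: cvgB.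
  move: h; rewrite addrK mulKf// subrr expr0n /= sqrtr0 ln0//.
  apply: cvg_trans; apply: near_eq_cvg.
  by apply: nearW => a; rewrite addrK mulKf.
move: cf => /cvgrPdist_lt /(_ 1 ltr01) /nbhs_ballP[e /= e0 he].
(* At distance at most exp(- 1) from b the logarithm is at most - 1, against the bound 1 that
   continuity would impose. *)
pose h := Num.min (e / 2) (expR (-1)).
have h0 : 0 < h by rewrite lt_min expR_gt0 divr_gt0.
have := he (b + h); rewrite /ball/=.
have -> : b - (b + h) = - h by ring.
have -> : b + h - b = h by ring.
rewrite normrN (gtr0_norm h0).
have -> : h < e by rewrite gt_min ltr_pdivrMr// ltr_pMr// ltr1n.
move=> /(_ isT); rewrite sqrtr_sqr (gtr0_norm h0) sub0r normrN.
have : ln h <= -1.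
  by rewrite -[leRHS](expRK (-1)) ler_ln ?posrE ?expR_gt0// ge_min lexx orbT.
move=> lh; rewrite ler0_norm; lra.
Qed.

Lemma continuous_fund_sol_refl0 y : 0 < y.2 ->
  {for y.1, continuous (fun a : R => fund_sol ((a, y.2) - refl y))}.
Proof.
move=> y0; apply: differentiable_continuous; apply/derivable1_diffP.
have ny : y != refl y by apply/eqP => /(congr1 snd) /=; lra.
by have [] := is_derive_fund_sol0 ny.
Qed.

Lemma continuous_fund_sol_refl1 y : 0 < y.2 ->
  {for y.2, continuous (fun a : R => fund_sol ((y.1, a) - refl y))}.
Proof.
move=> y0; apply: differentiable_continuous; apply/derivable1_diffP.
have ny : y != refl y by apply/eqP => /(congr1 snd) /=; lra.
by have [] := is_derive_fund_sol1 ny.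
Qed.

(* On the diagonal the difference quotients diverge, and [lim] of a divergent
   filter is [point], which is 0 in a real field. *)
Let grad_perp_green_diag (i : 'I_2) y : 0 < y.2 ->
  grad_perp (fun x' => green_fun x' y) i y = 0.
Proof.
move=> y0; have c0 : - (2 * @pi R)^-1 != 0.
  by rewrite oppr_eq0 invr_eq0 mulf_neq0// lt0r_neq0// pi_gt0.
have dvg (f : R -> R) b : ~ derivable f b 1 -> 'D_1 f b = 0 by move=> /dvgP.
rewrite /grad_perp; case: ifPn => _.
  rewrite partial1_derive; apply: dvg.
  rewrite (_ : (fun a => _) = (fun a => - (2 * pi)^-1 * ln (Num.sqrt ((a - y.2) ^+ 2)) +
     (- fund_sol ((y.1, a) - refl y)))).
    apply: ln_not_derivable => //; apply: continuousN; exact: continuous_fund_sol_refl1.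
  by apply/funext => a; rewrite /green_fun {1}/fund_sol /eucl_norm /= subrr expr0n add0r.
rewrite /= partial0_derive dvg ?oppr0//.
rewrite (_ : (fun a => _) = (fun a => - (2 * pi)^-1 * ln (Num.sqrt ((a - y.1) ^+ 2)) +
   (- fund_sol ((a, y.2) - refl y)))).
  apply: ln_not_derivable => //; apply: continuousN; exact: continuous_fund_sol_refl0.
by apply/funext => a; rewrite /green_fun {1}/fund_sol /eucl_norm /= subrr expr0n addr0.
Qed.

Lemma grad_perp_green (i : 'I_2) z y : 0 < z.2 -> 0 < y.2 ->
  grad_perp (fun x' => green_fun x' y) i z = Kgreen i z y.
Proof.
move=> z0 y0; rewrite /Kgreen; case: ifPn => [/eqP->|zy].
  exact: grad_perp_green_diag.
have zr : z != refl y by apply/eqP => /(congr1 snd) /=; lra.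
rewrite /grad_perp; case: ifPn => _.
  apply: partial1P.
  apply: is_derive1_eq (is_derive1D (is_derive_fund_sol1 zy) (is_derive1N (is_derive_fund_sol1 zr))) _.
  by rewrite /refl /= opprK; ring.
have e : is_derive z.1 1 (fun a => green_fun (a, z.2) y) _ :=
  is_derive1D (is_derive_fund_sol0 zy) (is_derive1N (is_derive_fund_sol0 zr)).
by rewrite /= (partial0P e) /refl /= opprK; ring.
Qed.

Lemma measurable_Kgreen i :
  measurable_fun setT (fun p : plane R * plane R => Kgreen i p.1 p.2).
Proof.
rewrite /Kgreen; apply: measurable_fun_ifT => //.
  rewrite (_ : (fun p => _) = fun p : plane R * plane R => (p.1.1 == p.2.1) && (p.1.2 == p.2.2)).
    by apply: measurable_and; apply: measurable_fun_eqr; meas.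
  by apply/funext => -[[? ?] [? ?]].
by case: (i == 0); rewrite /pk; meas.
Qed.

Lemma heat_kernelE x t : 0 < t -> heat_kernel x t = gauss t x.1 * gauss t x.2.
Proof.
move=> t0; rewrite /heat_kernel /gauss /eucl_norm sqr_sqrtr ?addr_ge0 ?sqr_ge0//.
rewrite mulrACA -expRD -invfM -expr2 sqr_sqrtr ?mulr_ge0 ?pi_ge0 ?(ltW t0)//.
congr (_ * expR _); ring.
Qed.

(* Heat kernel of the half plane with Dirichlet boundary condition. *)
Definition hd t x z : R := gauss t (x.1 - z.1) * (gauss t (x.2 - z.2) - gauss t (x.2 + z.2)).

Lemma heat_kernel_hd x z t : 0 < t ->
  heat_kernel (x - z) t - heat_kernel (x - refl z) t = hd t x z.
Proof. by move=> t0; rewrite !heat_kernelE//= opprK /hd; ring. Qed.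

Lemma measurable_Ccos_comp n t d (T : measurableType d) (f g : T -> R) :
  measurable_fun setT f -> measurable_fun setT g ->
  measurable_fun setT (fun p => Ccos n t (f p) (g p)).
Proof.
by move=> mf mg; exact: (measurableT_comp (measurable_Ccos n t) (measurable_fun_pair mf mg)).
Qed.

Lemma measurable_Csin_comp n t d (T : measurableType d) (f g : T -> R) :
  measurable_fun setT f -> measurable_fun setT g ->
  measurable_fun setT (fun p => Csin n t (f p) (g p)).
Proof.
have mS : measurable_fun setT (fun p : plane R => Csin n t p.1 p.2).
  rewrite /Csin; apply: measurable_funM => //.
  apply: (@measurable_Rintegral_param R _ _ (plane R) _ leb `[0, +oo[
    (fun p k => wexp n t p.1 k * sin (k * p.2))) => //.
  by rewrite /wexp; meas.
by move=> mf mg; exact: (measurableT_comp mS (measurable_fun_pair mf mg)).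
Qed.

Let integrable_itvoo_bounded (f : R -> R) (a b c : R) : measurable_fun setT f ->
  (forall w, a < w -> w < b -> `|f w| <= c) -> leb.-integrable `]a, b[ (EFin \o f).
Proof.
move=> mf fc; apply: (@le_integrable_EFin R _ _ leb _ _ (fun=> c)) => //.
- exact: measurable_funTS.
- apply: integrableS (integrable_segment a b (@cst_continuous _ _ c)) => //.
  exact: subset_itv_oo_cc.
- by move=> w /=; rewrite in_itv/= => /andP[]; exact: fc.
Qed.

(** Since w2 < x.2, the singularity of [fund_sol] is avoided and its partial derivative is, up to
    the factor 1 / 2 and signs, a Poisson kernel in w1 of height x.2 - w2 for i = 1 and the
    conjugate kernel for i = 0. The integral in w1 is thus a Gaussian convolution, and the one in w2
    is [Mcos_double] or [Msin_double]. *)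
Let inner_integral (i : 'I_2) x z t : 0 < t -> 0 < x.2 -> 0 <= z.2 ->
  \int[leb]_(w2 in `]0, x.2[) \int[leb]_w1
     (partial i (fun x'' => fund_sol (x'' - (w1, w2))) x
       * heat_kernel ((w1, w2) - refl z) t) =
  - 4^-1 * (if i == 0 then Msin 0 t (x.1 - z.1) x.2 z.2 else Mcos 0 t (x.1 - z.1) x.2 z.2).
Proof.
move=> t0 x0 z0.
have neq w1 w2 : w2 \in `]0, x.2[ -> x != (w1, w2).
  by rewrite in_itv/= => /andP[_ h]; apply/eqP => /(congr1 snd) /= e; move: h; rewrite e ltxx.
have gi s c (p : R -> R) : 0 < s -> measurable_fun setT p -> (forall w, `|p w| <= s^-1) ->
  leb.-integrable setT (EFin \o (fun w1 => gauss t (c - w1) * p w1)).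
  move=> s0 mp ps.
  apply: (@le_integrable_EFin R _ _ leb _ _ (fun w1 => s^-1 * gauss t (c - w1))) => //.
  + by apply: measurable_funM => //; rewrite /gauss; meas.
  + by apply: integrableZl_EFin => //; exact: integrable_reflect (integrable_gauss t0).
  + by move=> w _; rewrite normrM mulrC (ger0_norm (gauss_ge0 _ _)) ler_wpM2r ?gauss_ge0.
case: ifPn => [/eqP->|i0].
- transitivity (\int[leb]_(w2 in `]0, x.2[) (- 2^-1 * (gauss t (w2 + z.2) * Csin 0 t (x.2 - w2) (x.1 - z.1)))).
    apply: eq_Rintegral => w2 w2I; have {}w2I : w2 \in `]0, x.2[ by move: w2I; rewrite inE.
    have s0 : 0 < x.2 - w2 by move: w2I; rewrite in_itv/= subr_gt0 => /andP[].
    transitivity (\int[leb]_w1 (2^-1 * gauss t (w2 + z.2) * (gauss t (z.1 - w1) * pk (w1 - x.1) (x.2 - w2)))).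
      apply: eq_Rintegral => w1 _; rewrite (partial0P (is_derive_fund_sol0 (neq w1 _ w2I)))/=.
      rewrite heat_kernelE//= opprK -(gaussN _ (w1 - _)) opprB -[x.1 - w1]opprB pkN; ring.
    rewrite RintegralZl//; last first.
      by apply: (gi (x.2 - w2)) => //; [rewrite /pk; meas|move=> w; exact: norm_pk_le].
    by rewrite gauss_conv_cpk// -[z.1 - x.1]opprB CsinN//; ring.
  rewrite RintegralZl//; last first.
    apply: (integrable_itvoo_bounded (c := gauss t 0 * Ccos 0 t 0 0)).
      apply: measurable_funM; first by rewrite /gauss; meas.
      by apply: measurable_Csin_comp; meas.
    move=> w w0 wx; rewrite normrM ler_pM// ?Csin_bound ?subr_ge0 ?(ltW wx)//.
    by rewrite ger0_norm ?gauss_ge0 ?gauss_le.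
  by rewrite Msin_double//; field.
- have -> : i = 1 by have [/eqP|//] := ord2P i; rewrite (negbTE i0).
  transitivity (\int[leb]_(w2 in `]0, x.2[) (- 2^-1 * (gauss t (w2 + z.2) * Ccos 0 t (x.2 - w2) (x.1 - z.1)))).
    apply: eq_Rintegral => w2 w2I; have {}w2I : w2 \in `]0, x.2[ by move: w2I; rewrite inE.
    have s0 : 0 < x.2 - w2 by move: w2I; rewrite in_itv/= subr_gt0 => /andP[].
    transitivity (\int[leb]_w1 (- 2^-1 * gauss t (w2 + z.2) * (gauss t (z.1 - w1) * pk (x.2 - w2) (w1 - x.1)))).
      apply: eq_Rintegral => w1 _; rewrite (partial1P (is_derive_fund_sol1 (neq w1 _ w2I)))/=.
      rewrite heat_kernelE//= opprK -(gaussN _ (w1 - _)) opprB -[x.1 - w1]opprB pkNr; ring.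
    rewrite RintegralZl//; last first.
      apply: (gi (x.2 - w2)) => //; first by rewrite /pk; meas.
      by move=> w; exact: norm_pk_le2.
    by rewrite gauss_conv_pk// -[z.1 - x.1]opprB CcosN; ring.
  rewrite RintegralZl//; last first.
    apply: (integrable_itvoo_bounded (c := gauss t 0 * Ccos 0 t 0 0)).
      apply: measurable_funM; first by rewrite /gauss; meas.
      by apply: measurable_Ccos_comp; meas.
    move=> w w0 wx; rewrite normrM ler_pM// ?Ccos_bound ?subr_ge0 ?(ltW wx)//.
    by rewrite ger0_norm ?gauss_ge0 ?gauss_le.
  by rewrite Mcos_double//; field.
Qed.

Lemma stokes_kernelE (i j : 'I_2) x z t : 0 < t -> 0 < x.2 -> 0 <= z.2 ->
  stokes_kernel i j x z t =
    hd t x z * (i == j)%:R +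
    (1 - (j == 1)%:R) * (if i == 0 then Mcos 1 t (x.1 - z.1) x.2 z.2
                         else - Msin 1 t (x.1 - z.1) x.2 z.2).
Proof.
move=> t0 x0 z0; rewrite /stokes_kernel heat_kernel_hd//.
have [->|j1] := eqVneq j 1; first by rewrite !subrr mulr0 !mul0r subr0 addr0.
have -> : j = 0 by have [//|/eqP] := ord2P j; rewrite (negbTE j1).
rewrite subr0 mulr1 mul1r; congr (_ + _).
set F := (F in partial 0 F x).
have FE : (fun a : R => F (a, x.2)) = fun a => - 4^-1 *
   (if i == 0 then Msin 0 t (a - z.1) x.2 z.2 else Mcos 0 t (a - z.1) x.2 z.2).
  by apply/funext => a; rewrite /F (inner_integral i (x := (a, x.2))).
have dsub : is_derive x.1 1 (fun a => a - z.1) 1 by deriv; ring.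
suff e : is_derive x.1 1 (fun a : R => F (a, x.2)) (- 4^-1 *
   (if i == 0 then Mcos 1 t (x.1 - z.1) x.2 z.2 else - Msin 1 t (x.1 - z.1) x.2 z.2)).
  by rewrite (partial0P e); field.
rewrite FE; apply: is_derive1_cst_mul; case: ifP => _.
  have e := is_derive1_chain (f := fun a => Msin 0 t a x.2 z.2)
    (g := fun a => a - z.1) (is_derive_Msin_x _ _ t0 (ltW x0) z0) dsub.
  by apply: is_derive1_eq e _; rewrite mulr1.
have e := is_derive1_chain (f := fun a => Mcos 0 t a x.2 z.2)
  (g := fun a => a - z.1) (is_derive_Mcos_x _ _ t0 (ltW x0) z0) dsub.
by apply: is_derive1_eq e _; rewrite mulr1.
Qed.

End kernels.

(** * The curl of the Stokes semigroup *)

Section curl.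
Context {R : realType}.
Notation leb := (@lebesgue_measure R).
Notation leb2 := (@lebesgue2 R).
Notation H := (@half_plane R).
Implicit Types (x y z : R * R) (t : R) (u : 'I_2 -> R * R -> R).

(* The coefficients of [u 0] and [u 1] in [- div_perp (stokes_sgroup t u) x]. *)
Definition V0 t x z : R :=
  - (gauss t (x.1 - z.1) * (dgauss t (x.2 - z.2) - dgauss t (x.2 + z.2)))
  - 2 * gauss t (x.2 + z.2) * Ccos 1 t 0 (x.1 - z.1).
Definition V1 t x z : R :=
  dgauss t (x.1 - z.1) * (gauss t (x.2 - z.2) - gauss t (x.2 + z.2)).

Lemma half_planeE : H = setT `*` `]0, +oo[.
Proof. by apply/seteqP; split => -[a b]; rewrite /half_plane /= in_itv/= andbT; [|case]. Qed.

Lemma measurable_half_plane : measurable (H : set (plane R)).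
Proof. by rewrite half_planeE; exact: measurableX. Qed.

Section weighted.
Variables (w : plane R -> R) (v : plane R -> R).
Hypotheses (mw : measurable_fun setT w) (w0 : forall z, 0 < w z).
Hypothesis vi : leb2.-integrable H (EFin \o (fun z => w z * v z)).

(** All that is known of a velocity comes through its product with a weight; its measurability is
    recovered by dividing by the weight. *)
Lemma weighted_measurable : measurable_fun (H : set (plane R)) v.
Proof.
have := integrable_EFin_measurable measurable_half_plane vi.
move=> m; rewrite (_ : v = fun z => (w z)^-1 * (w z * v z)).
  apply: measurable_funM => //; apply: measurable_funTS; exact: measurable_funV.
by apply/funext => z; rewrite mulKf// gt_eqF.
Qed.

Lemma weighted_integrable (phi : plane R -> R) (C : R) : measurable_fun setT phi ->
  (forall z, H z -> `|phi z| <= C * w z) ->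
  leb2.-integrable H (EFin \o (fun z => phi z * v z)).
Proof.
move=> mphi phiC.
apply: (@le_integrable_EFin R _ _ leb2 _ _ (fun z => C * `|w z * v z|)).
- exact: measurable_half_plane.
- apply: measurable_funM; [exact: measurable_funTS|exact: weighted_measurable].
- apply: integrableZl_EFin; first exact: measurable_half_plane.
  exact: integrable_norm vi.
- move=> z Hz; rewrite normrM [leRHS](_ : _ = (C * w z) * `|v z|).
    by rewrite ler_wpM2r// phiC.
  by rewrite normrM gtr0_norm// mulrA.
Qed.
End weighted.

(** Decay in b uniform for a in a bounded range, since b is at most |a - b| + |a| and at most |a +
    b| + |a|. It provides the domination while x.2 varies. *)
Lemma gauss_shift_le (A a b : R) t : 0 < t -> 0 <= b -> `|a| <= A ->
  (`|gauss t (a - b)| <= gauss_bound t * expR A * expR (- b)) *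
  (`|gauss t (a + b)| <= gauss_bound t * expR A * expR (- b)) *
  (`|dgauss t (a - b)| <= gauss_bound t * expR A * expR (- b)) *
  (`|dgauss t (a + b)| <= gauss_bound t * expR A * expR (- b)).
Proof.
move=> t0 b0 aA.
have e1 : gauss_bound t * expR (- `|a - b|) <= gauss_bound t * expR A * expR (- b).
  rewrite -mulrA ler_wpM2l ?gauss_bound_ge0// -expRD ler_expR.
  have : b <= `|a - b| + `|a|.
    rewrite -[leLHS]ger0_norm// distrC; apply: le_trans (ler_normD _ _).
    by rewrite subrK.
  lra.
have e2 : gauss_bound t * expR (- `|a + b|) <= gauss_bound t * expR A * expR (- b).
  rewrite -mulrA ler_wpM2l ?gauss_bound_ge0// -expRD ler_expR.
  have : b <= `|a + b| + `|- a|.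
    rewrite -[leLHS]ger0_norm//; apply: le_trans (ler_normD _ _).
    by rewrite [a + b]addrC addrK.
  rewrite normrN; lra.
rewrite (ger0_norm (gauss_ge0 _ (a - b))) (ger0_norm (gauss_ge0 _ (a + b))).
do !split; first exact: le_trans (gauss_exp_le t0 _) e1.
- exact: le_trans (gauss_exp_le t0 _) e2.
- exact: le_trans (dgauss_exp_le t0 _) e1.
- exact: le_trans (dgauss_exp_le t0 _) e2.
Qed.

Lemma gauss_shift_abs_le (A a b : R) t : 0 < t -> `|a| <= A ->
  (`|gauss t (a - b)| <= gauss_bound t * expR A * expR (- `|b|)) *
  (`|dgauss t (a - b)| <= gauss_bound t * expR A * expR (- `|b|)).
Proof.
move=> t0 aA.
have e1 : gauss_bound t * expR (- `|a - b|) <= gauss_bound t * expR A * expR (- `|b|).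
  rewrite -mulrA ler_wpM2l ?gauss_bound_ge0// -expRD ler_expR.
  have : `|b| <= `|a - b| + `|a|.
    by rewrite distrC; apply: le_trans (ler_normD _ _); rewrite subrK.
  lra.
rewrite (ger0_norm (gauss_ge0 _ (a - b))).
split; first exact: le_trans (gauss_exp_le t0 _) e1.
exact: le_trans (dgauss_exp_le t0 _) e1.
Qed.

Lemma is_derive_hd2 t (x1 a : R) z : 0 < t ->
  is_derive a 1 (fun a => hd t (x1, a) z)
    (gauss t (x1 - z.1) * (dgauss t (a - z.2) - dgauss t (a + z.2))).
Proof.
move=> t0; rewrite /hd /=; apply: is_derive1_cst_mul.
have e1 : is_derive a 1 (fun a => a - z.2) 1 by deriv; ring.
have e2 : is_derive a 1 (fun a => a + z.2) 1 by deriv; ring.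
have d1 := is_derive1_chain (f := gauss t) (g := fun a => a - z.2) (is_derive_gauss t0 _) e1.
have d2 := is_derive1_chain (f := gauss t) (g := fun a => a + z.2) (is_derive_gauss t0 _) e2.
by apply: is_derive1_eq (is_derive1D d1 (is_derive1N d2)) _; ring.
Qed.

Lemma is_derive_hd1 t (a x2 : R) z : 0 < t ->
  is_derive a 1 (fun a => hd t (a, x2) z) (V1 t (a, x2) z).
Proof.
move=> t0; rewrite /hd /=.
have e1 : is_derive a 1 (fun a => a - z.1) 1 by deriv; ring.
have d1 := is_derive1_chain (f := gauss t) (g := fun a => a - z.1) (is_derive_gauss t0 _) e1.
apply: is_derive1_eq (is_derive1M d1 (is_derive_cst (gauss t (x2 - z.2) - gauss t (x2 + z.2)) a 1)) _.
by rewrite /V1 /=; ring.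
Qed.

Section curl_formula.
Variables (t : R) (x : R * R) (u : 'I_2 -> R * R -> R).
Hypotheses (t0 : 0 < t) (x0 : 0 < x.2).
Hypothesis u0i : leb2.-integrable H (EFin \o (fun z => expR (- z.2) * u 0 z)).
Hypothesis u1i : leb2.-integrable H (EFin \o (fun z => expR (- `|z.1|) * u 1 z)).

Let mw0 : measurable_fun setT (fun z : plane R => expR (- z.2)).
Proof. by meas. Qed.

Let mw1 : measurable_fun setT (fun z : plane R => expR (- `|z.1|)).
Proof. by meas. Qed.

Let phi_u0 (phi : plane R -> R) C : measurable_fun setT phi ->
  (forall z, H z -> `|phi z| <= C * expR (- z.2)) ->
  leb2.-integrable H (EFin \o (fun z => phi z * u 0 z)).
Proof. by apply: (weighted_integrable mw0) => // z; exact: expR_gt0. Qed.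

Let phi_u1 (phi : plane R -> R) C : measurable_fun setT phi ->
  (forall z, H z -> `|phi z| <= C * expR (- `|z.1|)) ->
  leb2.-integrable H (EFin \o (fun z => phi z * u 1 z)).
Proof. by apply: (weighted_integrable mw1) => // z; exact: expR_gt0. Qed.

Let mH := measurable_half_plane.

Lemma stokes_sgroupE (i : 'I_2) (x' : R * R) : 0 < x'.2 ->
  stokes_sgroup t u i x' = \int[leb2]_(z in H)
    (if i == 0 then (hd t x' z + Mcos 1 t (x'.1 - z.1) x'.2 z.2) * u 0 z
     else - Msin 1 t (x'.1 - z.1) x'.2 z.2 * u 0 z + hd t x' z * u 1 z).
Proof.
move=> x'0; apply: eq_Rintegral => z; rewrite inE => /= z0.
rewrite big_ord_recl big_ord1 !stokes_kernelE ?(ltW z0)//.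
have -> : lift ord0 ord0 = 1 :> 'I_2 by exact: val_inj.
have -> : ord0 = 0 :> 'I_2 by exact: val_inj.
have [->|->] := ord2P i; rewrite /= ?eqxx /=; ring.
Qed.

Let c1 := Ccos 1 t 0 0.
Let mV (n : nat) (a b : R) : measurable_fun setT (fun z : plane R => Mcos n t (a - z.1) b z.2).
Proof. by apply: measurable_Mcos; meas. Qed.

Let hd_le2 (a A : R) z : `|a| <= A -> H z ->
  `|hd t (x.1, a) z| <= gauss t 0 * (2 * (gauss_bound t * expR A)) * expR (- z.2).
Proof.
move=> aA z0; rewrite /hd /= normrM (ger0_norm (gauss_ge0 _ _)) -[leRHS]mulrA ler_pM ?gauss_ge0 ?gauss_le//.
have [[[h1 h2] h3] h4] := gauss_shift_le t0 (ltW z0) aA.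
by apply: (le_trans (ler_normB _ _)); lra.
Qed.

Let Mcos_le n (a A b : R) z : 0 <= a -> a <= A -> H z ->
  `|Mcos n t b a z.2| <= 2 * pi^-1 * (A * (wexp_bound n t 0 * gauss_bound t)) * expR (- z.2).
Proof.
move=> a0 aA z0; apply: (le_trans (norm_Mcos n b t0 a0 (ltW z0))).
rewrite [leRHS](_ : _ = 2 * pi^-1 * (A * Mbound n t z.2)); last by rewrite /Mbound; ring.
by rewrite ler_wpM2l ?mulr_ge0 ?invr_ge0 ?pi_ge0// ler_wpM2r// Mbound_ge0.
Qed.

Let Msin_le n (a A b : R) z : 0 <= a -> a <= A -> H z ->
  `|Msin n t b a z.2| <= 2 * pi^-1 * (A * (wexp_bound n t 0 * gauss_bound t)) * expR (- z.2).
Proof.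
move=> a0 aA z0; apply: (le_trans (norm_Msin n b t0 a0 (ltW z0))).
rewrite [leRHS](_ : _ = 2 * pi^-1 * (A * Mbound n t z.2)); last by rewrite /Mbound; ring.
by rewrite ler_wpM2l ?mulr_ge0 ?invr_ge0 ?pi_ge0// ler_wpM2r// Mbound_ge0.
Qed.

(** The derivative in x.2 of the coefficient of [u 0] in the first component of the semigroup. *)
Let D0 (a : R) z := gauss t (x.1 - z.1) * (dgauss t (a - z.2) - dgauss t (a + z.2)) +
   (2 * gauss t (a + z.2) * Ccos 1 t 0 (x.1 - z.1) - Mcos 2 t (x.1 - z.1) a z.2).

Let C0 : R := gauss t 0 * (2 * (gauss_bound t * expR (x.2 + 1))) +
  (2 * (gauss_bound t * expR (x.2 + 1)) * c1 +
   2 * pi^-1 * ((x.2 + 1) * (wexp_bound 2 t 0 * gauss_bound t))).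

Let D0_le (a : R) z : 0 < a -> a < x.2 + 1 -> H z -> `|D0 a z| <= C0 * expR (- z.2).
Proof.
move=> a0 a1 z0; have aA : `|a| <= x.2 + 1 by rewrite gtr0_norm// ltW.
have [[[h1 h2] h3] h4] := gauss_shift_le t0 (ltW z0) aA.
rewrite /D0 /C0 [leRHS]mulrDl; apply: (le_trans (ler_normD _ _)); apply: lerD.
  rewrite normrM (ger0_norm (gauss_ge0 _ _)) -[leRHS]mulrA ler_pM ?gauss_ge0 ?gauss_le//.
  by apply: (le_trans (ler_normB _ _)); lra.
rewrite [leRHS]mulrDl; apply: (le_trans (ler_normB _ _)); apply: lerD.
  rewrite normrM mulrAC ler_pM ?Ccos_bound// normrM ger0_norm// -mulrA ler_wpM2l//.
exact: Mcos_le (ltW a0) (ltW a1) z0.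
Qed.

Let is_derive_S0 : is_derive x.2 1 (fun a => stokes_sgroup t u 0 (x.1, a))
  (\int[leb2]_(z in H) (D0 x.2 z * u 0 z)).
Proof.
have e : is_derive x.2 1 (fun a => \int[leb2]_(z in H)
    ((hd t (x.1, a) z + Mcos 1 t (x.1 - z.1) a z.2) * u 0 z))
    (\int[leb2]_(z in H) (D0 x.2 z * u 0 z)).
  apply: (@is_derive_Rintegral R _ _ leb2
    (fun a z => (hd t (x.1, a) z + Mcos 1 t (x.1 - z.1) a z.2) * u 0 z)
    (fun a z => D0 a z * u 0 z)
    (fun z => C0 * `|expR (- z.2) * u 0 z|) _ x.2 0 (x.2 + 1)).
  - exact: mH.
  - exact: x0.
  - by rewrite ltrDl.
  - move=> a a0 a1; have aA : `|a| <= x.2 + 1 by rewrite gtr0_norm// ltW.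
    apply: (phi_u0 (C := gauss t 0 * (2 * (gauss_bound t * expR (x.2 + 1))) +
       2 * pi^-1 * ((x.2 + 1) * (wexp_bound 1 t 0 * gauss_bound t)))).
      by apply: measurable_funD => //; rewrite /hd /gauss; meas.
    move=> z z0; rewrite [leRHS]mulrDl; apply: (le_trans (ler_normD _ _)); apply: lerD.
      exact: hd_le2.
    exact: Mcos_le (ltW a0) (ltW a1) z0.
  - move=> a z a0 a1 z0.
    have d := is_derive1D (is_derive_hd2 x.1 a z t0) (is_derive_Mcos_a 1 (x.1 - z.1) t0 a0 (ltW z0)).
    by apply: is_derive1_eq (is_derive1M d (is_derive_cst (u 0 z) a 1)) _; rewrite /D0 /=; ring.
  - by apply: integrableZl_EFin => //; exact: integrable_norm u0i.
  - move=> a z a0 a1 z0; rewrite !normrM (ger0_norm (expR_ge0 _)) mulrA ler_wpM2r//.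
    exact: D0_le.
(* The formula [stokes_sgroupE] holds only for a > 0, hence near x.2 and not for all a. *)
apply: near_eq_is_derive e.
  near=> a; rewrite stokes_sgroupE//=.
  by near: a; exact: lt_nbhsr.
Unshelve. all: by end_near. Qed.

(** The derivative in x.1 of the integrand of the second component. *)
Let D1 (b : R) z := - Mcos 2 t (b - z.1) x.2 z.2 * u 0 z + V1 t (b, x.2) z * u 1 z.

Let K0 n : R := 2 * pi^-1 * (x.2 * (wexp_bound n t 0 * gauss_bound t)).
Let K1 : R := gauss_bound t * expR (`|x.1| + 1) * (2 * gauss t 0).

Let hd_le1 (b : R) z : `|b| <= `|x.1| + 1 ->
  (`|hd t (b, x.2) z| <= K1 * expR (- `|z.1|)) * (`|V1 t (b, x.2) z| <= K1 * expR (- `|z.1|)).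
Proof.
move=> bB; have [h1 h2] := gauss_shift_abs_le z.1 t0 bB.
have h3 : `|gauss t (x.2 - z.2) - gauss t (x.2 + z.2)| <= 2 * gauss t 0.
  apply: (le_trans (ler_normB _ _)); rewrite !ger0_norm ?gauss_ge0//.
  by have := gauss_le t0 (x.2 - z.2); have := gauss_le t0 (x.2 + z.2); lra.
rewrite /hd /V1 /K1 /= (normrM (gauss t (b - z.1))) (normrM (dgauss t (b - z.1))).
by split; rewrite [leRHS]mulrAC ler_pM.
Qed.

Let is_derive_S1 : is_derive x.1 1 (fun b => stokes_sgroup t u 1 (b, x.2))
  (\int[leb2]_(z in H) D1 x.1 z).
Proof.
have bB b : x.1 - 1 < b -> b < x.1 + 1 -> `|b| <= `|x.1| + 1.
  move=> h1 h2; have := ler_norm x.1; have := ler_norm (- x.1); rewrite normrN => h3 h4.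
  by rewrite ler_norml; lra.
rewrite (_ : (fun b => _) = fun b => \int[leb2]_(z in H)
    (- Msin 1 t (b - z.1) x.2 z.2 * u 0 z + hd t (b, x.2) z * u 1 z)); last first.
  by apply/funext => b; rewrite stokes_sgroupE.
apply: (@is_derive_Rintegral R _ _ leb2
  (fun b z => - Msin 1 t (b - z.1) x.2 z.2 * u 0 z + hd t (b, x.2) z * u 1 z)
  D1 (fun z => K0 2 * `|expR (- z.2) * u 0 z| + K1 * `|expR (- `|z.1|) * u 1 z|) _ x.1 (x.1 - 1) (x.1 + 1)).
- exact: mH.
- by rewrite ltrBlDr ltrDl.
- by rewrite ltrDl.
- move=> b b1 b2; apply: integrableD_EFin => //.
    apply: (phi_u0 (C := K0 1)).
      by apply: measurable_funN; apply: measurable_Msin; meas.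
    by move=> z z0; rewrite normrN; exact: Msin_le (ltW x0) (lexx _) z0.
  apply: (phi_u1 (C := K1)); first by rewrite /hd /gauss; meas.
  by move=> z z0; have [] := hd_le1 z (bB _ b1 b2).
- move=> b z b1 b2 z0.
  have e1 : is_derive b 1 (fun b => b - z.1) 1 by deriv; ring.
  have d0 := is_derive1N (is_derive1_chain (f := fun a => Msin 1 t a x.2 z.2) (g := fun b => b - z.1)
    (is_derive_Msin_x 1 _ t0 (ltW x0) (ltW z0)) e1).
  have d1 := is_derive1M d0 (is_derive_cst (u 0 z) b 1).
  have d2 := is_derive1M (is_derive_hd1 b x.2 z t0) (is_derive_cst (u 1 z) b 1).
  by apply: is_derive1_eq (is_derive1D d1 d2) _; rewrite /D1 /=; ring.
- apply: integrableD_EFin => //; apply: integrableZl_EFin => //.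
    exact: integrable_norm u0i.
  exact: integrable_norm u1i.
- move=> b z b1 b2 z0; apply: (le_trans (ler_normD _ _)); apply: lerD.
    rewrite !normrM normrN (ger0_norm (expR_ge0 _)) mulrA ler_wpM2r//.
    exact: Mcos_le (ltW x0) (lexx _) z0.
  rewrite normrM [X in _ <= _ * X]normrM (ger0_norm (expR_ge0 _)) mulrA ler_wpM2r//.
  by have [] := hd_le1 z (bB _ b1 b2).
Qed.

Lemma measurable_V0 : measurable_fun setT (V0 t x : plane R -> R).
Proof.
apply: measurable_funB; first by rewrite /dgauss /gauss; meas.
apply: measurable_funM; first by rewrite /gauss; meas.
by apply: measurable_Ccos_comp; meas.
Qed.

Lemma measurable_V1 : measurable_fun setT (V1 t x : plane R -> R).
Proof. by rewrite /V1 /dgauss /gauss; meas. Qed.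

Lemma V0_bound : exists C, forall z, H z -> `|V0 t x z| <= C * expR (- z.2).
Proof.
have aA : `|x.2| <= x.2 + 1 by rewrite gtr0_norm// lerDl.
exists (gauss t 0 * (2 * (gauss_bound t * expR (x.2 + 1))) +
  2 * (gauss_bound t * expR (x.2 + 1)) * c1).
move=> z z0; rewrite /V0.
have [[[h1 h2] h3] h4] := gauss_shift_le t0 (ltW z0) aA.
rewrite [leRHS]mulrDl; apply: (le_trans (ler_normB _ _)); apply: lerD.
  rewrite normrN normrM (ger0_norm (gauss_ge0 _ _)) -[leRHS]mulrA ler_pM ?gauss_ge0 ?gauss_le//.
  by apply: (le_trans (ler_normB _ _)); lra.
by rewrite normrM mulrAC ler_pM ?Ccos_bound// normrM ger0_norm// -mulrA ler_wpM2l.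
Qed.

Lemma V1_bound : exists C, forall z, H z -> `|V1 t x z| <= C * expR (- `|z.1|).
Proof.
have b1 : `|x.1| <= `|x.1| + 1 by rewrite lerDl.
by exists K1 => z _; have [_] := hd_le1 z b1; case: (x).
Qed.

Lemma integrable_V0 : leb2.-integrable H (EFin \o (fun z => V0 t x z * u 0 z)).
Proof. by have [C V0C] := V0_bound; exact: (phi_u0 measurable_V0 V0C). Qed.

Lemma integrable_V1 : leb2.-integrable H (EFin \o (fun z => V1 t x z * u 1 z)).
Proof. by have [C V1C] := V1_bound; exact: (phi_u1 measurable_V1 V1C). Qed.

(** The terms with [Mcos 2] in [D0] and [D1] are equal and cancel in the curl. *)
Lemma curl_stokes_sgroup : - div_perp (stokes_sgroup t u) x =
  \int[leb2]_(z in H) (V0 t x z * u 0 z) + \int[leb2]_(z in H) (V1 t x z * u 1 z).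
Proof.
have := integrable_V0; have := integrable_V1; move=> i1 i0.
rewrite /div_perp (partial1P is_derive_S0) (partial0P is_derive_S1).
have iM : leb2.-integrable H (EFin \o (fun z => Mcos 2 t (x.1 - z.1) x.2 z.2 * u 0 z)).
  apply: (phi_u0 (C := K0 2)) => // z z0.
  exact: Mcos_le (ltW x0) (lexx _) z0.
have -> : \int[leb2]_(z in H) (D0 x.2 z * u 0 z) =
    - (\int[leb2]_(z in H) (V0 t x z * u 0 z)) -
      \int[leb2]_(z in H) (Mcos 2 t (x.1 - z.1) x.2 z.2 * u 0 z).
  transitivity (\int[leb2]_(z in H) (- (V0 t x z * u 0 z) - Mcos 2 t (x.1 - z.1) x.2 z.2 * u 0 z)).
    by apply: eq_Rintegral => z _; rewrite /D0 /V0; ring.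
  rewrite (RintegralB mH (integrableN_EFin mH i0) iM).
  by rewrite (RintegralN mH i0).
have -> : \int[leb2]_(z in H) D1 x.1 z =
    \int[leb2]_(z in H) (V1 t x z * u 1 z) -
      \int[leb2]_(z in H) (Mcos 2 t (x.1 - z.1) x.2 z.2 * u 0 z).
  by rewrite -RintegralB//; apply: eq_Rintegral => z _; rewrite /D1 /V1 /=; ring.
ring.
Qed.

End curl_formula.
End curl.

(** The positivity of the time that the derivatives of [gauss], [dgauss] and [Ccos] need is looked
    up in the context. *)
Ltac deriv_step' := first [ deriv_step | lazymatch goal with
  | H : is_true (0 < ?t) |- is_derive _ _ (fun y => gauss ?t (@?f y)) _ =>
     notypeclasses refine (is_derive1_chain (f := gauss t) (g := f) (is_derive_gauss H _) _)
  | H : is_true (0 < ?t) |- is_derive _ _ (fun y => dgauss ?t (@?f y)) _ =>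
     notypeclasses refine (is_derive1_chain (f := dgauss t) (g := f) (is_derive_dgauss H _) _)
  | H : is_true (0 < ?t) |- is_derive _ _ (fun y => Ccos ?n ?t (@?f y) ?x) _ =>
     notypeclasses refine (is_derive1_chain (f := fun s => Ccos n t s x) (g := f) (is_derive_Ccos_s n _ _ H) _)
  end; cbv beta ].
Ltac deriv' := notypeclasses refine (is_derive1_eq _ _); [repeat deriv_step'|cbv beta].
Ltac cont' := apply: derivable1_continuous => ?; eexists; repeat deriv_step'.

(** * Weighted integrability of the Biot-Savart kernel *)

Section kernel.
Context {R : realType}.
Notation leb := (@lebesgue_measure R).
Notation leb2 := (@lebesgue2 R).
Notation H := (@half_plane R).
Implicit Types (x y z : R * R) (t : R).

Lemma ge0_integral_half_plane21 (f : plane R -> R) : measurable_fun setT f ->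
  (forall z, 0 <= f z) ->
  (\int[leb2]_(z in H) (f z)%:E =
   \int[leb]_(z2 in `]0%R, +oo[) \int[leb]_z1 (f (z1, z2))%:E)%E.
Proof.
move=> mf f0; rewrite integral_mkcond half_planeE.
rewrite /lebesgue2 fubini_tonelli2.
- rewrite [RHS]integral_mkcond; apply: eq_integral => z2 _.
  rewrite /fubini_G patchE; case: ifPn => z20.
    apply: eq_integral => z1 _; rewrite patchE mem_set//; split => //.
    by rewrite inE in z20.
  rewrite integral0_eq// => z1 _; rewrite patchE memNset// => -[_ h].
  by move: z20; rewrite (mem_set h).
- apply: (measurable_restrict _ _ _).1 => //; first exact: measurableX.
  by apply: measurable_funTS; exact/measurable_EFinP.
- by move=> z; rewrite patchE; case: ifP => // _; rewrite lee_fin.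
Qed.

Lemma ge0_integral_half_plane12 (f : plane R -> R) : measurable_fun setT f ->
  (forall z, 0 <= f z) ->
  (\int[leb2]_(z in H) (f z)%:E =
   \int[leb]_z1 \int[leb]_(z2 in `]0%R, +oo[) (f (z1, z2))%:E)%E.
Proof.
move=> mf f0; rewrite integral_mkcond half_planeE.
rewrite /lebesgue2 fubini_tonelli1.
- apply: eq_integral => z1 _.
  rewrite /fubini_F [RHS]integral_mkcond; apply: eq_integral => z2 _.
  rewrite !patchE; congr (if _ then _ else _).
  by apply/idP/idP; rewrite !inE /=; [case|split].
- apply: (measurable_restrict _ _ _).1 => //; first exact: measurableX.
  by apply: measurable_funTS; exact/measurable_EFinP.
- by move=> z; rewrite patchE; case: ifP => // _; rewrite lee_fin.
Qed.

(* [Kgreen i z y] is not integrable in [z] over the half plane; with these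
   weights it is, uniformly in [y]. *)
Definition green_weight (i : 'I_2) z : R := if i == 0 then expR (- z.2) else expR (- `|z.1|).

(** For i = 0 these are Poisson kernels in the first coordinate, for i = 1 in the second. Integrated
    in that coordinate first, each contributes at most 1 uniformly in y, and [green_weight] makes
    the remaining integral finite. *)
Definition green_bound (i : 'I_2) z y : R :=
  if i == 0 then `|pk (z.2 - y.2) (z.1 - y.1)| + `|pk (z.2 + y.2) (z.1 - y.1)|
  else `|pk (z.1 - y.1) (z.2 - y.2)| + `|pk (z.1 - y.1) (z.2 + y.2)|.

Let Kgreen_le i z y : `|Kgreen i z y| <= green_bound i z y.
Proof.
have half1 (c : R) : `|c| = 2^-1 -> forall p q : R, `|c * (p - q)| <= `|p| + `|q|.
  move=> cE p q; rewrite normrM cE; have := ler_normB p q.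
  by have := normr_ge0 (p - q); lra.
rewrite /Kgreen /green_bound; case: ifP => _.
  by rewrite normr0; case: ifP => _; rewrite addr_ge0.
have h2 : (0 : R) <= 2^-1 by [].
have n2 := ger0_norm h2.
by case: ifP => _; apply: half1; [rewrite normrN|]; exact: n2.
Qed.

Let measurable_wK i y : measurable_fun setT (fun z : plane R => green_weight i z * green_bound i z y).
Proof. by rewrite /green_weight /green_bound; case: (i == 0); rewrite /pk; meas. Qed.

Definition weight_mass : \bar R :=
  (maxe (\int[leb]_(z in `]0%R, +oo[) (2 * expR (- z))%:E) (\int[leb]_z (2 * expR (- `|z|))%:E))%E.

Lemma weight_mass_fin : (weight_mass < +oo)%E.
Proof.
rewrite /weight_mass gt_max; apply/andP; split.
  have : leb.-integrable `]0, +oo[ (EFin \o (fun z : R => 2 * expR (- z))).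
    apply: integrableZl_EFin => //; apply: integrableS (@integrable_expRN R) => //.
    by apply: subset_itvr; rewrite bnd_simp.
  move=> i; have : (\int[leb]_(z in `]0%R, +oo[) (2 * expR (- z))%:E)%E \is a fin_num.
    exact: integrable_fin_num i.
  rewrite ge0_fin_numE//; by apply: integral_ge0 => z _; rewrite lee_fin mulr_ge0 ?expR_ge0.
have : leb.-integrable setT (EFin \o (fun z : R => 2 * expR (- `|z|))).
  by apply: integrableZl_EFin => //; exact: integrable_expRN_abs.
move=> i; have : (\int[leb]_z (2 * expR (- `|z|))%:E)%E \is a fin_num.
  exact: integrable_fin_num i.
rewrite ge0_fin_numE//; by apply: integral_ge0 => z _; rewrite lee_fin mulr_ge0 ?expR_ge0.
Qed.

Let integral_pk_sum s1 s2 (c1 c2 : R) (D : set (measurableTypeR R)) : measurable D ->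
  (\int[leb]_(z in D) (`|pk s1 (z - c1)| + `|pk s2 (z - c2)|)%:E <= 2%:E)%E.
Proof.
move=> mD.
have m s c : measurable_fun setT (fun z : R => `|pk s (z - c)|) by rewrite /pk; meas.
apply: (@le_trans _ _ (\int[leb]_z (`|pk s1 (z - c1)| + `|pk s2 (z - c2)|)%:E)%E).
  apply: ge0_subset_integral => //.
  - by apply/measurable_EFinP; rewrite /pk; meas.
under eq_integral do rewrite EFinD.
rewrite ge0_integralD//.
- by rewrite [2]mulr2n EFinD leeD// integral_norm_pk_le1.
- by apply/measurable_EFinP; apply: measurable_funTS; exact: m.
- by apply/measurable_EFinP; apply: measurable_funTS; exact: m.
Qed.

Let integral_wK i y : (\int[leb2]_(z in H) (green_weight i z * green_bound i z y)%:E <= weight_mass)%E.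
Proof.
have K0 z : 0 <= green_bound i z y by rewrite /green_bound; case: ifP => _; rewrite addr_ge0.
have w0 z : 0 <= green_weight i z by rewrite /green_weight; case: ifP => _; exact: expR_ge0.
rewrite /weight_mass; have [->|->] := ord2P i.
- rewrite (ge0_integral_half_plane21 (measurable_wK 0 y)); last by move=> z; exact: mulr_ge0 (expR_ge0 _) (addr_ge0 _ _).
  rewrite le_max; apply/orP; left.
  apply: ge0_le_integral => //.
  + by move=> z _; apply: integral_ge0 => z1 _; rewrite lee_fin mulr_ge0 ?expR_ge0 ?addr_ge0.
  + apply: measurable_funTS.
    apply: (measurable_fun_fubini_tonelli_G (m1 := leb) (fun z => (green_weight 0 z * green_bound 0 z y)%:E)).
      by apply/measurable_EFinP; exact: measurable_wK.
    by move=> z; rewrite lee_fin mulr_ge0 ?expR_ge0 ?addr_ge0.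
  + by apply/measurable_EFinP; meas.
  + move=> z2 _; rewrite /green_weight /green_bound /=.
    under eq_integral do rewrite EFinM.
    rewrite ge0_integralZl//; last by apply/measurable_EFinP; rewrite /pk; meas.
    rewrite [leRHS](_ : _ = (expR (- z2))%:E * 2%:E)%E; last by rewrite -EFinM mulrC.
    apply: lee_wpmul2l; first by rewrite lee_fin expR_ge0.
    exact: integral_pk_sum.
- rewrite (ge0_integral_half_plane12 (measurable_wK 1 y)); last by move=> z; exact: mulr_ge0 (expR_ge0 _) (addr_ge0 _ _).
  rewrite le_max; apply/orP; right.
  apply: ge0_le_integral => //.
  + by move=> z _; apply: integral_ge0 => z1 _; rewrite lee_fin mulr_ge0 ?expR_ge0 ?addr_ge0.
  + apply: (measurable_integral_param leb
      (f := fun z1 z2 : measurableTypeR R => green_weight 1 (z1, z2) * green_bound 1 (z1, z2) y)).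
    * exact: measurable_itv.
    * by move=> z1 z2; exact: mulr_ge0 (expR_ge0 _) (addr_ge0 _ _).
    * by rewrite /green_weight /green_bound /pk /=; meas.
  + by apply/measurable_EFinP; meas.
  + move=> z1 _; rewrite /green_weight /green_bound /=.
    under eq_integral do rewrite EFinM.
    rewrite ge0_integralZl//; last by apply/measurable_EFinP; apply: measurable_funTS; rewrite /pk; meas.
    rewrite [leRHS](_ : _ = (expR (- `|z1|))%:E * 2%:E)%E; last by rewrite -EFinM mulrC.
    apply: lee_wpmul2l; first by rewrite lee_fin expR_ge0.
    rewrite [leLHS](_ : _ = \int[leb]_(z in `]0%R, +oo[)
        (`|pk (z1 - y.1) (z - y.2)| + `|pk (z1 - y.1) (z - - y.2)|)%:E)%E.
      exact: integral_pk_sum.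
    by apply: eq_integral => z _; rewrite opprK.
Qed.

Lemma integral_wKgreen i y :
  (\int[leb2]_(z in H) `|green_weight i z * Kgreen i z y|%:E <= weight_mass)%E.
Proof.
apply: le_trans (integral_wK i y); apply: ge0_le_integral => //.
- exact: measurable_half_plane.
- apply/measurable_EFinP/measurable_funTS; apply: measurable_fun_norm.
  apply: measurable_funM; first by rewrite /green_weight; case: (i == 0); meas.
  exact: (measurableT_comp (measurable_Kgreen i) (measurable_fun_pair (@measurable_id _ _ _) (measurable_cst y))).
- by apply/measurable_EFinP/measurable_funTS; exact: measurable_wK.
- move=> z _; rewrite lee_fin normrM ger0_norm.
    by rewrite ler_wpM2l ?Kgreen_le//; rewrite /green_weight; case: ifP => _; exact: expR_ge0.
  by rewrite /green_weight; case: ifP => _; exact: expR_ge0.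
Qed.

Lemma integrable_wKgreen i y :
  leb2.-integrable H (EFin \o (fun z => green_weight i z * Kgreen i z y)).
Proof.
apply/integrableP; split; last exact: le_lt_trans (integral_wKgreen i y) weight_mass_fin.
apply/measurable_EFinP/measurable_funTS.
apply: measurable_funM; first by rewrite /green_weight; case: (i == 0); meas.
exact: (measurableT_comp (measurable_Kgreen i) (measurable_fun_pair (@measurable_id _ _ _) (measurable_cst y))).
Qed.

End kernel.

(** * The kernel of the vorticity semigroup *)

Section vorticity_kernel.
Context {R : realType}.
Notation leb := (@lebesgue_measure R).
Notation leb2 := (@lebesgue2 R).
Notation H := (@half_plane R).
Implicit Types (x y : R * R).

(** The formula of [curl_stokes_sgroup] for the velocity of a unit point vortex at y. *)
Definition vort_kernel t x y : R :=
  \int[leb2]_(z in H) (V0 t x z * Kgreen 0 z y) + \int[leb2]_(z in H) (V1 t x z * Kgreen 1 z y).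

Lemma cvg_dom_expRN_ge (f : R -> R) (C M : R) :
  (forall s : R, M <= s -> `|f s| <= C * expR (- s)) -> f s @[s --> +oo] --> 0.
Proof.
move=> fC; apply: norm_cvg0.
apply: (@squeeze_cvgr _ _ _ _ (fun=> 0) (fun s : R => C * expR (- s))).
- near=> s; rewrite normr_ge0/= fC//; near: s; exact: nbhs_pinfty_ge.
- exact: cvg_cst.
- by rewrite -[X in _ --> X](mulr0 C); apply: cvgMr; exact: cvgr_expR.
Unshelve. all: by end_near. Qed.

Lemma norm_subr_le2 (p q c : R) : `|p| <= c -> `|q| <= c -> `|p - q| <= 2 * c.
Proof. by move=> pc qc; rewrite mulr_natl mulr2n (le_trans (ler_normB _ _))// lerD. Qed.

Lemma norm_half_sub_le (p q c : R) : `|p| <= c -> `|q| <= c -> `|2^-1 * (p - q)| <= c.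
Proof.
by move=> pc qc; rewrite normrM ger0_norm ?invr_ge0// ler_pdivrMl// norm_subr_le2.
Qed.

Section formula.
Variables (t : R) (x y : R * R).
Hypotheses (t0 : 0 < t) (x0 : 0 < x.2) (y0 : 0 < y.2).

Let xi := x.1 - y.1.
Let a := x.2.
Let b := y.2.
Let C s := Ccos 0 t s xi.
Let C' s := Ccos 1 t s xi.

Let gauss_pk_int s : 0 < s ->
  leb.-integrable setT (EFin \o (fun z1 => gauss t (x.1 - z1) * pk s (z1 - y.1))).
Proof.
move=> s0; apply: (@le_integrable_EFin R _ _ leb _ _ (fun z1 => s^-1 * gauss t (x.1 - z1))) => //.
- by rewrite /gauss /pk; meas.
- by apply: integrableZl_EFin => //; exact: integrable_reflect (integrable_gauss t0).
- by move=> z _; rewrite normrM mulrC (ger0_norm (gauss_ge0 _ _)) ler_wpM2r ?gauss_ge0 ?norm_pk_le2.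
Qed.

Let Ccos1_pk_int s : 0 < s ->
  leb.-integrable setT (EFin \o (fun z1 => Ccos 1 t 0 (x.1 - z1) * pk s (z1 - y.1))).
Proof.
move=> s0.
have pki : leb.-integrable setT (EFin \o (fun z : R => pk s (z - y.1))).
  have := integrable_reflect y.1 (integrable_pk s0).
  by apply: eq_integrable => // z _ /=; rewrite -pkNr opprB.
apply: (@le_integrable_EFin R _ _ leb _ _ (fun z1 => Ccos 1 t 0 0 * pk s (z1 - y.1))) => //.
- apply: measurable_funM; last by rewrite /pk; meas.
  by apply: measurable_Ccos_comp; meas.
- exact: integrableZl_EFin.
- by move=> z _; rewrite normrM (ger0_norm (pk_ge0 _ (ltW s0))) ler_wpM2r ?pk_ge0 ?(ltW s0)// Ccos_bound.
Qed.

Let dgauss_pk_int s : 0 < s ->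
  leb.-integrable setT (EFin \o (fun z1 => dgauss t (x.1 - z1) * pk (z1 - y.1) s)).
Proof.
move=> s0; apply: (@le_integrable_EFin R _ _ leb _ _
   (fun z1 => s^-1 * (gauss_bound t * expR (- `|x.1 - z1|)))) => //.
- by rewrite /dgauss /gauss /pk; meas.
- by do 2 apply: integrableZl_EFin => //; exact: integrable_reflect (@integrable_expRN_abs R).
- by move=> z _; rewrite normrM mulrC ler_pM// ?norm_pk_le// dgauss_exp_le.
Qed.

(* [pk s] is odd in s, so the convolutions below carry the sign of s *)
Let sgn_conv s : s != 0 ->
  leb.-integrable setT (EFin \o (fun z1 => gauss t (x.1 - z1) * pk s (z1 - y.1))) /\
  \int[leb]_z1 (gauss t (x.1 - z1) * pk s (z1 - y.1)) = Num.sg s * C `|s|.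
Proof.
rewrite neq_lt => /orP[s0|s0].
- have s1 : 0 < - s by rewrite oppr_gt0.
  have e z1 : gauss t (x.1 - z1) * pk s (z1 - y.1) = - (gauss t (x.1 - z1) * pk (- s) (z1 - y.1)).
    by rewrite pkN; ring.
  split.
    have := integrableN_EFin measurableT (gauss_pk_int s1).
    by apply: eq_integrable => // z1 _ /=; rewrite e.
  under eq_Rintegral do rewrite e.
  rewrite RintegralN//; last exact: gauss_pk_int.
  by rewrite gauss_conv_pk// ltr0_sg// ltr0_norm// mulN1r.
- split; first exact: gauss_pk_int.
  by rewrite gauss_conv_pk// gtr0_sg// gtr0_norm// mul1r.
Qed.

Let sgn_conv1 s : s != 0 ->
  leb.-integrable setT (EFin \o (fun z1 => Ccos 1 t 0 (x.1 - z1) * pk s (z1 - y.1))) /\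
  \int[leb]_z1 (Ccos 1 t 0 (x.1 - z1) * pk s (z1 - y.1)) = Num.sg s * C' `|s|.
Proof.
rewrite neq_lt => /orP[s0|s0].
- have s1 : 0 < - s by rewrite oppr_gt0.
  have e z1 : Ccos 1 t 0 (x.1 - z1) * pk s (z1 - y.1) = - (Ccos 1 t 0 (x.1 - z1) * pk (- s) (z1 - y.1)).
    by rewrite pkN; ring.
  split.
    have := integrableN_EFin measurableT (Ccos1_pk_int s1).
    by apply: eq_integrable => // z1 _ /=; rewrite e.
  under eq_Rintegral do rewrite e.
  rewrite RintegralN//; last exact: Ccos1_pk_int.
  by rewrite Ccos1_conv_pk// ltr0_sg// ltr0_norm// mulN1r.
- split; first exact: Ccos1_pk_int.
  by rewrite Ccos1_conv_pk// gtr0_sg// gtr0_norm// mul1r.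
Qed.

(** The conjugate kernel is even in the height, so no sign appears here. *)
Let even_conv s : s != 0 ->
  leb.-integrable setT (EFin \o (fun z1 => dgauss t (x.1 - z1) * pk (z1 - y.1) s)) /\
  \int[leb]_z1 (dgauss t (x.1 - z1) * pk (z1 - y.1) s) = C' `|s|.
Proof.
move=> s0; have s1 : 0 < `|s| by rewrite normr_gt0.
have e z1 : dgauss t (x.1 - z1) * pk (z1 - y.1) s = dgauss t (x.1 - z1) * pk (z1 - y.1) `|s|.
  by rewrite /pk real_normK ?num_real.
split.
  by have := dgauss_pk_int s1; apply: eq_integrable => // z1 _ /=; rewrite e.
by under eq_Rintegral do rewrite e; rewrite dgauss_conv_cpk.
Qed.

(* The integral over [z1], see [innerE]; [fL] and [fR] are its expressions for
   [z < b] and [b < z]. *)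
Let inner z : R :=
  2^-1 * (dgauss t (a - z) - dgauss t (a + z)) * (Num.sg (z - b) * C `|z - b| - C (z + b)) +
  gauss t (a + z) * (Num.sg (z - b) * C' `|z - b| - C' (z + b)) +
  2^-1 * (gauss t (a - z) - gauss t (a + z)) * (C' `|z - b| - C' (z + b)).

(** On the line z2 = b one of the two heights is 0 and the convolution formulas fail; this single
    value is negligible for the integral in z2. *)
Let innerE (z2 : R) : 0 < z2 -> z2 != b ->
  \int[leb]_z1 (V0 t x (z1, z2) * Kgreen 0 (z1, z2) y) +
  \int[leb]_z1 (V1 t x (z1, z2) * Kgreen 1 (z1, z2) y) = inner z2.
Proof.
move=> z0 zb.
have s1 : z2 - b != 0 by rewrite subr_eq0.
have s2 : 0 < z2 + b by rewrite addr_gt0.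
have s2n := lt0r_neq0 s2.
have zy z1 : ((z1, z2) == y :> R * R) = false.
  by apply/negbTE; apply: contra zb => /eqP/(congr1 snd)/= ->.
have [i1 e1] := sgn_conv s1; have [i2 e2] := sgn_conv s2n.
have [j1 f1] := sgn_conv1 s1; have [j2 f2] := sgn_conv1 s2n.
have [k1 g1] := even_conv s1; have [k2 g2] := even_conv s2n.
rewrite gtr0_sg// gtr0_norm// in e2 f2 g2; rewrite mul1r in e2; rewrite mul1r in f2.
have -> : \int[leb]_z1 (V1 t x (z1, z2) * Kgreen 1 (z1, z2) y) =
    2^-1 * (gauss t (a - z2) - gauss t (a + z2)) * (C' `|z2 - b| - C' (z2 + b)).
  transitivity (\int[leb]_z1 (2^-1 * (gauss t (a - z2) - gauss t (a + z2)) *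
     (dgauss t (x.1 - z1) * pk (z1 - y.1) (z2 - b) - dgauss t (x.1 - z1) * pk (z1 - y.1) (z2 + b)))).
    by apply: eq_Rintegral => z1 _; rewrite /V1 /Kgreen zy /=; ring.
  rewrite RintegralZl//; last exact: integrableB_EFin.
  by rewrite RintegralB// g1 g2.
have -> : \int[leb]_z1 (V0 t x (z1, z2) * Kgreen 0 (z1, z2) y) =
  2^-1 * (dgauss t (a - z2) - dgauss t (a + z2)) * (Num.sg (z2 - b) * C `|z2 - b| - C (z2 + b)) +
  gauss t (a + z2) * (Num.sg (z2 - b) * C' `|z2 - b| - C' (z2 + b)).
  transitivity (\int[leb]_z1 (2^-1 * (dgauss t (a - z2) - dgauss t (a + z2)) *
     (gauss t (x.1 - z1) * pk (z2 - b) (z1 - y.1) - gauss t (x.1 - z1) * pk (z2 + b) (z1 - y.1)) +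
     gauss t (a + z2) * (Ccos 1 t 0 (x.1 - z1) * pk (z2 - b) (z1 - y.1) -
        Ccos 1 t 0 (x.1 - z1) * pk (z2 + b) (z1 - y.1)))).
    by apply: eq_Rintegral => z1 _; rewrite /V0 /Kgreen zy /=; field.
  have I1 := integrableB_EFin measurableT i1 i2; have I2 := integrableB_EFin measurableT j1 j2.
  rewrite RintegralD//; [|exact: integrableZl_EFin..].
  by rewrite !RintegralZl// !RintegralB// e1 e2 f1 f2.
by rewrite /inner.
Qed.

Let fL z : R :=
  2^-1 * (dgauss t (a - z) - dgauss t (a + z)) * (- C (b - z) - C (z + b)) +
  gauss t (a + z) * (- C' (b - z) - C' (z + b)) +
  2^-1 * (gauss t (a - z) - gauss t (a + z)) * (C' (b - z) - C' (z + b)).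

Let fR z : R :=
  2^-1 * (dgauss t (a - z) - dgauss t (a + z)) * (C (z - b) - C (z + b)) +
  gauss t (a + z) * (C' (z - b) - C' (z + b)) +
  2^-1 * (gauss t (a - z) - gauss t (a + z)) * (C' (z - b) - C' (z + b)).

(* [FL] is a primitive of [fL - 2 tail], [FR] one of [fR]. *)
Let FL z : R := 2^-1 * (gauss t (a - z) - gauss t (a + z)) * (C (b - z) + C (z + b)) +
  gauss t (a + z) * (C (z + b) - C (b - z)).

Let FR z : R := - (2^-1 * (gauss t (a - z) - gauss t (a + z)) * (C (z - b) - C (z + b))) -
  gauss t (a + z) * (C (z - b) - C (z + b)).

Let tail z : R := dgauss t (a + z) * C (b - z).

Let is_derive_FL (z : R) : is_derive z 1 FL (fL z - 2 * tail z).
Proof.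
rewrite /FL /C; deriv'; rewrite /fL /tail /C /C'.
move: (gauss t (a - z)) (gauss t (a + z)) (dgauss t (a - z)) (dgauss t (a + z)) => g1 g2 d1 d2.
move: (Ccos 0 t (b - z) xi) (Ccos 0 t (z + b) xi) (Ccos 1 t (b - z) xi) (Ccos 1 t (z + b) xi) => e1 e2 e3 e4.
by field.
Qed.

Let is_derive_FR (z : R) : is_derive z 1 FR (fR z).
Proof.
rewrite /FR /C; deriv'; rewrite /fR /C /C'.
move: (gauss t (a - z)) (gauss t (a + z)) (dgauss t (a - z)) (dgauss t (a + z)) => g1 g2 d1 d2.
move: (Ccos 0 t (z - b) xi) (Ccos 0 t (z + b) xi) (Ccos 1 t (z - b) xi) (Ccos 1 t (z + b) xi) => e1 e2 e3 e4.
by field.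
Qed.

Let cfL : continuous fL. Proof. by rewrite /fL /C /C'; cont'. Qed.
Let cfR : continuous fR. Proof. by rewrite /fR /C /C'; cont'. Qed.
Let ctail : continuous tail. Proof. by rewrite /tail /C; cont'. Qed.

Let c0 := Ccos 0 t 0 0.
Let c1 := Ccos 1 t 0 0.

Let fR_le (z : R) : b <= z -> `|fR z| <= (gauss_bound t * expR a) * (2 * c0 + 4 * c1) * expR (- z) /\
  `|FR z| <= (gauss_bound t * expR a) * (4 * c0) * expR (- z).
Proof.
move=> bz; have z0 : 0 <= z by apply: le_trans bz; exact: ltW.
have aA : `|a| <= a by rewrite ger0_norm// ltW.
have [[[h1 h2] h3] h4] := gauss_shift_le t0 z0 aA.
set B := gauss_bound t * expR a * expR (- z) in h1 h2 h3 h4.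
have p1 : `|C (z - b)| <= c0 by rewrite Ccos_bound// subr_ge0.
have p2 : `|C (z + b)| <= c0 by rewrite Ccos_bound// addr_ge0// ltW.
have q1 : `|C' (z - b)| <= c1 by rewrite Ccos_bound// subr_ge0.
have q2 : `|C' (z + b)| <= c1 by rewrite Ccos_bound// addr_ge0// ltW.
have p3 : `|C (z - b) - C (z + b)| <= 2 * c0 by exact: (norm_subr_le2 p1 p2).
have q3 : `|C' (z - b) - C' (z + b)| <= 2 * c1 by exact: (norm_subr_le2 q1 q2).
have m1 : `|2^-1 * (dgauss t (a - z) - dgauss t (a + z))| <= B.
  exact: norm_half_sub_le.
have m2 : `|2^-1 * (gauss t (a - z) - gauss t (a + z))| <= B.
  exact: norm_half_sub_le.
split.
- rewrite [leRHS](_ : _ = B * (2 * c0) + B * (2 * c1) + B * (2 * c1)); last by rewrite /B; ring.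
  apply: (le_trans (ler_normD _ _)); apply: lerD; last by rewrite normrM ler_pM.
  by apply: (le_trans (ler_normD _ _)); apply: lerD; rewrite normrM ler_pM.
- rewrite [leRHS](_ : _ = B * (2 * c0) + B * (2 * c0)); last by rewrite /B; ring.
  apply: (le_trans (ler_normB _ _)); apply: lerD; last by rewrite normrM ler_pM.
  by rewrite normrN normrM ler_pM.
Qed.

Let fR_int : leb.-integrable `[b, +oo[ (EFin \o fR).
Proof.
apply: (@le_integrable_EFin R _ _ leb _ _
  (fun z => (gauss_bound t * expR a) * (2 * c0 + 4 * c1) * expR (- z))) => //.
- by apply: measurable_funTS; exact: continuous_measurable_fun.
- apply: integrableZl_EFin => //; apply: integrableS (@integrable_expRN R) => //.
  by apply: subset_itvr; rewrite bnd_simp ltW.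
- by move=> z /=; rewrite in_itv/= andbT => bz; have [] := fR_le bz.
Qed.

Let right_part : \int[leb]_(z in `[b, +oo[) fR z = - FR b.
Proof.
rewrite (Rintegral_FTC2y cfR is_derive_FR fR_int (l := 0)) ?sub0r//.
by apply: (@cvg_dom_expRN_ge _ _ b) => z bz; have [_] := fR_le bz; exact.
Qed.

Let left_part : \int[leb]_(z in `[0, b]) fL z = FL b - FL 0 + 2 * \int[leb]_(z in `[0, b]) tail z.
Proof.
have i1 := integrable_segment 0 b ctail.
have i2 : leb.-integrable `[0, b] (EFin \o (fun z => 2 * tail z)).
  by apply: integrableZl_EFin i1; exact: measurable_itv.
have cF : continuous (fun z => fL z - 2 * tail z) by rewrite /fL /tail /C /C'; cont'.
rewrite -RintegralZl// -(Rintegral_FTC2 (ltW y0) cF is_derive_FL).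
rewrite -RintegralD//; last exact: integrable_segment.
by apply: eq_Rintegral => z _; rewrite subrK.
Qed.

(** Only boundary values of the primitives and the tail remain. [FL] vanishes at 0; at b the terms
    with C (b + b) from the two sides cancel, and C 0 = [gauss t xi] produces the Dirichlet heat
    kernel. *)
Lemma vort_kernelE : vort_kernel t x y =
  gauss t xi * (gauss t (a - b) - gauss t (a + b)) +
  2 * \int[leb]_(z in `[0, b]) (dgauss t (a + z) * Ccos 0 t (b - z) xi).
Proof.
have i0 := integrable_V0 (u := fun i z => Kgreen i z y) t0 x0 (integrable_wKgreen 0 y).
have i1 := integrable_V1 (u := fun i z => Kgreen i z y) x t0 (integrable_wKgreen 1 y).
pose f0 (z1 z2 : R) := V0 t x (z1, z2) * Kgreen 0 (z1, z2) y.
pose f1 (z1 z2 : R) := V1 t x (z1, z2) * Kgreen 1 (z1, z2) y.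
have j0 : (leb \x leb)%E.-integrable (setT `*` `]0, +oo[) (EFin \o (fun p => f0 p.1 p.2)).
  by rewrite -half_planeE; apply: eq_integrable i0; [exact: measurable_half_plane|case].
have j1 : (leb \x leb)%E.-integrable (setT `*` `]0, +oo[) (EFin \o (fun p => f1 p.1 p.2)).
  by rewrite -half_planeE; apply: eq_integrable i1; [exact: measurable_half_plane|case].
have mI : measurable (`]0, +oo[ : set (measurableTypeR R)) by exact: measurable_itv.
have k0 := integrable_Rintegral_param (f := fun z2 z1 : measurableTypeR R => f0 z1 z2) mI measurableT (integrable_prod_swap measurableT mI j0).
have k1 := integrable_Rintegral_param (f := fun z2 z1 : measurableTypeR R => f1 z1 z2) mI measurableT (integrable_prod_swap measurableT mI j1).
pose h z2 : R := \int[leb]_z1 f0 z1 z2 + \int[leb]_z1 f1 z1 z2.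
have hi : leb.-integrable `]0, +oo[ (EFin \o h) by exact: integrableD_EFin.
have -> : vort_kernel t x y = \int[leb]_(z2 in `]0, +oo[) h z2.
  rewrite /h RintegralD// -(Rintegral_prod21 measurableT mI j0) -(Rintegral_prod21 measurableT mI j1).
  rewrite /vort_kernel half_planeE.
  by congr (_ + _); apply: eq_Rintegral => -[].
have hE (z : R) : 0 < z -> z != b -> h z = inner z by exact: innerE.
have hL (z : R) : 0 < z -> z < b -> h z = fL z.
  move=> z0 zb; have e1 : Num.sg (z - b) = -1 by rewrite ltr0_sg// subr_lt0.
  have e2 : `|z - b| = b - z by rewrite ltr0_norm ?opprB// subr_lt0.
  have zb' : z != b by rewrite lt_eqF.
  by rewrite (hE z z0 zb') /inner e1 e2 mulN1r mulN1r.
have hR (z : R) : b < z -> h z = fR z.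
  move=> bz; have e1 : Num.sg (z - b) = 1 by rewrite gtr0_sg// subr_gt0.
  have e2 : `|z - b| = z - b by rewrite gtr0_norm// subr_gt0.
  have zb' : z != b by rewrite gt_eqF.
  by rewrite (hE z (lt_trans y0 bz) zb') /inner e1 e2 mul1r mul1r.
have s1 : \int[leb]_(z in `]0, b]) h z = \int[leb]_(z in `[0, b]) fL z.
  rewrite -Rintegral_itv_bndo_bndc; last first.
    by apply: integrableS hi => //; apply: subset_itvl.
  rewrite -Rintegral_itv_obnd_cbnd; last first.
    by apply: integrableS (integrable_segment 0 b cfL) => //; apply: subset_itvr; rewrite bnd_simp.
  rewrite -[RHS]Rintegral_itv_bndo_bndc; last first.
    apply: integrableS (integrable_segment 0 b cfL) => //.
    by apply: subset_itv; rewrite bnd_simp.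
  by apply: eq_Rintegral => z; rewrite inE/= in_itv/= => /andP[]; exact: hL.
have s2 : \int[leb]_(z in `]b, +oo[) h z = \int[leb]_(z in `[b, +oo[) fR z.
  rewrite -[RHS]Rintegral_itv_obnd_cbnd; last first.
    by apply: integrableS fR_int => //; apply: subset_itvr; rewrite bnd_simp.
  by apply: eq_Rintegral => z; rewrite inE/= in_itv/= andbT; exact: hR.
have := Rintegral_itvB (x := b) hi; rewrite !bnd_simp => /(_ (ltW y0) isT).
rewrite s1 s2 => /eqP; rewrite subr_eq => /eqP ->.
rewrite right_part left_part /FL /FR /tail.
have C0 : C 0 = gauss t xi by rewrite /C Ccos_gauss.
rewrite (subrr b) (subr0 a) (subr0 b) (addr0 a) (add0r b) C0.
move: (gauss t (a - b)) (gauss t (a + b)) (C (b + b)) (gauss t xi) (gauss t a) (C b) => g1 g2 c2 g3 g4 c3.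
by rewrite /C; field.
Qed.

End formula.
End vorticity_kernel.

(** * Estimates for the one-dimensional kernels *)

Section kernel_bounds.
Context {R : realType}.
Notation leb := (@lebesgue_measure R).
Implicit Types (t : R).

(** A bound of order 1 / t, written with [gauss t 0] because the later estimates are homogeneous in
    it. The factor 4 comes from sqrt pi <= 2, by which 1 / sqrt t is at most 4 [gauss t 0]. *)
Lemma dgauss_le t r : 0 < t -> `|dgauss t r| <= 4 * gauss t 0 ^+ 2.
Proof.
move=> t0; rewrite /dgauss normrM normrN (ger0_norm (gauss_ge0 _ _)).
have s0 : 0 < Num.sqrt t by rewrite sqrtr_gt0.
have tE : t = Num.sqrt t ^+ 2 by rewrite sqr_sqrtr// ltW.
set s := Num.sqrt t in s0 tE.
have g1 : s^-1 <= 4 * gauss t 0.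
  have pi4 : Num.sqrt pi <= 2 :> R.
    have -> : 2 = Num.sqrt (2 ^+ 2) :> R by rewrite sqrtr_sqr ger0_norm.
    by rewrite ler_sqrt ?exprn_gt0//; have := pihalf_lt2 R; lra.
  have p0 : 0 < Num.sqrt pi :> R by rewrite sqrtr_gt0 pi_gt0.
  have -> : gauss t 0 = 2^-1 * ((Num.sqrt pi)^-1 * s^-1).
    rewrite gauss0 !sqrtrM ?mulr_ge0 ?pi_ge0// -/s !invfM -mulrA; congr (_ * _).
    by have -> : 4 = 2 ^+ 2 :> R; [ring|rewrite sqrtr_sqr ger0_norm].
  have p1 : 2^-1 <= (Num.sqrt pi)^-1 :> R by rewrite lef_pV2 ?posrE.
  have si : 0 <= s^-1 by rewrite invr_ge0 ltW.
  have := ler_wpM2r si p1; lra.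
have -> : gauss t r = gauss t 0 * expR (- (r ^+ 2 / (4 * t))) by rewrite gauss0.
rewrite mulrCA [leRHS](_ : _ = gauss t 0 * (4 * gauss t 0)); last by ring.
rewrite ler_wpM2l ?gauss_ge0//.
apply: le_trans g1; rewrite expRN ler_pdivrMr ?expR_gt0//.
apply: (@le_trans _ _ (s^-1 * (1 + r ^+ 2 / (4 * t)))); last first.
  by rewrite ler_wpM2l ?expR_ge1Dx// invr_ge0 ltW.
rewrite normrM (ger0_norm (x := (2 * t)^-1)) ?invr_ge0 ?mulr_ge0 ?(ltW t0)//.
have -> : r ^+ 2 = `|r| ^+ 2 by rewrite real_normK ?num_real.
rewrite tE; set a := `|r|.
(* After exp(u) >= 1 + u, the claim is that this expression exceeds a / (2 s^2); the excess is
   displayed as a square plus a nonnegative term. *)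
have -> : s^-1 * (1 + a ^+ 2 / (4 * s ^+ 2)) =
   a / (2 * s ^+ 2) + s^-1 * ((1 - a / (2 * s)) ^+ 2 + a / (2 * s)).
  by field; rewrite gt_eqF.
rewrite lerDl mulr_ge0 ?invr_ge0 ?(ltW s0)// addr_ge0 ?sqr_ge0//.
by rewrite divr_ge0 ?normr_ge0// mulr_ge0// ltW.
Qed.

Lemma gauss_lipschitz t p q : 0 < t ->
  `|gauss t p - gauss t q| <= 4 * gauss t 0 ^+ 2 * `|p - q|.
Proof.
move=> t0; wlog pq : p q / q <= p.
  move=> W; have [/W//|/ltW/W] := leP q p.
  by rewrite distrC (distrC q).
have cg : {within `[q, p], continuous (gauss t)}.
  by apply: continuous_subspaceT => x; exact: continuous_gauss.
have [c _ ->] := MVT_segment pq (fun x _ => is_derive_gauss t0 x) cg.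
by rewrite normrM ler_wpM2r// dgauss_le.
Qed.

Lemma gauss_le_norm t p q : 0 < t -> `|p| <= `|q| -> gauss t q <= gauss t p.
Proof.
move=> t0 pq; rewrite /gauss ler_wpM2l ?invr_ge0 ?sqrtr_ge0// ler_expR lerN2.
have qE : q ^+ 2 = `|q| ^+ 2 by rewrite real_normK ?num_real.
have pE : p ^+ 2 = `|p| ^+ 2 by rewrite real_normK ?num_real.
rewrite qE pE ler_wpM2r ?invr_ge0 ?mulr_ge0 ?(ltW t0)//.
by rewrite lerXn2r ?nnegrE.
Qed.

(** The total variation of a function that rises from 0 to [gauss t 0] and falls back to 0; computed
    here from the first moment. *)
Lemma integral_norm_dgauss t : 0 < t ->
  (\int[leb]_v `|dgauss t v|%:E = (2 * gauss t 0)%:E)%E.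
Proof.
move=> t0; have [i e] := Rintegral_abs_gauss t0.
have dE v : `|dgauss t v| = (2 * t)^-1 * (`|v| * gauss t v).
  rewrite /dgauss normrM normrN normrM (ger0_norm (gauss_ge0 _ _)).
  by rewrite (ger0_norm (x := (2 * t)^-1)) ?invr_ge0 ?mulr_ge0 ?(ltW t0)//; ring.
have i' := integrableZl_EFin (2 * t)^-1 measurableT i.
under eq_integral do rewrite dE.
have <- : \int[leb]_v ((2 * t)^-1 * (`|v| * gauss t v)) = 2 * gauss t 0.
  by rewrite RintegralZl// e; field; rewrite gt_eqF.
by rewrite /Rintegral fineK//; exact: integrable_fin_num i'.
Qed.

Lemma ge0_integral_shift (f : R -> R) s : measurable_fun setT f ->
  (forall x, 0 <= f x) -> (forall x, f (- x) = f x) ->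
  (\int[leb]_x (f (x + s))%:E = \int[leb]_x (f x)%:E)%E.
Proof.
move=> mf f0 fN; rewrite -(@ge0_integral_reflect _ (EFin \o f) (- s)).
- by apply: eq_integral => x _ /=; rewrite -fN opprD addrC.
- exact/measurable_EFinP.
- by move=> x; rewrite lee_fin.
Qed.

Lemma integral_gauss_shift t s : 0 < t -> (\int[leb]_x (gauss t (x + s))%:E = 1)%E.
Proof.
move=> t0; rewrite (@ge0_integral_shift (gauss t) s) ?integral_gauss//.
- exact: measurable_gauss.
- by move=> x; rewrite gauss_ge0.
- by move=> x; rewrite gaussN.
Qed.

(** The increment is an integral of [dgauss] over [c, d]; Tonelli and translation invariance then
    give the length d - c times the total variation. *)
Lemma integral_gauss_incr t c d : 0 < t -> c <= d ->
  (\int[leb]_a `|gauss t (a + d) - gauss t (a + c)|%:E <= ((d - c) * (2 * gauss t 0))%:E)%E.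
Proof.
move=> t0 cd.
have mf : measurable_fun setT (fun p : measurableTypeR R * measurableTypeR R => `|dgauss t (p.1 + p.2)|).
  by rewrite /dgauss /gauss; meas.
apply: (@le_trans _ _ (\int[leb]_a \int[leb]_(s in `[c, d]) `|dgauss t (a + s)|%:E)%E).
  apply: ge0_le_integral => //.
  - by apply/measurable_EFinP; rewrite /gauss; meas.
  - by apply: (measurable_integral_param leb (f := fun a s : measurableTypeR R => `|dgauss t (a + s)|)).
  move=> a _.
  have cf : continuous (fun s => dgauss t (a + s)) by cont'.
  have dF (s : R) : is_derive s 1 (fun s => gauss t (a + s)) (dgauss t (a + s)).
    by deriv'; ring.
  rewrite -(Rintegral_FTC2 cd cf dF).
  have i := integrable_segment c d cf.
  rewrite /Rintegral -abse_EFin fineK; last exact: integrable_fin_num i.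
  by apply: (le_trans (le_abse_integral _ _ (measurable_int _ i))).
rewrite (ge0_integral_swap leb leb (f := fun a s : measurableTypeR R => `|dgauss t (a + s)|))//.
rewrite (eq_integral (fun=> (2 * gauss t 0)%:E)); last first.
  move=> s _; rewrite (@ge0_integral_shift (fun x => `|dgauss t x|) s)//.
  - exact: integral_norm_dgauss.
  - by rewrite /dgauss /gauss; meas.
  - by move=> x; rewrite dgaussN normrN.
rewrite integral_cst//= lebesgue_measure_itv/= lte_fin.
case: ltP => _; last by rewrite mule0 lee_fin mulr_ge0 ?subr_ge0// mulr_ge0 ?gauss_ge0.
by rewrite -EFinB -EFinM mulrC.
Qed.

(** Positivity is invisible in the oscillating integral, but [gauss_conv_pk] exhibits [Ccos 0] as a
    convolution of two nonnegative kernels. In the same way [integral_Ccos0] convolves two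
    probability densities. *)
Lemma Ccos0_ge0 t s x : 0 < t -> 0 <= s -> 0 <= Ccos 0 t s x.
Proof.
move=> t0; rewrite le_eqVlt => /predU1P[<-|s0]; first by rewrite Ccos_gauss ?gauss_ge0.
rewrite -(subr0 x) -gauss_conv_pk//; apply: Rintegral_ge0 => z _.
by rewrite mulr_ge0 ?gauss_ge0 ?pk_ge0// ltW.
Qed.

Lemma integral_Ccos0 t s c : 0 < t -> 0 <= s ->
  (\int[leb]_x (Ccos 0 t s (x - c))%:E = 1)%E.
Proof.
move=> t0; rewrite le_eqVlt => /predU1P[<-|s0].
  by under eq_integral do rewrite Ccos_gauss//; exact: integral_gauss_shift.
have mf : measurable_fun setT (fun p : measurableTypeR R * measurableTypeR R =>
    gauss t (p.1 - p.2) * pk s (p.2 - c)) by rewrite /gauss /pk; meas.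
have f0 (x z : R) : 0 <= gauss t (x - z) * pk s (z - c) by rewrite mulr_ge0 ?gauss_ge0 ?pk_ge0// ltW.
transitivity (\int[leb]_x \int[leb]_z (gauss t (x - z) * pk s (z - c))%:E)%E.
  apply: eq_integral => x _; rewrite -gauss_conv_pk// /Rintegral fineK//.
  apply: (@integrable_fin_num _ _ _ leb setT) => //.
  apply: (@le_integrable_EFin R _ _ leb _ _ (fun z1 => s^-1 * gauss t (x - z1))) => //.
  - by rewrite /gauss /pk; meas.
  - by apply: integrableZl_EFin => //; exact: integrable_reflect (integrable_gauss t0).
  - by move=> z _; rewrite normrM mulrC (ger0_norm (gauss_ge0 _ _)) ler_wpM2r ?gauss_ge0 ?norm_pk_le2.
rewrite (ge0_integral_swap leb leb (f := fun x z : measurableTypeR R => gauss t (x - z) * pk s (z - c)))//.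
transitivity (\int[leb]_z (pk s (z - c))%:E)%E; last first.
  rewrite (@ge0_integral_shift (pk s) (- c)) ?integral_pk//.
  - exact: measurable_pk1.
  - by move=> x; rewrite pk_ge0// ltW.
  - by move=> x; rewrite pkNr.
apply: eq_integral => z _; under eq_integral do rewrite mulrC EFinM.
rewrite ge0_integralZl//.
- by rewrite integral_gauss_shift// mule1.
- by apply/measurable_EFinP; rewrite /gauss; meas.
- by move=> x _; rewrite lee_fin gauss_ge0.
- by rewrite lee_fin pk_ge0// ltW.
Qed.

End kernel_bounds.

Section plane_measure.
Context {R : realType}.
Notation leb := (@lebesgue_measure R).

(* [lebesgue2] under another head symbol, so that sigma-finiteness can be
   attached to it. *)
Definition plane_lebesgue : set (plane R) -> \bar R := @lebesgue2 R.

HB.instance Definition _ := Measure.on plane_lebesgue.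

Let sigma_finite_plane : sigma_finite setT plane_lebesgue.
Proof.
have /sigma_finiteP[F [TF ndF Foo]] := sigma_finiteT leb.
exists (fun n => F n `*` F n).
  rewrite -setXTT {1 2}TF predeqE => -[a b]; split.
    move=> [/= [n _ Fn] [k _ Fk]]; exists (maxn n k) => //; split.
    - by move: a Fn; exact/subsetPset/ndF/leq_maxl.
    - by move: b Fk; exact/subsetPset/ndF/leq_maxr.
  by move=> [n _ []/= ? ?]; split; exists n.
move=> n; have [mF fF] := Foo n; split; first exact: measurableX.
by rewrite /plane_lebesgue /lebesgue2/= product_measure1E// lte_mul_pinfty// ge0_fin_numE.
Qed.

HB.instance Definition _ :=
  Measure_isSigmaFinite.Build _ _ _ plane_lebesgue sigma_finite_plane.

End plane_measure.

(** * Sup and L^1 bounds on the vorticity kernel *)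

Section vorticity_kernel_bounds.
Context {R : realType}.
Notation leb := (@lebesgue_measure R).
Notation leb2 := (@lebesgue2 R).
Notation H := (@half_plane R).
Implicit Types (t : R).

Lemma measurable_Kgreen_comp i d (T : measurableType d) (f g : T -> plane R) :
  measurable_fun setT f -> measurable_fun setT g ->
  measurable_fun setT (fun p => Kgreen i (f p) (g p)).
Proof.
by move=> mf mg; exact: (measurableT_comp (measurable_Kgreen i) (measurable_fun_pair mf mg)).
Qed.

(** Proved from the defining integrals, as the closed form [vort_kernelE] is available only for
    points of the open half plane. *)
Lemma measurable_vort_kernel t :
  measurable_fun setT (fun p : plane R * plane R => vort_kernel t p.1 p.2).
Proof.
apply: measurable_funD.
- apply: (@measurable_Rintegral_param R _ _ _ _ (@plane_lebesgue R) H
    (fun (p : plane R * plane R) z => V0 t p.1 z * Kgreen 0 z p.2)).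
    exact: measurable_half_plane.
  apply: measurable_funM.
    apply: measurable_funB; first by rewrite /dgauss /gauss; meas.
    apply: measurable_funM; first by rewrite /gauss; meas.
    by apply: measurable_Ccos_comp; meas.
  by apply: measurable_Kgreen_comp; meas.
- apply: (@measurable_Rintegral_param R _ _ _ _ (@plane_lebesgue R) H
    (fun (p : plane R * plane R) z => V1 t p.1 z * Kgreen 1 z p.2)).
    exact: measurable_half_plane.
  apply: measurable_funM; first by rewrite /V1 /dgauss /gauss; meas.
  by apply: measurable_Kgreen_comp; meas.
Qed.

Lemma measurable_vort_kernel1 t y :
  measurable_fun setT (fun x : plane R => vort_kernel t x y).
Proof.
exact: (measurableT_comp (measurable_vort_kernel t)
  (measurable_fun_pair (@measurable_id _ _ _) (measurable_cst y))).
Qed.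

(** The second argument is of order b / sqrt t. Its 8 is the 4 of [gauss_lipschitz] times the
    distance 2 b between a - b and a + b, with one factor [gauss t 0] split off. *)
Definition kappa t b : R := Num.min 1 (8 * b * gauss t 0).

Section fixed.
Variables (t b : R).
Hypotheses (t0 : 0 < t) (b0 : 0 < b).
Let g0 := gauss t 0.
Let g0_ge0 : 0 <= g0. Proof. exact: gauss_ge0. Qed.

Let D1 a : R := gauss t (a - b) - gauss t (a + b).
Let D2 a : R := gauss t a - gauss t (a + b).

Let le_kappa v : v <= g0 -> v <= 8 * b * g0 ^+ 2 -> v <= g0 * kappa t b.
Proof.
move=> v1 v2; rewrite /kappa -/g0 minr_pMr// mulr1 le_min v1/=.
by rewrite [leRHS](_ : _ = 8 * b * g0 ^+ 2)//; ring.
Qed.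

Let D1_ge0 (a : R) : 0 < a -> 0 <= D1 a.
Proof.
move=> a0; rewrite subr_ge0 gauss_le_norm//.
by rewrite [leRHS]ger0_norm ?addr_ge0 ?(ltW a0) ?(ltW b0)// ler_norml; apply/andP; split; [lra|by rewrite lerD2l ge0_cp ?ltW].
Qed.

Let D2_ge0 (a : R) : 0 < a -> 0 <= D2 a.
Proof.
move=> a0; rewrite subr_ge0 gauss_le_norm//.
by rewrite !ger0_norm ?addr_ge0 ?(ltW a0) ?(ltW b0)// lerDl ltW.
Qed.

Let D1_le (a : R) : 0 < a -> D1 a <= g0 * kappa t b.
Proof.
move=> a0; apply: le_kappa.
  by rewrite /D1 (le_trans _ (gauss_le t0 (a - b)))// lerBlDr lerDl gauss_ge0.
apply: (le_trans (ler_norm _)); apply: (le_trans (gauss_lipschitz _ _ t0)).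
rewrite -/g0 (_ : a - b - (a + b) = - (2 * b)); last by ring.
rewrite normrN gtr0_norm ?mulr_gt0// le_eqVlt; apply/orP; left; apply/eqP; ring.
Qed.

Let D2_le (a : R) : 0 < a -> D2 a <= g0 * kappa t b.
Proof.
move=> a0; apply: le_kappa.
  by rewrite /D2 (le_trans _ (gauss_le t0 a))// lerBlDr lerDl gauss_ge0.
apply: (le_trans (ler_norm _)); apply: (le_trans (gauss_lipschitz _ _ t0)).
rewrite -/g0 (_ : a - (a + b) = - b); last by ring.
rewrite normrN gtr0_norm// -mulrA [leRHS](_ : _ = 4 * (g0 ^+ 2 * b) + 4 * (g0 ^+ 2 * b)); last by ring.
by rewrite lerDl !mulr_ge0 ?sqr_ge0// ltW.
Qed.

(** For a > 0 and s >= 0 this is the absolute value of [dgauss], so the tail is controlled by an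
    integral with an exact value, [D2]. *)
Let ndg a s := - dgauss t (a + s).

Let ndg_ge0 (a s : R) : 0 < a -> 0 <= s -> 0 <= ndg a s.
Proof.
move=> a0 s0; rewrite /ndg /dgauss mulNr opprK mulr_ge0 ?gauss_ge0// divr_ge0 ?mulr_ge0 ?(ltW t0)//.
by rewrite addr_ge0// ltW.
Qed.

Let Rintegral_ndg (a : R) : \int[leb]_(s in `[0, b]) ndg a s = D2 a.
Proof.
have cf : continuous (ndg a) by rewrite /ndg; cont'.
have dF (s : R) : is_derive s 1 (fun s => - gauss t (a + s)) (ndg a s).
  by rewrite /ndg; deriv'; ring.
by rewrite (Rintegral_FTC2 (ltW b0) cf dF) /D2 addr0; ring.
Qed.

Let integrable_ndg (a : R) : leb.-integrable `[0, b] (EFin \o ndg a).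
Proof. by apply: integrable_segment; rewrite /ndg; cont'. Qed.

Let tail a xi : R := \int[leb]_(z in `[0, b]) (dgauss t (a + z) * Ccos 0 t (b - z) xi).

Let mtail (a xi : R) : measurable_fun setT (fun z : R => dgauss t (a + z) * Ccos 0 t (b - z) xi).
Proof.
apply: measurable_funM; first by rewrite /dgauss /gauss; meas.
by apply: measurable_Ccos_comp; meas.
Qed.

Let tail_dom (a xi z : R) : 0 < a -> `[0, b]%classic z ->
  `|dgauss t (a + z) * Ccos 0 t (b - z) xi| <= g0 * ndg a z.
Proof.
move=> a0; rewrite /= in_itv/= => /andP[z0 zb].
rewrite normrM mulrC -(normrN (dgauss _ _)) (ger0_norm (ndg_ge0 a0 z0)) ler_wpM2r ?ndg_ge0//.
by rewrite /g0 -Ccos00// Ccos_bound// subr_ge0.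
Qed.

Let tail_le (a xi : R) : 0 < a -> `|tail a xi| <= g0 * (g0 * kappa t b).
Proof.
move=> a0; apply: (@le_trans _ _ (\int[leb]_(z in `[0, b]) (g0 * ndg a z))).
  apply: le_normr_Rintegral_dom => //.
  - by apply: measurable_funTS; exact: mtail.
  - by apply: integrableZl_EFin (integrable_ndg a); exact: measurable_itv.
  - by move=> z; exact: tail_dom.
rewrite (RintegralZl _ _ (integrable_ndg a)); last exact: measurable_itv.
by rewrite Rintegral_ndg ler_wpM2l// D2_le.
Qed.

(** The factor 3 counts the heat kernel part once and the tail, which carries a factor 2, twice; in
    both, the function of x.1 - y.1 is at most [gauss t 0]. *)
Lemma norm_vort_kernel_le (x y : R * R) : y.2 = b -> 0 < x.2 ->
  `|vort_kernel t x y| <= 3 * g0 ^+ 2 * kappa t b.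
Proof.
move=> yb x0; rewrite vort_kernelE ?yb//.
apply: (le_trans (ler_normD _ _)).
rewrite [leRHS](_ : _ = g0 * (g0 * kappa t b) + 2 * (g0 * (g0 * kappa t b))); last by ring.
apply: lerD.
  rewrite normrM (ger0_norm (gauss_ge0 _ _)) (ger0_norm (D1_ge0 x0)).
  by rewrite ler_pM ?gauss_ge0 ?gauss_le ?D1_ge0 ?D1_le.
by rewrite normrM ger0_norm// ler_wpM2l// tail_le.
Qed.

(** Integrated in x.1 first, [gauss] and [Ccos 0] have mass 1, which leaves [D1] + 2 [D2] as a
    function of the height a. *)
Lemma integral_norm_vort_kernel_le (y : R * R) : y.2 = b ->
  (\int[leb2]_(x in H) `|vort_kernel t x y|%:E <= (3 * kappa t b)%:E)%E.
Proof.
move=> yb.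
have mW : measurable_fun setT (fun x : plane R => `|vort_kernel t x y|).
  apply: measurable_fun_norm.
  exact: measurable_vort_kernel1.
rewrite ge0_integral_half_plane21//.
pose T a (x1 z : R) : R := `|dgauss t (a + z) * Ccos 0 t (b - z) (x1 - y.1)|.
have T0 a x1 z : 0 <= T a x1 z by exact: normr_ge0.
have mT a : measurable_fun setT (fun p : measurableTypeR R * measurableTypeR R => T a p.1 p.2).
  apply: measurable_fun_norm; apply: measurable_funM; first by rewrite /dgauss /gauss; meas.
  by apply: measurable_Ccos_comp; meas.
have mT' a x1 : measurable_fun setT (fun z : measurableTypeR R => T a x1 z).
  by apply: measurable_fun_norm; exact: mtail.
have inner (a : R) : 0 < a -> (\int[leb]_x1 `|vort_kernel t (x1, a) y|%:E <= (D1 a + 2 * D2 a)%:E)%E.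
  move=> a0.
  have m1 : measurable_fun setT (fun x1 : measurableTypeR R => (D1 a * gauss t (x1 - y.1))%:E).
    by apply/measurable_EFinP; rewrite /gauss; meas.
  have m2 : measurable_fun setT (fun x1 : measurableTypeR R => \int[leb]_(z in `[0%R, b]) (T a x1 z)%:E)%E.
    by apply: (measurable_integral_param leb (f := fun x1 z : measurableTypeR R => T a x1 z)).
  have m3 : measurable_fun setT (fun x1 : measurableTypeR R => 2%:E * \int[leb]_(z in `[0%R, b]) (T a x1 z)%:E)%E.
    exact: emeasurable_funM.
  have n2 (x1 : R) : (0 <= \int[leb]_(z in `[0%R, b]) (T a x1 z)%:E)%E.
    by apply: integral_ge0 => z _; rewrite lee_fin.
  apply: (@le_trans _ _ (\int[leb]_x1 ((D1 a * gauss t (x1 - y.1))%:E +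
     2%:E * \int[leb]_(z in `[0%R, b]) (T a x1 z)%:E))%E).
    apply: ge0_le_integral => //.
    - apply/measurable_EFinP.
      exact: (measurableT_comp mW (measurable_fun_pair (@measurable_id _ (measurableTypeR R) setT) (measurable_cst (a : measurableTypeR R)))).
    - exact: emeasurable_funD.
    - move=> x1 _; rewrite vort_kernelE ?yb//=.
      apply: (@le_trans _ _ (`|gauss t (x1 - y.1) * D1 a|%:E + `|2 * tail a (x1 - y.1)|%:E)%E).
        by rewrite -EFinD lee_fin ler_normD.
      apply: leeD.
        by rewrite lee_fin mulrC ger0_norm// mulr_ge0 ?gauss_ge0 ?D1_ge0.
      rewrite normrM ger0_norm// EFinM lee_wpmul2l//.
      have i : leb.-integrable `[0, b] (EFin \o (fun z => dgauss t (a + z) * Ccos 0 t (b - z) (x1 - y.1))).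
        apply: (@le_integrable_EFin R _ _ leb _ _ (fun z => g0 * ndg a z)) => //.
        - by apply: measurable_funTS; exact: mtail.
        - by apply: integrableZl_EFin (integrable_ndg a); exact: measurable_itv.
        - by move=> z; exact: tail_dom.
      rewrite /tail /Rintegral -abse_EFin fineK; last exact: integrable_fin_num i.
      by apply: (le_trans (le_abse_integral _ _ (measurable_int _ i))).
  rewrite ge0_integralD//; first last.
  - by move=> x1 _; apply: mule_ge0.
  - by move=> x1 _; rewrite lee_fin mulr_ge0 ?gauss_ge0 ?D1_ge0.
  rewrite [leRHS]EFinD; apply: leeD.
    under eq_integral do rewrite EFinM.
    rewrite ge0_integralZl//.
    - by rewrite integral_gauss_shift// mule1.
    - by apply/measurable_EFinP; rewrite /gauss; meas.
    - by move=> x _; rewrite lee_fin gauss_ge0.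
    - by rewrite lee_fin D1_ge0.
  rewrite ge0_integralZl// EFinM lee_wpmul2l//.
  rewrite (ge0_integral_swap leb leb (f := fun x1 z : measurableTypeR R => T a x1 z))//.
  rewrite -Rintegral_ndg /Rintegral fineK; last exact: integrable_fin_num (integrable_ndg a).
  apply: ge0_le_integral; first exact: measurable_itv.
  - by move=> z _; apply: integral_ge0 => x1 _; rewrite lee_fin.
  - apply: measurable_funTS.
    apply: (measurable_fun_fubini_tonelli_G (m1 := leb) (fun p : plane R => (T a p.1 p.2)%:E)).
      exact/measurable_EFinP.
    by move=> p; rewrite lee_fin.
  - by apply/measurable_EFinP; rewrite /ndg /dgauss /gauss; meas.
  move=> z; rewrite /= in_itv/= => /andP[z0 zb].
  have TE x1 : T a x1 z = ndg a z * Ccos 0 t (b - z) (x1 - y.1).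
    rewrite /T normrM -(normrN (dgauss _ _)) (ger0_norm (ndg_ge0 a0 z0)).
    by rewrite ger0_norm// Ccos0_ge0// subr_ge0.
  under eq_integral do rewrite TE EFinM.
  rewrite ge0_integralZl//.
  - by rewrite integral_Ccos0 ?subr_ge0// mule1.
  - by apply/measurable_EFinP; apply: measurable_Ccos_comp; meas.
  - by move=> x _; rewrite lee_fin Ccos0_ge0// subr_ge0.
  - by rewrite lee_fin ndg_ge0.
apply: (@le_trans _ _ (\int[leb]_(a in `]0%R, +oo[) (D1 a + 2 * D2 a)%:E)%E).
  apply: ge0_le_integral => //.
  - by move=> a _; apply: integral_ge0 => x1 _; rewrite lee_fin.
  - apply: measurable_funTS.
    apply: (measurable_fun_fubini_tonelli_G (m1 := leb) (fun p : plane R => `|vort_kernel t p y|%:E)).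
      exact/measurable_EFinP.
    by move=> p; rewrite lee_fin.
  - by apply/measurable_EFinP; rewrite /D1 /D2 /gauss; meas.
  - by move=> a; rewrite /= in_itv/= andbT; exact: inner.
have dom (F : R -> R) : measurable_fun setT F -> (forall a, 0 <= F a) ->
    (forall a : R, 0 < a -> D1 a + 2 * D2 a <= F a) ->
    (\int[leb]_(a in `]0%R, +oo[) (D1 a + 2 * D2 a)%:E <= \int[leb]_a (F a)%:E)%E.
  move=> mF F0 leF; apply: (@le_trans _ _ (\int[leb]_(a in `]0%R, +oo[) (F a)%:E)%E).
    apply: ge0_le_integral => //.
    - move=> a; rewrite /= in_itv/= andbT => a0.
      by rewrite lee_fin addr_ge0 ?D1_ge0// mulr_ge0// D2_ge0.
    - by apply/measurable_EFinP; rewrite /D1 /D2 /gauss; meas.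
    - by apply/measurable_EFinP; exact: measurable_funTS.
    - by move=> a; rewrite /= in_itv/= andbT => a0; rewrite lee_fin leF.
  apply: ge0_subset_integral => //; first exact/measurable_EFinP.
  by move=> a _; rewrite lee_fin.
(* One estimate for each argument of the minimum: dropping the subtracted Gaussians leaves the mass
   1 + 2 = 3, while [integral_gauss_incr] gives 4 b + 4 b times [gauss t 0], below the required 24 b
   [gauss t 0]. *)
rewrite /kappa minr_pMr// mulr1 minElt; case: ifP => _.
- apply: le_trans; first apply: (dom (fun a : R => gauss t (a - b) + 2 * gauss t a)).
  + by rewrite /gauss; meas.
  + by move=> a; rewrite addr_ge0 ?gauss_ge0// mulr_ge0 ?gauss_ge0.
  + move=> a _; rewrite /D1 /D2; have := gauss_ge0 t (a + b); lra.
  under eq_integral do rewrite EFinD.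
  rewrite ge0_integralD//.
  + rewrite integral_gauss_shift//; under eq_integral do rewrite EFinM.
    rewrite ge0_integralZl//.
    * by rewrite integral_gauss// mule1 -EFinD lee_fin; lra.
    * by apply/measurable_EFinP; rewrite /gauss; meas.
    * by move=> x _; rewrite lee_fin gauss_ge0.
  + by move=> x _; rewrite lee_fin gauss_ge0.
  + by apply/measurable_EFinP; rewrite /gauss; meas.
  + by move=> x _; rewrite lee_fin mulr_ge0 ?gauss_ge0.
  + by apply/measurable_EFinP; rewrite /gauss; meas.
- apply: le_trans; first apply: (dom (fun a : R =>
    `|gauss t (a + b) - gauss t (a - b)| + 2 * `|gauss t (a + b) - gauss t (a + 0)|)).
  + by rewrite /gauss; meas.
  + by move=> a; rewrite addr_ge0// mulr_ge0.
  + move=> a _; rewrite lerD// ?ler_wpM2l// /D1 /D2 ?addr0 distrC; exact: ler_norm.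
  under eq_integral do rewrite EFinD.
  rewrite ge0_integralD//.
  + apply: (@le_trans _ _ ((4 * b * gauss t 0)%:E + 2%:E * (2 * b * gauss t 0)%:E)%E); last first.
      rewrite -EFinM -EFinD lee_fin.
      have : 0 <= b * gauss t 0 by rewrite mulr_ge0 ?gauss_ge0// ltW.
      move: (gauss t 0) => g h; lra.
    apply: leeD.
      apply: (le_trans (@integral_gauss_incr _ _ (- b) b t0 _)).
        by rewrite ge0_cp// ltW.
      by rewrite lee_fin le_eqVlt; apply/orP; left; apply/eqP; ring.
    under eq_integral do rewrite EFinM.
    rewrite ge0_integralZl//.
      apply: lee_wpmul2l => //.
      apply: (le_trans (@integral_gauss_incr _ _ 0 b t0 (ltW b0))).
      by rewrite lee_fin le_eqVlt; apply/orP; left; apply/eqP; ring.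
    by apply/measurable_EFinP; rewrite /gauss; meas.
  + by apply/measurable_EFinP; rewrite /gauss; meas.
  + by apply/measurable_EFinP; rewrite /gauss; meas.
Qed.

End fixed.
End vorticity_kernel_bounds.

(** * From the kernel to measures *)

Section Rintegral_not_integrable.
Context {R : realType} d (T : measurableType d) (mu : {measure set T -> \bar R}).
Implicit Types (D : set T) (f : T -> R).

(* [fine] sends both infinities to 0. *)
Lemma Rintegral_not_integrable D f : measurable D -> measurable_fun D f ->
  ~ mu.-integrable D (EFin \o f) -> \int[mu]_(x in D) f x = 0.
Proof.
move=> mD mf nf; rewrite /Rintegral integralE.
have mf' : measurable_fun D (EFin \o f) by exact/measurable_EFinP.
have pos_ge0 : (0 <= \int[mu]_(x in D) ((EFin \o f)^\+ x))%E by apply: integral_ge0.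
have neg_ge0 : (0 <= \int[mu]_(x in D) ((EFin \o f)^\- x))%E by apply: integral_ge0.
have : ~ (\int[mu]_(x in D) ((EFin \o f)^\+ x) + \int[mu]_(x in D) ((EFin \o f)^\- x) < +oo)%E.
  move=> h; apply: nf; apply/integrableP; split => //.
  move: h; rewrite -ge0_integralD//; last 2 first.
    exact: measurable_funepos.
    exact: measurable_funeneg.
  by rewrite -[fun x => `|_|%E]/(abse \o (EFin \o f)) fune_abse.
move: pos_ge0 neg_ge0.
case: (\int[mu]_(x in D) _)%E => [p||]//; case: (\int[mu]_(x in D) _)%E => [q||]//.
by rewrite -EFinD ltry => _ _ [].
Qed.

(** If f is not integrable and c is not 0, then c f is not integrable either and both sides are 0.
    This allows points z where the velocity integral diverges. *)
Lemma RintegralZl_measurable D f (c : R) : measurable D -> measurable_fun D f ->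
  \int[mu]_(x in D) (c * f x) = c * \int[mu]_(x in D) f x.
Proof.
move=> mD mf; have [->|c0] := eqVneq c 0.
  by under eq_Rintegral do rewrite mul0r; rewrite Rintegral_cst// !mul0r.
have [fi|nf] := pselect (mu.-integrable D (EFin \o f)); first exact: RintegralZl.
rewrite (Rintegral_not_integrable mD mf nf) mulr0 Rintegral_not_integrable//.
  exact: measurable_funM.
move=> /(integrableZl_EFin c^-1 mD) h; apply: nf.
by apply: eq_integrable h => // x _ /=; rewrite mulKf.
Qed.

End Rintegral_not_integrable.

Section fubini.
Context {R : realType}.
Notation leb2 := (@lebesgue2 R).
Notation pleb := (@plane_lebesgue R).
Notation H := (@half_plane R).
Let mH : measurable (H : set (plane R)) := measurable_half_plane.

Lemma measurable_green_weight i : measurable_fun setT (green_weight i : plane R -> R).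
Proof. by rewrite /green_weight; case: (i == 0); meas. Qed.

Lemma green_weight_ge0 i (z : R * R) : 0 <= green_weight i z.
Proof. by rewrite /green_weight; case: ifP => _; exact: expR_ge0. Qed.

Section finite_measure.
Variable nu : {finite_measure set (plane R) -> \bar R}.

Definition velocity (i : 'I_2) (z : R * R) : R := \int[nu]_(y in H) Kgreen i z y.

(** Tonelli with z inside: the bound [weight_mass] is uniform in y, and nu is finite. *)
Lemma integrable_weight_Kgreen i :
  (pleb \x nu)%E.-integrable (H `*` H)
    (EFin \o (fun p : plane R * plane R => green_weight i p.1 * Kgreen i p.1 p.2)).
Proof.
apply: (@integrable_prod21 R _ _ _ _ pleb nu H H (fun z y : plane R => green_weight i z * Kgreen i z y)) => //.
  apply: measurable_funM; last by apply: measurable_Kgreen_comp; meas.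
  exact: (measurableT_comp (measurable_green_weight i)).
apply: (@le_lt_trans _ _ (\int[nu]_(y in H) (@weight_mass R))%E).
  apply: ge0_le_integral.
  - exact: mH.
  - by move=> y _; apply: integral_ge0 => z _; rewrite lee_fin.
  - apply: measurable_funTS.
    apply: (measurable_integral_param pleb (f := fun y z : plane R => `|green_weight i z * Kgreen i z y|)) => //.
    apply: measurable_fun_norm; apply: measurable_funM; last by apply: measurable_Kgreen_comp; meas.
    exact: (measurableT_comp (measurable_green_weight i)).
  - exact: measurable_cst.
  - by move=> y _; exact: integral_wKgreen.
have m0 : (0 <= @weight_mass R)%E.
  rewrite /weight_mass le_max; apply/orP; left; apply: integral_ge0 => z _.
  by rewrite lee_fin mulr_ge0 ?expR_ge0.
rewrite integral_cst// lte_mul_pinfty//.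
- by rewrite ge0_fin_numE// weight_mass_fin.
- by rewrite ltey_eq fin_num_measure.
Qed.

Lemma integrable_weight_velocity i :
  leb2.-integrable H (EFin \o (fun z => green_weight i z * velocity i z)).
Proof.
have := integrable_Rintegral_param mH mH (f := fun z y : plane R => green_weight i z * Kgreen i z y)
  (integrable_weight_Kgreen i).
apply: eq_integrable => // z _ /=.
rewrite RintegralZl_measurable//; apply: measurable_funTS.
by apply: measurable_Kgreen_comp; meas.
Qed.

Variables (t : R) (x : R * R).
Hypotheses (t0 : 0 < t) (x0 : 0 < x.2).

(** The decay required of V is that of the weight of the same component, which [V0_bound] and
    [V1_bound] supply; the double integral is then absolutely convergent. *)
Lemma Rintegral_velocity i (V : plane R -> R) (C : R) : measurable_fun setT V ->
  (forall z, H z -> `|V z| <= C * green_weight i z) ->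
  nu.-integrable H (EFin \o (fun y => \int[leb2]_(z in H) (V z * Kgreen i z y))) /\
  \int[leb2]_(z in H) (V z * velocity i z) =
  \int[nu]_(y in H) \int[leb2]_(z in H) (V z * Kgreen i z y).
Proof.
move=> mV VC.
have VK : (pleb \x nu)%E.-integrable (H `*` H)
    (EFin \o (fun p : plane R * plane R => V p.1 * Kgreen i p.1 p.2)).
  apply: (@le_integrable_EFin R _ _ (pleb \x nu)%E _ _
    (fun p : plane R * plane R => C * `|green_weight i p.1 * Kgreen i p.1 p.2|)).
  - exact: measurableX.
  - apply: measurable_funTS; apply: measurable_funM; last by apply: measurable_Kgreen_comp; meas.
    exact: (measurableT_comp mV).
  - apply: integrableZl_EFin; first exact: measurableX.
    exact: integrable_norm (integrable_weight_Kgreen i).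
  - move=> -[z y] [/= Hz _]; rewrite !normrM mulrA (ger0_norm (green_weight_ge0 _ _)).
    by rewrite ler_wpM2r// VC.
split.
  exact: (integrable_Rintegral_param mH mH (f := fun y z : plane R => V z * Kgreen i z y)
    (integrable_prod_swap mH mH (f := fun z y : plane R => V z * Kgreen i z y) VK)).
rewrite -(Rintegral_swap mH mH (m1 := pleb) (f := fun z y : plane R => V z * Kgreen i z y) VK).
apply: eq_Rintegral => z _; rewrite RintegralZl_measurable//; apply: measurable_funTS.
by apply: measurable_Kgreen_comp; meas.
Qed.

Lemma integrable_vort_kernel : nu.-integrable H (EFin \o vort_kernel t x).
Proof.
have [C0 b0] := V0_bound t0 x0; have [C1 b1] := V1_bound x t0.
have [i0 _] := Rintegral_velocity (i := 0) (measurable_V0 t x) b0.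
have [i1 _] := Rintegral_velocity (i := 1) (measurable_V1 t x) b1.
exact: integrableD_EFin.
Qed.

Lemma Rintegral_vort_kernel :
  \int[leb2]_(z in H) (V0 t x z * velocity 0 z) + \int[leb2]_(z in H) (V1 t x z * velocity 1 z) =
  \int[nu]_(y in H) vort_kernel t x y.
Proof.
have [C0 b0] := V0_bound t0 x0; have [C1 b1] := V1_bound x t0.
have [i0 ->] := Rintegral_velocity (i := 0) (measurable_V0 t x) b0.
have [i1 ->] := Rintegral_velocity (i := 1) (measurable_V1 t x) b1.
by rewrite -RintegralD.
Qed.

End finite_measure.

Variable mu : {charge set (plane R) -> \bar R}.
Let hahn := projT2 (cid (Hahn_pair mu)).

Lemma biot_savartE i z : H z ->
  biot_savart mu i z = velocity (jordan_pos hahn) i z - velocity (jordan_neg hahn) i z.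
Proof.
move=> Hz; rewrite /biot_savart /charge_integral /velocity.
by congr (_ - _); apply: eq_Rintegral => y /set_mem Hy; rewrite grad_perp_green.
Qed.

Lemma vorticity_opE t x : 0 < t -> 0 < x.2 ->
  vorticity_op t mu x = \int[jordan_pos hahn]_(y in H) vort_kernel t x y -
    \int[jordan_neg hahn]_(y in H) vort_kernel t x y.
Proof.
move=> t0 x0; set np := jordan_pos hahn; set nn := jordan_neg hahn.
have wi i : leb2.-integrable H (EFin \o (fun z => green_weight i z * biot_savart mu i z)).
  have := integrableB_EFin mH (integrable_weight_velocity np i) (integrable_weight_velocity nn i).
  apply: eq_integrable => // z /set_mem Hz /=.
  by rewrite biot_savartE// mulrBr.
rewrite /vorticity_op (curl_stokes_sgroup t0 x0 (wi 0) (wi 1)).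
have e0 : \int[leb2]_(z in H) (V0 t x z * biot_savart mu 0 z) =
   \int[leb2]_(z in H) (V0 t x z * velocity np 0 z) - \int[leb2]_(z in H) (V0 t x z * velocity nn 0 z).
  rewrite -RintegralB//.
  - by apply: eq_Rintegral => z /set_mem Hz; rewrite biot_savartE// mulrBr.
  - exact: (integrable_V0 (u := velocity np) t0 x0 (integrable_weight_velocity np 0)).
  - exact: (integrable_V0 (u := velocity nn) t0 x0 (integrable_weight_velocity nn 0)).
have e1 : \int[leb2]_(z in H) (V1 t x z * biot_savart mu 1 z) =
   \int[leb2]_(z in H) (V1 t x z * velocity np 1 z) - \int[leb2]_(z in H) (V1 t x z * velocity nn 1 z).
  rewrite -RintegralB//.
  - by apply: eq_Rintegral => z /set_mem Hz; rewrite biot_savartE// mulrBr.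
  - exact: (integrable_V1 (u := velocity np) x t0 (integrable_weight_velocity np 1)).
  - exact: (integrable_V1 (u := velocity nn) x t0 (integrable_weight_velocity nn 1)).
rewrite e0 e1 addrACA -opprD.
by rewrite (Rintegral_vort_kernel np t0 x0) (Rintegral_vort_kernel nn t0 x0).
Qed.

End fubini.

(** * Interpolation between the sup norm and the L^1 norm *)

Section Lnorm_interpolation.
Context {R : realType} d (T : measurableType d) (mu : {measure set T -> \bar R}).

(** For finite q = r, it suffices to integrate |f|^r <= B^(r - 1) |f|. *)
Lemma Lnorm_interpolation (D : set T) (f : T -> R) (B L : R) (q : \bar R) :
  (1 <= q)%E -> measurable D -> measurable_fun D f -> 0 <= B -> 0 <= L ->
  (forall x, D x -> `|f x| <= B) -> (\int[mu]_(x in D) `|f x|%:E <= L%:E)%E ->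
  ('N[mu]_q[(EFin \o f) \_ D] <= (B `^ (1 - fine (q^-1)%E) * L `^ fine (q^-1)%E)%:E)%E.
Proof.
move=> q1 mD mf B0 L0 fB fL; rewrite unlock /Lnorm.
case: q q1 => [r| |]//= r1.
- rewrite lee_fin in r1; have r0 : 0 < r by exact: lt_le_trans r1.
  have -> : fine (r%:E^-1)%E = r^-1 by rewrite inver gt_eqF.
  have nf : measurable_fun D (fun x => `|f x|) by exact: measurable_fun_norm.
  have I : (\int[mu]_x `| ((EFin \o f) \_ D) x | `^ r <= (B `^ (r - 1) * L)%:E)%E.
    rewrite (eq_integral (fun x => ((fun x => (`|f x| `^ r)%:E) \_ D) x)); last first.
      move=> x _; rewrite !patchE; case: ifP => //= _.
      by rewrite normr0 powR0// gt_eqF.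
    rewrite -integral_mkcond.
    apply: (@le_trans _ _ (\int[mu]_(x in D) ((B `^ (r - 1))%:E * `|f x|%:E))%E).
      apply: ge0_le_integral => //.
      - by apply/measurable_EFinP; apply: (measurableT_comp (measurable_powR r)).
      - by apply: emeasurable_funM => //; exact/measurable_EFinP.
      - move=> x Dx; rewrite -EFinM lee_fin -mulr_powRB1// mulrC ler_wpM2r//.
        by apply: ge0_ler_powR; rewrite ?nnegrE ?subr_ge0 ?fB.
    rewrite ge0_integralZl//; last 2 first.
      exact/measurable_EFinP.
      by rewrite lee_fin powR_ge0.
    by rewrite EFinM lee_wpmul2l// lee_fin powR_ge0.
  have I0 : (0 <= \int[mu]_x `| ((EFin \o f) \_ D) x | `^ r)%E.
    by apply: integral_ge0 => x _; exact: poweR_ge0.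
  apply: (@le_trans _ _ (((B `^ (r - 1) * L) `^ r^-1)%:E)).
    rewrite -poweR_EFin; apply: gt0_ler_poweR => //.
    - by rewrite invr_ge0 ltW.
    - by rewrite in_itv/= I0 leey.
    - by rewrite in_itv/= lee_fin mulr_ge0 ?powR_ge0// leey.
  by rewrite lee_fin powRM ?powR_ge0// -powRrM mulrBl divff ?gt_eqF// mul1r.
(* For q = +oo the exponents are 1 and 0, and L^0 is 1 even if L = 0. The case split is on whether
   the whole space has positive measure, which the norm at +oo distinguishes. *)
- rewrite subr0 powRr1// powRr0 mulr1; case: ifP => _; last by rewrite lee_fin.
  apply/ess_supP; apply: nearW => x /=; rewrite patchE; case: ifPn => xD /=.
    by rewrite lee_fin fB//; exact: set_mem.
  by rewrite normr0 lee_fin.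
Qed.

End Lnorm_interpolation.

(** * Decay of the integral of [kappa] *)

Section kappa_limit.
Context {R : realType}.
Notation H := (@half_plane R).
Let mH : measurable (H : set (plane R)) := measurable_half_plane.

Lemma cvg_gauss0 : gauss t 0 @[t --> +oo] --> (0 : R).
Proof.
have e : \forall t \near +oo, Num.sqrt ((4 * pi)^-1 * t^-1) = gauss t 0 :> R.
  near=> t; have t0 : 0 <= t by near: t; exact: nbhs_pinfty_ge.
  by rewrite gauss0 -invfM sqrtrV// !mulr_ge0// pi_ge0.
apply: cvg_trans (near_eq_cvg e) _.
have c : (4 * pi)^-1 * t^-1 @[t --> +oo] --> (0 : R).
  rewrite -[X in _ --> X](mulr0 (4 * pi)^-1); apply: cvgMr.
  by apply/gtr0_cvgV0; [exact: nbhs_pinfty_gt|exact: cvg_id].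
have := cvg_comp _ _ c (@sqrt_continuous R 0); rewrite sqrtr0; exact.
Unshelve. all: by end_near. Qed.

Lemma kappa_ge0 t b : 0 <= b -> 0 <= kappa t b :> R.
Proof. by move=> b0; rewrite /kappa le_min ler01 !mulr_ge0 ?gauss_ge0. Qed.

Lemma kappa_le1 t b : kappa t b <= 1 :> R.
Proof. by rewrite /kappa ge_min lexx. Qed.

Variable nu : {finite_measure set (plane R) -> \bar R}.

Definition kappa_mass t : R := \int[nu]_(y in H) kappa t y.2.

Let mkappa t : measurable_fun (H : set (plane R)) (fun y => kappa t y.2).
Proof.
apply: measurable_funTS; rewrite /kappa; apply: measurable_minr => //; meas.
Qed.

Let integrable1 : nu.-integrable H (EFin \o (fun=> 1)).
Proof.
apply/integrableP; split; first by apply/measurable_EFinP.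
rewrite (eq_integral (cst 1%E)); last by move=> y _; rewrite /= normr1.
by rewrite integral_cst// mul1e ltey_eq fin_num_measure.
Qed.

Lemma integrable_kappa t : nu.-integrable H (EFin \o (fun y => kappa t y.2)).
Proof.
apply: (@le_integrable_EFin R _ _ nu _ _ (fun=> 1)) => // y Hy.
by rewrite ger0_norm ?kappa_le1// kappa_ge0// ltW.
Qed.

Lemma kappa_mass_ge0 t : 0 <= kappa_mass t.
Proof. by apply: Rintegral_ge0 => y Hy; rewrite kappa_ge0// ltW. Qed.

Lemma cvg_kappa_mass : kappa_mass t @[t --> +oo] --> 0.
Proof.
(* Dominated convergence is about sequences, so the limit is tested along every sequence of times
   tending to infinity. *)
apply/cvg_pinftyP => u uy; rewrite /kappa_mass.
have -> : 0 = \int[nu]_(y in H) (0 : R) by rewrite Rintegral_cst// mul0r.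
apply: (cvg_Rintegral_dom (g := fun=> 1)) => //.
- move=> y Hy.
  have g : gauss (u n) 0 @[n --> \oo] --> (0 : R) by exact: (cvg_comp u (fun t => gauss t 0) uy cvg_gauss0).
  apply: (@squeeze_cvgr _ _ _ _ (fun=> 0) (fun n => 8 * y.2 * gauss (u n) 0)).
  + by near=> n; rewrite kappa_ge0 ?(ltW Hy)//= /kappa ge_min lexx orbT.
  + exact: cvg_cst.
  + by rewrite -[X in _ --> X](mulr0 (8 * y.2)); apply: cvgMr.
- by move=> n y Hy; rewrite ger0_norm ?kappa_le1// kappa_ge0// ltW.
Unshelve. all: by end_near. Qed.

End kappa_limit.

(** * Norm estimates for T(t) *)

Section vorticity_bounds.
Context {R : realType}.
Notation leb2 := (@lebesgue2 R).
Notation pleb := (@plane_lebesgue R).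
Notation H := (@half_plane R).
Let mH : measurable (H : set (plane R)) := measurable_half_plane.

Section finite_measure.
Variable nu : {finite_measure set (plane R) -> \bar R}.
Variable t : R.
Hypothesis t0 : 0 < t.

Let vort x : R := \int[nu]_(y in H) vort_kernel t x y.

Lemma measurable_Rintegral_vort_kernel : measurable_fun setT (vort : plane R -> R).
Proof.
by apply: (@measurable_Rintegral_param R _ _ _ _ nu H (fun x y : plane R => vort_kernel t x y)) => //;
  exact: measurable_vort_kernel.
Qed.

Lemma norm_Rintegral_vort_kernel_le x : 0 < x.2 ->
  `|vort x| <= gauss t 0 ^+ 2 * (3 * kappa_mass nu t).
Proof.
move=> x0; rewrite mulrA [gauss t 0 ^+ 2 * 3]mulrC /kappa_mass -RintegralZl//; last exact: integrable_kappa.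
apply: le_normr_Rintegral_dom => //.
- by apply: integrable_EFin_measurable => //; exact: integrable_vort_kernel.
- by apply: integrableZl_EFin => //; exact: integrable_kappa.
- by move=> y Hy; exact: norm_vort_kernel_le.
Qed.

Lemma integral_norm_Rintegral_vort_kernel_le :
  (\int[leb2]_(x in H) `|vort x|%:E <= (3 * kappa_mass nu t)%:E)%E.
Proof.
have mW : measurable_fun setT (fun p : plane R * plane R => `|vort_kernel t p.1 p.2|).
  by apply: measurable_fun_norm; exact: measurable_vort_kernel.
apply: (@le_trans _ _ (\int[pleb]_(x in H) \int[nu]_(y in H) `|vort_kernel t x y|%:E)%E).
  apply: ge0_le_integral => //.
  - apply/measurable_EFinP; apply: measurable_funTS; apply: measurable_fun_norm.
    exact: measurable_Rintegral_vort_kernel.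
  - apply: measurable_funTS.
    by apply: (measurable_integral_param nu (f := fun x y : plane R => `|vort_kernel t x y|)).
  - move=> x x0; have i := integrable_vort_kernel nu t0 x0.
    rewrite /vort /Rintegral -abse_EFin fineK; last exact: integrable_fin_num i.
    by apply: (le_trans (le_abse_integral _ _ (measurable_int _ i))).
rewrite (ge0_integral_swap pleb nu (f := fun x y : plane R => `|vort_kernel t x y|))//.
rewrite /kappa_mass -RintegralZl//; last exact: integrable_kappa.
have i3 : nu.-integrable H (EFin \o (fun y => 3 * kappa t y.2)).
  by apply: integrableZl_EFin => //; exact: integrable_kappa.
rewrite /Rintegral fineK; last exact: integrable_fin_num i3.
apply: ge0_le_integral => //.
- by move=> y _; apply: integral_ge0 => x _; rewrite lee_fin.
- apply: measurable_funTS.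
  apply: (measurable_integral_param pleb (f := fun y x : plane R => `|vort_kernel t x y|)) => //.
  have sw : measurable_fun setT (fun p : plane R * plane R => (p.2, p.1)) by meas.
  exact: (measurableT_comp mW sw).
- exact: measurable_int i3.
- by move=> y Hy; exact: integral_norm_vort_kernel_le.
Qed.

End finite_measure.

Variable mu : {charge set (plane R) -> \bar R}.
Let hahn := projT2 (cid (Hahn_pair mu)).
Let np := jordan_pos hahn.
Let nn := jordan_neg hahn.

(** A common majorant: it bounds the L^1 norm of the vorticity and, multiplied by [gauss t 0 ^+ 2],
    its sup norm. *)
Definition vort_mass t : R := 3 * kappa_mass np t + 3 * kappa_mass nn t.

Lemma vort_mass_ge0 t : 0 <= vort_mass t.
Proof. by rewrite addr_ge0// mulr_ge0// kappa_mass_ge0. Qed.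

Lemma cvg_vort_mass : vort_mass t @[t --> +oo] --> (0 : R).
Proof.
rewrite -[X in _ --> X](addr0 (0 : R)); apply: cvgD.
- by rewrite -[X in _ --> X](mulr0 3); apply: cvgMr; exact: cvg_kappa_mass.
- by rewrite -[X in _ --> X](mulr0 3); apply: cvgMr; exact: cvg_kappa_mass.
Qed.

Let vort (nu : {finite_measure set (plane R) -> \bar R}) (t : R) (x : R * R) : R := \int[nu]_(y in H) vort_kernel t x y.

(** With s = 1 / q and M the mass, interpolation gives (t g(0)^2 M)^(1 - s) M^s, in which the powers
    of M add up to M itself. *)
Lemma Lq_norm_vorticity_op_le (t : R) (q : \bar R) : (1 <= q)%E -> 0 < t ->
  ((t `^ (1 - fine (q^-1)%E))%:E * Lq_norm q (vorticity_op t mu) <= (vort_mass t)%:E)%E.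
Proof.
move=> q1 t0.
have mv (nu : {finite_measure set (plane R) -> \bar R}) : measurable_fun H (fun x => `|vort nu t x|).
  by apply: measurable_funTS; apply: measurable_fun_norm; exact: measurable_Rintegral_vort_kernel.
have M0 := vort_mass_ge0 t.
have N : (Lq_norm q (vorticity_op t mu) <= ((gauss t 0 ^+ 2 * vort_mass t) `^ (1 - fine (q^-1)%E) *
    vort_mass t `^ fine (q^-1)%E)%:E)%E.
  apply: Lnorm_interpolation => //.
  - apply: (eq_measurable_fun (fun x => vort np t x - vort nn t x)).
      by move=> x /set_mem x0; rewrite vorticity_opE.
    by apply: measurable_funTS; apply: measurable_funB; exact: measurable_Rintegral_vort_kernel.
  - by rewrite mulr_ge0// sqr_ge0.
  - move=> x x0; rewrite vorticity_opE// mulrDr.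
    apply: (le_trans (ler_normB _ _)); apply: lerD; exact: norm_Rintegral_vort_kernel_le.
  - apply: (@le_trans _ _ (\int[leb2]_(x in H) (`|vort np t x|%:E + `|vort nn t x|%:E))%E).
      apply: ge0_le_integral => //.
      + apply/measurable_EFinP; apply: measurable_fun_norm.
        apply: (eq_measurable_fun (fun x => vort np t x - vort nn t x)).
          by move=> x /set_mem x0; rewrite vorticity_opE.
        by apply: measurable_funTS; apply: measurable_funB; exact: measurable_Rintegral_vort_kernel.
      + by apply: emeasurable_funD; apply/measurable_EFinP; exact: mv.
      + by move=> x x0; rewrite vorticity_opE// -EFinD lee_fin ler_normB.
    rewrite ge0_integralD//; try by apply/measurable_EFinP; exact: mv.
    by rewrite EFinD leeD// integral_norm_Rintegral_vort_kernel_le.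
apply: (@le_trans _ _ ((t `^ (1 - fine (q^-1)%E))%:E * ((gauss t 0 ^+ 2 * vort_mass t) `^ (1 - fine (q^-1)%E) *
    vort_mass t `^ fine (q^-1)%E)%:E)%E).
  by rewrite lee_wpmul2l// lee_fin powR_ge0.
have s1 : 0 <= 1 - fine (q^-1)%E.
  case: q q1 {N} => [r| |]//= r1.
  rewrite lee_fin in r1; rewrite inver gt_eqF ?(lt_le_trans ltr01)//=.
  by rewrite subr_ge0 invf_le1 ?(lt_le_trans ltr01).
move: (fine _) s1 {N} => s s1.
rewrite -EFinM lee_fin powRM ?sqr_ge0// !mulrA -powRM ?sqr_ge0 ?(ltW t0)//.
(* The power of t in the statement is exactly compensated; the remaining constant (4 pi)^(s - 1) is
   at most 1. *)
have -> : t * gauss t 0 ^+ 2 = (4 * pi)^-1.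
  rewrite gauss0 exprVn sqr_sqrtr ?mulr_ge0 ?pi_ge0 ?(ltW t0)//.
  move: (lt0r_neq0 (pi_gt0 R)) (lt0r_neq0 t0); move: (@pi R) => p pn tn.
  by field; rewrite ?pn ?tn.
rewrite -mulrA -powRD; last by rewrite subrK oner_eq0.
rewrite subrK powRr1// -[leRHS]mul1r ler_wpM2r//.
have c1 : (4 * pi)^-1 <= 1 :> R.
  by rewrite invf_le1 ?mulr_gt0 ?pi_gt0//; have := pi_ge2 R; lra.
apply: (@le_trans _ _ (1 `^ (1 - s))); last by rewrite powR1.
by apply: ge0_ler_powR; rewrite ?nnegrE ?invr_ge0 ?mulr_ge0 ?pi_ge0.
Qed.

End vorticity_bounds.

(* For q = +oo, (q^-1)%E = 0, so the exponent is 1. *)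
Theorem theorem4p7 (R : realType) (omega0 : {charge set (plane R) -> \bar R})
    (omega0_supp : supported_in_closed_half_plane omega0)
    (q : \bar R) (q_ge1 : (1 <= q)%E) :
  ((t `^ (1 - fine (q^-1)%E))%:E * Lq_norm q (vorticity_op t omega0))%E
    @[t --> +oo%R] --> 0%E.
Proof.
apply: (@squeeze_cvge _ _ _ _ (fun=> 0%E) _ (fun t => (vort_mass omega0 t)%:E)).
- near=> t; apply/andP; split.
    by rewrite mule_ge0 ?lee_fin ?powR_ge0//; exact: Lnorm_ge0.
  by apply: Lq_norm_vorticity_op_le => //; near: t; exact: nbhs_pinfty_gt.
- exact: cvg_cst.
- by apply: cvg_EFin; [exact: nearW|exact: cvg_vort_mass].
Unshelve. all: by end_near. Qed.
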